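(* A state $\rho$ is quantum Schnorr random if and only if for every computable measure machine $C$ and every $\epsilon>0$ there is a constant $d>0$ such that $QK^{\epsilon}_C(\rho_n)>n-d$ for all $n$.
   Context: A computable measure machine is a prefix-free Turing machine $C$ whose domain has computable Lebesgue measure $\sum_{\pi\in\operatorname{dom}(C)}2^{-|\pi|}$. Outputs of machines are interpreted as finite sets of vectors with complex algebraic entries via a fixed canonical effective indexing; $C(\pi)\downarrow=F$ means $C$ on input $\pi$ halts with output the code of $F$. $\mathbb{C}^{2^n}_{alg}$ denotes the vectors in $\mathbb{C}^{2^n}$ with complex algebraic entries. Logarithms are base 2. For a density matrix $\tau$ on $\mathbb{C}^{2^n}$ write $|\tau|=n$, and for $\epsilon>0$ define $QK^{\epsilon}_C(\tau)=\inf\{|\pi|+\log|F| : C(\pi)\downarrow=F,\ F \text{ an orthonormal subset of } \mathbb{C}^{2^{|\tau|}}_{alg},\ \sum_{v\in F}\langle v|\tau|v\rangle>\epsilon\}$, with $\inf\emptyset=\infty$. A state is a sequence $\rho=(\rho_n)_{n\in\mathbb{N}}$ of density matrices $\rho_n$ on $\mathbb{C}^{2^n}$ such that the partial trace of $\rho_n$ over the last qubit equals $\rho_{n-1}$. A special projection is a Hermitian projection matrix with complex algebraic entries. For a special projection $S$ on $\mathbb{C}^{2^n}$ put $\tau(S)=2^{-n}\operatorname{Tr}(S)$ and $\rho(S)=\operatorname{Tr}(\rho_nS)$. A strong Solovay test is a computable sequence $(S^m)_m$ of special projections with $\sum_m\tau(S^m)<\infty$; $\rho$ fails it at level $\epsilon>0$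 if $\rho(S^m)>\epsilon$ for infinitely many $m$, and passes it if it fails it at no level $\epsilon>0$. A quantum Schnorr test is a strong Solovay test $(S^m)_m$ such that $\sum_m\tau(S^m)$ is a computable real number. A state is quantum Schnorr random if it passes every quantum Schnorr test. *)

(* Defs.v *)
From HB Require Import structures.
From mathcomp Require Import all_boot all_order all_algebra.
From mathcomp Require Import all_classical all_reals.
From mathcomp Require Import ereal esum exp.
From mathcomp Require Import complex.
From mathcomp Require Import Rstruct.

Set Implicit Arguments.
Unset Strict Implicit.
Unset Printing Implicit Defensive.

Import Order.TTheory GRing.Theory Num.Theory.

(* Cantor unpairing: enumerates N x N along the diagonals
   (0,0),(1,0),(0,1),(2,0),(1,1),(0,2),... *)
Fixpoint unpair (n : nat) : nat * nat :=
  if n is m.+1 then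
    let: (x, y) := unpair m in
    if x is x'.+1 then (x', y.+1) else (y.+1, 0)
  else (0, 0).

Definition npair (x y : nat) : nat := ((x + y) * (x + y).+1)./2 + y.

Inductive prf : Type :=
| PZero
| PSucc
| PId
| PFst
| PSnd
| PComp (f g : prf)
| PPair (f g : prf)
| PRec (f g : prf)
| PMu (f : prf).

Inductive peval : prf -> nat -> nat -> Prop :=
| ev_zero x : peval PZero x 0
| ev_succ x : peval PSucc x x.+1
| ev_id x : peval PId x x
| ev_fst x : peval PFst x (unpair x).1
| ev_snd x : peval PSnd x (unpair x).2
| ev_comp f g x y z : peval g x y -> peval f y z -> peval (PComp f g) x z
| ev_pair f g x y z : peval f x y -> peval g x z -> peval (PPair f g) x (npair y z)
| ev_rec0 f g a y : peval f a y -> peval (PRec f g) (npair 0 a) y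
| ev_recS f g n a y z :
    peval (PRec f g) (npair n a) y ->
    peval g (npair n (npair y a)) z -> peval (PRec f g) (npair n.+1 a) z
| ev_mu f x n :
    peval f (npair n x) 0 ->
    (forall k, (k < n)%N -> exists2 v, v != 0%N & peval f (npair k x) v) ->
    peval (PMu f) x n.

Definition total_prog (e : prf) : Prop := forall x, exists y, peval e x y.

(* Effective bijection between binary strings and natural numbers
   (bijective base-2 numeration). *)
Fixpoint bcode (s : seq bool) : nat :=
  if s is b :: s' then (bcode s').*2 + (if b then 2 else 1) else 0.

(* Effective decoding of nat into finite sequences of nat:
   0 |-> [::],  (npair x c).+1 |-> x :: decode c. *)
Fixpoint seq_dec_fuel (fuel n : nat) : seq nat :=
  if fuel is f.+1 then
    (if n is m.+1 then (unpair m).1 :: seq_dec_fuel f (unpair m).2 else [::])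
  else [::].
Definition seq_dec (n : nat) : seq nat := seq_dec_fuel n n.

Definition int_dec (a : nat) : int :=
  if odd a then (- Posz (a.+1)./2)%R else Posz a./2.
Definition rat_dec (n : nat) : rat :=
  ((int_dec (unpair n).1)%:~R / ((unpair n).2.+1)%:R)%R.

Local Open Scope ring_scope.

Notation RR := Rdefinitions.R.
Definition C : Type := RR[i].

Definition computable_real (x : RR) : Prop :=
  exists e : prf, forall k : nat, exists q : nat,
    peval e k q /\ `|x - ratr (rat_dec q)| <= 2 ^- k.

Definition log2 (x : RR) : RR := ln x / ln 2.

Definition is_algebraic (z : C) : Prop :=
  exists p : {poly rat}, p != 0 /\ root (map_poly (ratr : rat -> C) p) z.

(* Code c = <pc, <a, <b, r>>> denotes the unique root z of the nonzero
   rational polynomial with coefficient list (seq_dec pc) lying in the open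
   disk of (rational) center a + b i and (rational) radius r. *)
Definition alg_dec (c : nat) (z : C) : Prop :=
  let pc := (unpair c).1 in
  let a := (unpair (unpair c).2).1 in
  let b := (unpair (unpair (unpair c).2).2).1 in
  let r := (unpair (unpair (unpair c).2).2).2 in
  let p : {poly C} := Poly [seq ratr (rat_dec k) | k <- seq_dec pc] in
  let ctr : C := Complex (ratr (rat_dec a)) (ratr (rat_dec b)) in
  let rad : C := Complex (ratr (rat_dec r)) 0 in
  [/\ p != 0, root p z, `|z - ctr| < rad &
      forall w : C, root p w -> `|w - ctr| < rad -> w = z].

Definition vec_dec (N : nat) (c : nat) (v : 'cV[C]_N) : Prop :=
  size (seq_dec c) = N /\
  forall i : 'I_N, alg_dec (nth 0%N (seq_dec c) i) (v i 0).

Definition vset_dec (N : nat) (c : nat) (F : seq 'cV[C]_N) : Prop :=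
  size F = size (seq_dec c) /\
  forall k, (k < size F)%N -> vec_dec (nth 0%N (seq_dec c) k) (F`_k).

Definition mx_dec (N : nat) (c : nat) (S : 'M[C]_N) : Prop :=
  size (seq_dec c) = N /\
  forall i : 'I_N, vec_dec (nth 0%N (seq_dec c) i) (row i S)^T.

Definition sqmx_dec (y : nat) (n : nat) (S : 'M[C]_(2 ^ n)) : Prop :=
  (unpair y).1 = n /\ mx_dec (unpair y).2 S.

Local Open Scope sesquilinear_scope.

Definition density_matrix (N : nat) (A : 'M[C]_N) : Prop :=
  [/\ A ^t* = A,
      forall v : 'cV[C]_N, 0 <= (v ^t* *m A *m v) 0 0 &
      \tr A = 1].

Lemma qidx_proof (m : nat) (i : 'I_(2 ^ m)) (b : bool) :
  (i.*2 + b < 2 ^ m.+1)%N.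
Proof.
rewrite expnS mul2n; have := ltn_ord i => lt.
have : (i.*2.+2 <= (2 ^ m).*2)%N by rewrite -doubleS leq_double.
by case: b => /= h; apply: leq_trans h; rewrite ?addn1 ?addn0.
Qed.

(* basis index |i>|b> of C^(2^m) (x) C^2 = C^(2^(m+1)); b is the last qubit *)
Definition qidx (m : nat) (i : 'I_(2 ^ m)) (b : bool) : 'I_(2 ^ m.+1) :=
  Ordinal (qidx_proof i b).

Definition ptrace_last (m : nat) (A : 'M[C]_(2 ^ m.+1)) : 'M[C]_(2 ^ m) :=
  \matrix_(i, j) \sum_(b : bool) A (qidx i b) (qidx j b).

Definition is_state (rho : forall n : nat, 'M[C]_(2 ^ n)) : Prop :=
  (forall n, density_matrix (rho n)) /\
  (forall n, ptrace_last (rho n.+1) = rho n).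

Definition special_projection (N : nat) (S : 'M[C]_N) : Prop :=
  [/\ S ^t* = S, S *m S = S & forall i j, is_algebraic (S i j)].

(* tau(S) = 2^-n Tr(S)  (a real number, Tr S being real) *)
Definition tauS (n : nat) (S : 'M[C]_(2 ^ n)) : RR :=
  2 ^- n * complex.Re (\tr S).

Definition rhoS (rho : forall n : nat, 'M[C]_(2 ^ n)) (n : nat)
  (S : 'M[C]_(2 ^ n)) : C := \tr (rho n *m S).

Definition computable_sp_seq (dim : nat -> nat)
  (S : forall m, 'M[C]_(2 ^ dim m)) : Prop :=
  (forall m, special_projection (S m)) /\
  exists e : prf, forall m, exists y, peval e m y /\ sqmx_dec y (S m).

Definition strong_solovay_test (dim : nat -> nat)
  (S : forall m, 'M[C]_(2 ^ dim m)) : Prop :=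
  computable_sp_seq S /\
  (\esum_(m in [set: nat]) (tauS (S m))%:E < +oo)%E.

Definition quantum_schnorr_test (dim : nat -> nat)
  (S : forall m, 'M[C]_(2 ^ dim m)) : Prop :=
  strong_solovay_test S /\
  exists r : RR,
    (\esum_(m in [set: nat]) (tauS (S m))%:E = r%:E)%E /\ computable_real r.

Definition fails_at (rho : forall n : nat, 'M[C]_(2 ^ n)) (dim : nat -> nat)
  (S : forall m, 'M[C]_(2 ^ dim m)) (eps : RR) : Prop :=
  forall N : nat, exists2 m : nat, (N <= m)%N &
    Complex eps 0 < rhoS rho (S m).

Definition passes (rho : forall n : nat, 'M[C]_(2 ^ n)) (dim : nat -> nat)
  (S : forall m, 'M[C]_(2 ^ dim m)) : Prop :=
  forall eps : RR, 0 < eps -> ~ fails_at rho S eps.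

Definition quantum_schnorr_random (rho : forall n : nat, 'M[C]_(2 ^ n)) : Prop :=
  forall (dim : nat -> nat) (S : forall m, 'M[C]_(2 ^ dim m)),
    quantum_schnorr_test S -> passes rho S.

Definition halts_on (M : prf) (p : seq bool) : Prop :=
  exists y, peval M (bcode p) y.

Definition prefix_free_machine (M : prf) : Prop :=
  forall p q : seq bool, halts_on M p -> halts_on M q -> prefix p q -> p = q.

(* Lebesgue measure of the domain: sum over pi in dom(M) of 2^-|pi| *)
Definition domain_measure (M : prf) : \bar RR :=
  (\esum_(p in [set p | halts_on M p]) ((2 : RR) ^- size p)%:E)%E.

Definition computable_measure_machine (M : prf) : Prop :=
  prefix_free_machine M /\
  exists r : RR, domain_measure M = r%:E /\ computable_real r.

Definition orthonormal (N : nat) (F : seq 'cV[C]_N) : Prop :=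
  forall i j, (i < size F)%N -> (j < size F)%N ->
    ((F`_i) ^t* *m F`_j) 0 0 = (i == j)%:R.

Definition QK (M : prf) (eps : RR) (n : nat) (tau : 'M[C]_(2 ^ n)) : \bar RR :=
  ereal_inf [set x : \bar RR | exists (p : seq bool) (y : nat)
      (F : seq 'cV[C]_(2 ^ n)),
    [/\ peval M (bcode p) y, vset_dec y F, orthonormal F,
        Complex eps 0 < \sum_(v <- F) (v ^t* *m tau *m v) 0 0 &
        x = ((size p)%:R + log2 (size F)%:R)%:E]].

(* Main.v *)
(* Both directions replace algebraic data by Gaussian rational data.  Given the
   code of an algebraic number, a total procedure returns rational
   approximations (junk on invalid codes); totality needs a computable lower
   bound for the distance of a root in the open isolating disk to its boundary,
   which comes from the fact that the nonzero eigenvalues of a Gaussian integer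
   matrix are bounded away from 0.  By the Cayley transform Gaussian rational
   unitaries are dense, so near every Hermitian projection there is one with an
   exactly orthonormal Gaussian rational frame, and such a frame is found by
   unbounded search.  Traces against a density matrix move by at most the
   entrywise l1 distance, so the replacement only costs an arbitrarily small
   part of epsilon.

   Random implies incompressible: clocked evaluation enumerates the domain of the
   machine, and a program p whose output F has |p| + log |F| <= n contributes a
   projection of tau-mass |F| 2^-n <= 2^-|p|; the sum of the masses converges
   computably because the domain measure does.

   Incompressible implies random: computability of the sum of tau(S^m) gives
   computable weights G(m) -> oo for which the sum of G(m) tau(S^m) still
   converges computably to at most 1; a Kraft-Chaitin machine then describes a
   frame of S^m with n - log |F| - log G(m) + O(1) bits. *)
Require Import Defs.
From HB Require Import structures.
From mathcomp Require Import all_boot all_order all_algebra.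
From mathcomp Require Import all_classical all_reals.
From mathcomp Require Import ereal esum exp.
From mathcomp Require Import topology normedtype sequences.
From mathcomp Require Import complex.
From mathcomp Require Import Rstruct.
From mathcomp Require Import zify ring lra.
Import Order.TTheory GRing.Theory Num.Theory.
Local Open Scope ring_scope.

Set Implicit Arguments.
Unset Strict Implicit.
Unset Printing Implicit Defensive.

(** * Pairing and programs *)

(** The proof never verifies a machine output exactly: neither the validity of a code of an
    algebraic number nor the orthonormality of the coded vectors is tested. Hence approximation is
    total, with explicit search bounds, orthonormality is tested only up to a margin exponentially
    small in n, and whatever passes the margin is replaced by a genuine projection of the same rank.
    Exactness returns through Gaussian rational frames: they give test projections with algebraic
    entries and integer trace, and machine outputs with explicit codes. Ranks survive the
    replacement because natural traces that differ by less than 1 are equal.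

    Computability of a sum is always used as a computable bound on its tails, a property inherited
    by termwise smaller series. This makes the sum of test masses computable from the domain
    measure, and conversely makes the domain measure of the constructed machine computable from the
    weighted test sum. *)

Lemma npair_diag (y : nat) : npair y.+1 0 = (npair 0 y).+1.
Proof.
rewrite /npair !addn0 !add0n.
have -> : (y.+1 * y.+2 = y * y.+1 + y.+1.*2)%N by lia.
by rewrite halfD odd_double andbF add0n doubleK addnS.
Qed.

Lemma npairS (x y : nat) : npair x y.+1 = (npair x.+1 y).+1.
Proof. by rewrite /npair addnS addSn addnS. Qed.

Lemma unpairS (n : nat) : unpair n.+1 =
  let: (x, y) := unpair n in if x is x'.+1 then (x', y.+1) else (y.+1, 0%N).
Proof. by []. Qed.

(** [unpair] recurses on the code, so the induction is on [npair x y]: one step back leads from (x,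
    y+1) to (x+1, y) and from (x+1, 0) to (0, x). *)
Lemma unpair_npair (x y : nat) : unpair (npair x y) = (x, y).
Proof.
have [n] := ubnP (npair x y); elim: n x y => // n IH x [|y].
  case: x => [//|x]; rewrite npair_diag ltnS => h.
  by rewrite unpairS IH.
by rewrite npairS ltnS => h; rewrite unpairS IH.
Qed.

Lemma npair_unpair (n : nat) : npair (unpair n).1 (unpair n).2 = n.
Proof.
elim: n => // n; rewrite unpairS; case: (unpair n) => [[|x] y] IH.
  by rewrite npair_diag IH.
by rewrite npairS IH.
Qed.

Lemma unpair1_le (n : nat) : ((unpair n).1 <= n)%N.
Proof.
rewrite -{2}[n]npair_unpair /npair.
set x := (unpair n).1; set y := (unpair n).2.
have : ((x + y).*2 <= (x + y) * (x + y).+1 + 1)%N by nia.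
move/half_leq; rewrite doubleK halfD /=.
case: (odd _) => /=; rewrite ?addn0; first by nia.
by rewrite add0n => h; apply: leq_trans (leq_trans h _); lia.
Qed.

Lemma unpair2_le (n : nat) : ((unpair n).2 <= n)%N.
Proof. by rewrite -{2}[n]npair_unpair /npair leq_addl. Qed.

(** Bounds the codes of grid points later on; the halving in [npair] is simply dropped. *)
Lemma npair_le (x y B : nat) : (x <= B)%N -> (y <= B)%N ->
  (npair x y <= 4 * B * B + 3 * B)%N.
Proof.
move=> hx hy; rewrite /npair.
have : (((x + y) * (x + y).+1)./2 <= (x + y) * (x + y).+1)%N.
  by rewrite -divn2 leq_div.
by nia.
Qed.

(** The indices [npair n a] of [peval] are not patterns, so inversion is phrased through the
    components of [unpair x]. *)
Lemma peval_inv (e : prf) (x y : nat) : peval e x y ->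
  match e with
  | PZero => y = 0%N
  | PSucc => y = x.+1
  | PId => y = x
  | PFst => y = (unpair x).1
  | PSnd => y = (unpair x).2
  | PComp f g => exists2 u, peval g x u & peval f u y
  | PPair f g => exists u v, [/\ peval f x u, peval g x v & y = npair u v]
  | PRec f g =>
      if (unpair x).1 is n.+1 then
        exists2 u, peval (PRec f g) (npair n (unpair x).2) u &
                   peval g (npair n (npair u (unpair x).2)) y
      else peval f (unpair x).2 y
  | PMu f => peval f (npair y x) 0 /\
      forall k, (k < y)%N -> exists2 v, v != 0%N & peval f (npair k x) v
  end.
Proof.
case=> {e x y}; rewrite ?unpair_npair //.
- by move=> f g x y z h1 h2; exists y.
- by move=> f g x y z h1 h2; exists y, z.
- by move=> f g a y; rewrite unpair_npair.
- by move=> f g n a y z h1 h2; rewrite unpair_npair; exists y.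
Qed.

Lemma peval_fun (e : prf) (x y z : nat) : peval e x y -> peval e x z -> y = z.
Proof.
elim: e x y z => [|||||f IHf g IHg|f IHf g IHg|f IHf g IHg|f IHf] x y z.
1-5: by move=> /peval_inv -> /peval_inv ->.
- move=> /peval_inv[u h1 h2] /peval_inv[v h3 h4].
  by move: h4; rewrite -(IHg _ _ _ h1 h3); apply: IHf.
- move=> /peval_inv[u [v [h1 h2 ->]]] /peval_inv[u' [v' [h3 h4 ->]]].
  by rewrite (IHf _ _ _ h1 h3) (IHg _ _ _ h2 h4).
- rewrite -[x]npair_unpair; elim: (unpair x).1 y z => [|n IH] y z.
    by move=> /peval_inv + /peval_inv; rewrite unpair_npair; apply: IHf.
  move=> /peval_inv + /peval_inv; rewrite unpair_npair.
  move=> [u h1 h2] [v h3 h4].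
  by move: h4; rewrite -(IH _ _ h1 h3); apply: IHg.
- move=> /peval_inv[h1 h2] /peval_inv[h3 h4].
  case: (ltngtP y z) => // lt.
    by have [v v0 /(IHf _ _ _ h1) e] := h4 _ lt; rewrite -e in v0.
  by have [v v0 /(IHf _ _ _ h3) e] := h2 _ lt; rewrite -e in v0.
Qed.

(** * Represented types and computable functions *)

(* [rep x a] reads: the number x is a code of a.  An object may have many codes
   or none, so real and complex numbers can be represented through their
   rational and Gaussian rational elements. *)
Class Rep (T : Type) := rep : nat -> T -> Prop.

#[export] Instance Rep_nat : Rep nat := fun x n => x = n.
#[export] Instance Rep_bool : Rep bool := fun x b => x = nat_of_bool b.
#[export] Instance Rep_pair (A B : Type) (rA : Rep A) (rB : Rep B) :
  Rep (A * B) := fun x p => rep (unpair x).1 p.1 /\ rep (unpair x).2 p.2.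

(** Realizability of a total function: every code of a must be sent to some code of f a. Points
    without a code impose nothing, so on [RR] and [C] only rational and Gaussian rational arguments
    matter. *)
Definition computable (A B : Type) (rA : Rep A) (rB : Rep B) (f : A -> B) :=
  exists e, forall x a, rep x a -> exists2 y, peval e x y & rep y (f a).
Arguments computable {A B rA rB} f.

Section Closure.
Context {A B D S : Type} {rA : Rep A} {rB : Rep B} {rD : Rep D} {rS : Rep S}.

Lemma comp_ext (f g : A -> B) : f =1 g -> computable f -> computable g.
Proof. by move=> fg [e he]; exists e => x a /he; rewrite fg. Qed.

Lemma comp_id : computable (fun a : A => a).
Proof. by exists PId => x a; exists x => //; constructor. Qed.

Lemma comp_comp (g : B -> D) (f : A -> B) :
  computable g -> computable f -> computable (fun a => g (f a)).
Proof.
move=> [eg hg] [ef hf]; exists (PComp eg ef) => x a /hf[y p1 /hg[z p2 h]].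
by exists z => //; apply: ev_comp p1 p2.
Qed.

Lemma comp_pair (f : A -> B) (g : A -> D) :
  computable f -> computable g -> computable (fun a => (f a, g a)).
Proof.
move=> [ef hf] [eg hg]; exists (PPair ef eg) => x a xa.
have [y p1 h1] := hf _ _ xa; have [z p2 h2] := hg _ _ xa.
exists (npair y z); first exact: ev_pair.
by rewrite /rep /Rep_pair unpair_npair.
Qed.

Lemma comp_fst (f : A -> B * D) : computable f -> computable (fun a => (f a).1).
Proof.
move=> [e h]; exists (PComp PFst e) => x a /h[y p1 [h1 _]].
by exists (unpair y).1 => //; apply: ev_comp p1 (ev_fst _).
Qed.

Lemma comp_snd (f : A -> B * D) : computable f -> computable (fun a => (f a).2).
Proof.
move=> [e h]; exists (PComp PSnd e) => x a /h[y p1 [_ h1]].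
by exists (unpair y).2 => //; apply: ev_comp p1 (ev_snd _).
Qed.

Lemma comp_const (b : B) : (exists x, rep x b) -> computable (fun _ : A => b).
Proof.
move=> [x xb].
suff [e he] : exists e, forall y, peval e y x.
  by exists e => y a _; exists x.
elim: {xb} x => [|x [e he]]; first by exists PZero => y; constructor.
by exists (PComp PSucc e) => y; apply: ev_comp (he y) (ev_succ _).
Qed.

Lemma comp_iteri (n : A -> nat) (s0 : A -> S) (g : A -> nat -> S -> S) :
  computable n -> computable s0 ->
  computable (fun p : A * (nat * S) => g p.1 p.2.1 p.2.2) ->
  computable (fun a => iteri (n a) (g a) (s0 a)).
Proof.
move=> [en hn] [e0 h0] [eg hg].
(* [PRec] hands its step the triple (m, (y, x)), whereas g is realized on (x, (m, y)). *)
pose arr := PPair (PComp PSnd PSnd) (PPair PFst (PComp PFst PSnd)).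
exists (PComp (PRec e0 (PComp eg arr)) (PPair en PId)) => x a xa.
have [m p1 h1] := hn _ _ xa; rewrite -h1.
suff [y py hy] : exists2 y, peval (PRec e0 (PComp eg arr)) (npair m x) y &
    @rep S rS y (iteri m (g a) (s0 a)).
  by exists y => //; apply: ev_comp py; apply: ev_pair p1 (ev_id _).
elim: {p1 h1} m => [|m [y py hy]].
  by have [y py hy] := h0 _ _ xa; exists y => //; apply: (ev_rec0 _ py).
have [|z pz hz] := hg (npair x (npair m y)) (a, (m, iteri m (g a) (s0 a))).
  split; rewrite unpair_npair; first exact: xa.
  by split; rewrite unpair_npair; [|exact: hy].
exists z => //; apply: ev_recS py _; apply: ev_comp pz.
have uE : unpair (npair m (npair y x)) = (m, npair y x) by rewrite unpair_npair.
have vE : unpair (npair y x) = (y, x) by rewrite unpair_npair.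
have e1 : peval PSnd (npair m (npair y x)) (npair y x).
  by rewrite -[X in peval _ _ X]/((m, npair y x).2) -uE; constructor.
apply: ev_pair; last apply: ev_pair.
- by apply: ev_comp e1 _; rewrite -[X in peval _ _ X]/((y, x).2) -vE; constructor.
- by rewrite -[X in peval _ _ X]/((m, npair y x).1) -uE; constructor.
- by apply: ev_comp e1 _; rewrite -[X in peval _ _ X]/((y, x).1) -vE; constructor.
Qed.
End Closure.

Ltac comp_proj := repeat match goal with
  | |- computable (fun a => a) => apply: comp_id
  | |- computable (fun a => (@?f a).1) => apply: (comp_fst (f := f))
  | |- computable (fun a => (@?f a).2) => apply: (comp_snd (f := f))
  | |- computable fst => apply: (comp_fst (f := id))
  | |- computable snd => apply: (comp_snd (f := id))
  end.


(** * Arithmetic on naturals and booleans by iteration *)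

Lemma comp_nat {A : Type} {rA : Rep A} (n : nat) : computable (fun _ : A => n).
Proof. by apply: comp_const; exists n. Qed.

Lemma comp_boolc {A : Type} {rA : Rep A} (b : bool) : computable (fun _ : A => b).
Proof. by apply: comp_const; exists (nat_of_bool b). Qed.

Lemma comp_succ {A : Type} {rA : Rep A} (f : A -> nat) :
  computable f -> computable (fun a => (f a).+1).
Proof.
by apply: comp_comp; exists PSucc => x a ->; exists a.+1 => //; constructor.
Qed.

Lemma comp_bool {A : Type} {rA : Rep A} (b : A -> bool) :
  computable b -> computable (fun a => nat_of_bool (b a)).
Proof. by []. Qed.

Lemma comp_unpair {A : Type} {rA : Rep A} (f : A -> nat) :
  computable f -> computable (fun a => unpair (f a)).
Proof.
by move=> [e h]; exists e => x a /h[y p e1]; exists y => //; rewrite e1.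
Qed.

Lemma comp_npair {A : Type} {rA : Rep A} (f g : A -> nat) :
  computable f -> computable g -> computable (fun a => npair (f a) (g a)).
Proof.
move=> [e h] [e' h']; exists (PPair e e') => x a xa.
have [y p1 h1] := h _ _ xa; have [z p2 h2] := h' _ _ xa.
by exists (npair y z); [apply: ev_pair | rewrite h1 h2].
Qed.

Lemma comp_if {A B : Type} {rA : Rep A} {rB : Rep B} (b : A -> bool)
  (u v : A -> B) : computable b -> computable u -> computable v ->
  computable (fun a => if b a then u a else v a).
Proof.
move=> hb hu hv.
apply: (@comp_ext _ _ _ _ (fun a => iteri (b a) (fun _ _ => u a) (v a))).
  by move=> a; case: (b a).
apply: comp_iteri => //; apply: (comp_comp hu); comp_proj.
Qed.

Lemma comp_add {A : Type} {rA : Rep A} (f g : A -> nat) :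
  computable f -> computable g -> computable (fun a => f a + g a)%N.
Proof.
move=> hf hg.
apply: (@comp_ext _ _ _ _ (fun a => iteri (f a) (fun _ s => s.+1) (g a))).
  by move=> a; elim: (f a) => //= n ->.
by apply: comp_iteri => //; (apply: comp_succ; comp_proj).
Qed.

Lemma comp_pred {A : Type} {rA : Rep A} (f : A -> nat) :
  computable f -> computable (fun a => (f a).-1).
Proof.
move=> hf.
apply: (@comp_ext _ _ _ _ (fun a => iteri (f a) (fun i _ => i) 0%N)).
  by move=> a; case: (f a).
apply: comp_iteri => //; first exact: comp_nat.
by (comp_proj).
Qed.

Lemma comp_sub {A : Type} {rA : Rep A} (f g : A -> nat) :
  computable f -> computable g -> computable (fun a => f a - g a)%N.
Proof.
move=> hf hg.
apply: (@comp_ext _ _ _ _ (fun a => iteri (g a) (fun _ s => s.-1) (f a))).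
  by move=> a; elim: (g a) => [|n /= ->]; rewrite ?subn0 ?subnS.
by apply: comp_iteri => //; (apply: comp_pred; comp_proj).
Qed.

Lemma comp_mul {A : Type} {rA : Rep A} (f g : A -> nat) :
  computable f -> computable g -> computable (fun a => f a * g a)%N.
Proof.
move=> hf hg.
apply: (@comp_ext _ _ _ _ (fun a => iteri (f a) (fun _ s => g a + s)%N 0%N)).
  by move=> a; elim: (f a) => //= n ->; rewrite mulSn.
apply: comp_iteri => //; first exact: comp_nat.
apply: comp_add; last (comp_proj).
by apply: (comp_comp hg); (comp_proj).
Qed.

Lemma comp_expn {A : Type} {rA : Rep A} (f g : A -> nat) :
  computable f -> computable g -> computable (fun a => f a ^ g a)%N.
Proof.
move=> hf hg.
apply: (@comp_ext _ _ _ _ (fun a => iteri (g a) (fun _ s => f a * s)%N 1%N)).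
  by move=> a; elim: (g a) => //= n ->; rewrite expnS.
apply: comp_iteri => //; first exact: comp_nat.
apply: comp_mul; last (comp_proj).
by apply: (comp_comp hf); (comp_proj).
Qed.

Lemma comp_fact {A : Type} {rA : Rep A} (f : A -> nat) :
  computable f -> computable (fun a => (f a)`!).
Proof.
move=> hf.
apply: (@comp_ext _ _ _ _ (fun a => iteri (f a) (fun i s => i.+1 * s)%N 1%N)).
  by move=> a; elim: (f a) => //= n ->; rewrite factS.
apply: comp_iteri => //; first exact: comp_nat.
by apply: comp_mul; [(apply: comp_succ; comp_proj)|
  (comp_proj)].
Qed.

Lemma comp_eq0 {A : Type} {rA : Rep A} (f : A -> nat) :
  computable f -> computable (fun a => f a == 0%N).
Proof.
move=> hf.
apply: (@comp_ext _ _ _ _ (fun a => iteri (f a) (fun _ _ => false) true)).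
  by move=> a; case: (f a).
by apply: comp_iteri => //; apply: comp_boolc.
Qed.

Lemma comp_leq {A : Type} {rA : Rep A} (f g : A -> nat) :
  computable f -> computable g -> computable (fun a => f a <= g a)%N.
Proof. by move=> hf hg; apply: comp_eq0; apply: comp_sub. Qed.

Lemma comp_negb {A : Type} {rA : Rep A} (b : A -> bool) :
  computable b -> computable (fun a => ~~ b a).
Proof.
move=> hb; apply: (@comp_ext _ _ _ _ (fun a => if b a then false else true)).
  by move=> a; case: (b a).
by apply: comp_if => //; apply: comp_boolc.
Qed.

Lemma comp_andb {A : Type} {rA : Rep A} (b c : A -> bool) :
  computable b -> computable c -> computable (fun a => b a && c a).
Proof. by move=> hb hc; apply: comp_if => //; apply: comp_boolc. Qed.

Lemma comp_orb {A : Type} {rA : Rep A} (b c : A -> bool) :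
  computable b -> computable c -> computable (fun a => b a || c a).
Proof. by move=> hb hc; apply: comp_if => //; apply: comp_boolc. Qed.

Lemma comp_eqn {A : Type} {rA : Rep A} (f g : A -> nat) :
  computable f -> computable g -> computable (fun a => f a == g a).
Proof.
move=> hf hg.
apply: (@comp_ext _ _ _ _ (fun a => (f a <= g a) && (g a <= f a))%N).
  by move=> a; rewrite eqn_leq.
by apply: comp_andb; apply: comp_leq.
Qed.

Lemma comp_odd {A : Type} {rA : Rep A} (f : A -> nat) :
  computable f -> computable (fun a => odd (f a)).
Proof.
move=> hf.
apply: (@comp_ext _ _ _ _ (fun a => iteri (f a) (fun _ s => ~~ s) false)).
  by move=> a; elim: (f a) => //= n ->.
by apply: comp_iteri => //; [apply: comp_boolc|
  (apply: comp_negb; comp_proj)].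
Qed.

Lemma comp_half {A : Type} {rA : Rep A} (f : A -> nat) :
  computable f -> computable (fun a => (f a)./2).
Proof.
move=> hf.
apply: (@comp_ext _ _ _ _
  (fun a => iteri (f a) (fun i s => odd i + s)%N 0%N)).
  by move=> a; elim: (f a) => //= n ->; rewrite uphalf_half.
apply: comp_iteri => //; first exact: comp_nat.
by apply: comp_add; [(apply: comp_bool; apply: comp_odd; comp_proj)|
  (comp_proj)].
Qed.

(** * Bounded quantification and minimisation *)

Lemma comp_all_lt {A : Type} {rA : Rep A} (n : A -> nat) (P : A -> nat -> bool) :
  computable n -> computable (fun p : A * nat => P p.1 p.2) ->
  computable (fun a => all (P a) (iota 0 (n a))).
Proof.
move=> hn hP; apply: (@comp_ext _ _ _ _
  (fun a => iteri (n a) (fun i s => s && P a i) true)).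
  move=> a; elim: (n a) => // m IH.
  by rewrite [LHS]/= IH -addn1 iotaD all_cat /= andbT.
apply: comp_iteri => //; first exact: comp_boolc.
apply: comp_andb; first (comp_proj).
apply: (comp_comp (f := fun p => (p.1, p.2.1)) hP).
by apply: comp_pair; comp_proj.
Qed.

(** [PMu] looks for a zero and receives its counter first, hence the negation of P and the swapped
    pair. *)
Lemma comp_mu {A : Type} {rA : Rep A} (P : A -> nat -> bool) (f : A -> nat) :
  computable (fun p : A * nat => P p.1 p.2) ->
  (forall a, P a (f a)) -> (forall a k, (k < f a)%N -> ~~ P a k) ->
  computable f.
Proof.
move=> /comp_negb[e he] Pf Pm.
exists (PMu (PComp e (PPair PSnd PFst))) => x a xa; exists (f a) => //.
have ev k : peval (PComp e (PPair PSnd PFst)) (npair k x) (~~ P a k).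
  have [|y p1 h] := he (npair x k) (a, k).
    by rewrite /rep /Rep_pair unpair_npair.
  rewrite -h; apply: ev_comp p1; rewrite -[npair x k]/(npair (k, x).2 (k, x).1).
  by rewrite -unpair_npair; apply: ev_pair; constructor.
apply: ev_mu; first by have := ev (f a); rewrite Pf.
by move=> k /Pm kP; exists (nat_of_bool (~~ P a k)); rewrite ?kP //; have := ev k; rewrite kP.
Qed.

Lemma comp_search {A : Type} {rA : Rep A} (P : A -> nat -> bool) :
  computable (fun p : A * nat => P p.1 p.2) -> (forall a, exists n, P a n) ->
  exists f, [/\ computable f, forall a, P a (f a) &
    forall a k, (k < f a)%N -> ~~ P a k].
Proof.
move=> hP ex; pose f a := ex_minn (ex a); exists f.
have Pf a : P a (f a) by rewrite /f; case: ex_minnP.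
have Pm a k : (k < f a)%N -> ~~ P a k.
  rewrite /f; case: ex_minnP => m _ hm lt; apply/negP => /hm.
  by rewrite leqNgt lt.
by split=> //; apply: comp_mu hP Pf Pm.
Qed.

(* Extended below as further computable operations become available. *)
Ltac comp_ext0 := fail.
Ltac comp_ext1 := fail.
Ltac comp_ext2 := fail.
Ltac comp1 := lazy beta; match goal with
  | H : computable ?f |- computable ?f => exact H
  | |- computable (fun a => a) => apply: comp_id
  | |- computable fst => apply: (comp_fst (f := id))
  | |- computable snd => apply: (comp_snd (f := id))
  | |- computable (fun _ => ?c) =>
     first [exact: comp_nat | exact: comp_boolc | apply: comp_const; eexists; reflexivity]
  | |- computable (fun a => (@?f a).1) => apply: (comp_fst (f := f))
  | |- computable (fun a => (@?f a).2) => apply: (comp_snd (f := f))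
  | |- computable (fun a => (@?f a, @?g a)) => apply: (comp_pair (f := f) (g := g))
  | |- computable (fun a => (@?f a).+1) => apply: (comp_succ (f := f))
  | |- computable (fun a => (@?f a).-1) => apply: (comp_pred (f := f))
  | |- computable (fun a => unpair (@?f a)) => apply: (comp_unpair (f := f))
  | |- computable (fun a => npair (@?f a) (@?g a)) => apply: (comp_npair (f := f) (g := g))
  | |- computable (fun a => nat_of_bool (@?f a)) => apply: (comp_bool (b := f))
  | |- computable (fun a => addn (@?f a) (@?g a)) => apply: (comp_add (f := f) (g := g))
  | |- computable (fun a => subn (@?f a) (@?g a)) => apply: (comp_sub (f := f) (g := g))
  | |- computable (fun a => muln (@?f a) (@?g a)) => apply: (comp_mul (f := f) (g := g))
  | |- computable (fun a => expn (@?f a) (@?g a)) => apply: (comp_expn (f := f) (g := g))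
  | |- computable (fun a => factorial (@?f a)) => apply: (comp_fact (f := f))
  | |- computable (fun a => leq (@?f a) (@?g a)) => apply: (comp_leq (f := f) (g := g))
  | |- computable (fun a => odd (@?f a)) => apply: (comp_odd (f := f))
  | |- computable (fun a => half (@?f a)) => apply: (comp_half (f := f))
  | |- computable (fun a => negb (@?f a)) => apply: (comp_negb (b := f))
  | |- computable (fun a => andb (@?f a) (@?g a)) => apply: (comp_andb (b := f) (c := g))
  | |- computable (fun a => orb (@?f a) (@?g a)) => apply: (comp_orb (b := f) (c := g))
  | |- computable (fun a => @eq_op Datatypes_nat__canonical__eqtype_Equality
                              (@?f a) (@?g a)) =>
      apply: (comp_eqn (f := f) (g := g))
  | |- computable (fun a => match _ with true => _ | false => _ end) =>
      apply: comp_if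
  | |- computable (fun a => iteri (@?n a) (@?g a) (@?s a)) =>
      apply: (comp_iteri (n := n) (g := g) (s0 := s))
  | |- computable (fun a => all (@?P a) (iota O (@?n a))) =>
      apply: (comp_all_lt (P := P) (n := n))
  | _ => first [comp_ext0 | comp_ext1 | comp_ext2]
  | H : computable ?f |- computable (fun a => ?f (@?g a)) => apply: (comp_comp (f := g) H)
  | H : computable (fun p => ?f p.1 p.2) |- computable (fun a => ?f (@?g a) (@?h a)) =>
      let u := constr:(fun a => (g a, h a)) in
      let K := fresh in pose proof (comp_comp (f := u) H) as K; apply: K
  | H : computable (fun p => ?f p.1 p.2.1 p.2.2) |-
      computable (fun a => ?f (@?g a) (@?h a) (@?k a)) =>
      let u := constr:(fun a => (g a, (h a, k a))) in
      let K := fresh in pose proof (comp_comp (f := u) H) as K; apply: K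
  end.
Ltac comp := repeat comp1.

(** * Sequences *)

Lemma seq_dec_fuelE (f g n : nat) : (n <= f)%N -> (n <= g)%N ->
  seq_dec_fuel f n = seq_dec_fuel g n.
Proof.
elim: f g n => [|f IH] [|g] [|n] //= hf hg; congr cons.
by apply: IH; apply: leq_trans (unpair2_le n) _.
Qed.

Lemma seq_decS (m : nat) : seq_dec m.+1 = (unpair m).1 :: seq_dec (unpair m).2.
Proof.
rewrite {1}/seq_dec [LHS]/=; congr cons.
by apply: seq_dec_fuelE => //; apply: unpair2_le.
Qed.

Fixpoint rep_list (T : Type) (rT : Rep T) (l : seq nat) (s : seq T) : Prop :=
  match l, s with
  | [::], [::] => True
  | x :: l', a :: s' => rep x a /\ rep_list rT l' s'
  | _, _ => False
  end.

#[export] Instance Rep_seq (T : Type) (rT : Rep T) : Rep (seq T) :=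
  fun x s => rep_list rT (seq_dec x) s.

Lemma rep_listP (T : Type) (rT : Rep T) (d : T) (l : seq nat) (s : seq T) :
  rep_list rT l s <-> size l = size s /\
    forall i, (i < size s)%N -> rep (nth 0%N l i) (nth d s i).
Proof.
elim: l s => [|x l IH] [|a s] //=; try by split=> // -[].
split=> [[h /IH[h1 h2]]|[[h1] h2]]; first by rewrite h1; split=> // -[|i] // hi; apply: h2.
by split; [apply: (h2 0%N)|apply/IH; split=> // i; apply: (h2 i.+1)].
Qed.

Lemma rep_seq_nat (x : nat) : rep x (seq_dec x).
Proof.
by apply/(rep_listP _ 0%N); split.
Qed.

(** Entry point for primitive operations: it is enough to realize f by a function on raw codes. *)
Lemma comp_code {A B D : Type} {rA : Rep A} {rB : Rep B} {rD : Rep D}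
  (f : B -> D) (h : nat -> nat) (g : A -> B) :
  computable h -> (forall x b, rep x b -> rep (h x) (f b)) ->
  computable g -> computable (fun a => f (g a)).
Proof.
move=> [e he] hf; apply: comp_comp; exists e => x b xb.
have [y p1 h1] := he x x (erefl x); exists y => //.
by rewrite h1; apply: hf.
Qed.

Lemma comp_seq_dec {A : Type} {rA : Rep A} (f : A -> nat) :
  computable f -> computable (fun a => seq_dec (f a)).
Proof.
apply: (comp_code (h := fun x => x)); first exact: comp_id.
by move=> x b ->; apply: rep_seq_nat.
Qed.

Lemma comp_nil {A B : Type} {rA : Rep A} {rB : Rep B} :
  computable (fun _ : A => [::] : seq B).
Proof. by apply: comp_const; exists 0%N. Qed.

Lemma comp_cons {A B : Type} {rA : Rep A} {rB : Rep B} (f : A -> B)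
  (g : A -> seq B) :
  computable f -> computable g -> computable (fun a => f a :: g a).
Proof.
move=> hf hg; apply: (comp_code (f := fun p : B * seq B => p.1 :: p.2)
  (h := fun x => x.+1) (g := fun a => (f a, g a))); [by comp| |by comp].
by move=> x [b s] [h1 h2]; rewrite /rep /Rep_seq seq_decS.
Qed.

(** [comp_if] would need a head element even when the list is empty. Instead [PRec] runs with
    counter 0 or 1, so that v is evaluated only on a nonempty list; there the predecessor of the
    list code is the code of the pair of head and tail. *)
Lemma comp_case {A B D : Type} {rA : Rep A} {rB : Rep B} {rD : Rep D}
  (s : A -> seq B) (u : A -> D) (v : A -> B -> seq B -> D) :
  computable s -> computable u ->
  computable (fun p : A * (B * seq B) => v p.1 p.2.1 p.2.2) ->
  computable (fun a => if s a is x :: s' then v a x s' else u a).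
Proof.
move=> [es hs] [eu hu] [ev hv].
have [ep hp] : computable (fun x : nat => x.-1) by comp.
have [en hn] : computable (fun x : nat => ~~ (x == 0%N)) by comp.
pose arr := PPair (PComp PSnd PSnd) (PComp ep (PComp es (PComp PSnd PSnd))).
exists (PComp (PRec eu (PComp ev arr)) (PPair (PComp en es) PId)) => x a xa.
have [c pc hc] := hs _ _ xa; have [y py hy] := hu _ _ xa.
have [n pn nE] := hn c c erefl; rewrite /rep /Rep_bool in nE.
have p0 : peval (PPair (PComp en es) PId) x (npair (c != 0%N) x).
  by apply: ev_pair (ev_id _); rewrite -nE; apply: ev_comp pc pn.
have p1 : peval (PRec eu (PComp ev arr)) (npair 0 x) y by apply: ev_rec0.
case: c {nE pn} hc pc p0 => [|c] hc pc p0.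
  exists y; first exact: ev_comp p0 p1.
  by move: hc; rewrite /rep /Rep_seq /=; case: (s a).
move: hc; rewrite /rep /Rep_seq seq_decS; case: (s a) => // b s' [h1 h2].
have [|z pz hz] := hv (npair x c) (a, (b, s')).
  by split; rewrite unpair_npair.
exists z => //; apply: ev_comp p0 _; apply: (ev_recS p1); apply: ev_comp pz.
have e1 : peval (PComp PSnd PSnd) (npair 0 (npair y x)) x.
  apply: (@ev_comp _ _ _ (npair y x)).
    by rewrite -[X in peval _ _ X]/((0%N, npair y x).2) -unpair_npair; constructor.
  by rewrite -[X in peval _ _ X]/((y, x).2) -unpair_npair; constructor.
apply: ev_pair => //; apply: (ev_comp (ev_comp e1 pc)).
by have [m pm mE] := hp c.+1 c.+1 erefl; rewrite /rep /Rep_nat /= in mE; subst m.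
Qed.

Lemma comp_behead {A B : Type} {rA : Rep A} {rB : Rep B} (s : A -> seq B) :
  computable s -> computable (fun a => behead (s a)).
Proof.
move=> hs; apply: (@comp_ext _ _ _ _
  (fun a => if s a is x :: s' then s' else [::])); first by move=> a; case: (s a).
by apply: (comp_case (v := fun _ _ s' => s')) => //; [exact: comp_nil|comp].
Qed.

Lemma comp_drop {A B : Type} {rA : Rep A} {rB : Rep B} (n : A -> nat)
  (s : A -> seq B) :
  computable n -> computable s -> computable (fun a => drop (n a) (s a)).
Proof.
move=> hn hs; apply: (@comp_ext _ _ _ _
  (fun a => iteri (n a) (fun _ t => behead t) (s a))).
  by move=> a; elim: (n a) => [|m /= ->]; rewrite ?drop0 // -drop1 drop_drop.
by comp; apply: comp_behead; comp.
Qed.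

Lemma comp_size {A B : Type} {rA : Rep A} {rB : Rep B} (s : A -> seq B) :
  computable s -> computable (fun a => size (s a)).
Proof.
move=> hs; apply: (comp_mu (P := fun a n => if drop n (s a) is _ :: _ then false
  else true)).
- apply: (comp_case (s := fun p : A * nat => drop p.2 (s p.1))
    (v := fun _ _ _ => false)); try by comp.
  by apply: comp_drop; comp.
- by move=> a; rewrite drop_size.
- by move=> a k; case: (s a) => // b t hk; rewrite (drop_nth b hk).
Qed.

Lemma comp_nth {A B : Type} {rA : Rep A} {rB : Rep B} (d : A -> B)
  (s : A -> seq B) (n : A -> nat) :
  computable d -> computable s -> computable n ->
  computable (fun a => nth (d a) (s a) (n a)).
Proof.
move=> hd hs hn; apply: (@comp_ext _ _ _ _
  (fun a => if drop (n a) (s a) is x :: s' then x else d a)).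
  move=> a; rewrite -{2}[n a]addn0 -nth_drop; by case: drop.
apply: (comp_case (v := fun _ x _ => x)) => //; last by comp.
exact: comp_drop.
Qed.

Lemma comp_foldl {A B D : Type} {rA : Rep A} {rB : Rep B} {rD : Rep D}
  (g : A -> D -> B -> D) (z : A -> D) (s : A -> seq B) :
  computable (fun p : A * (D * B) => g p.1 p.2.1 p.2.2) ->
  computable z -> computable s -> computable (fun a => foldl (g a) (z a) (s a)).
Proof.
move=> hg hz hs; pose step a (i : nat) (t : seq B * D) :=
  if t.1 is x :: s' then (s', g a t.2 x) else t.
apply: (@comp_ext _ _ _ _
  (fun a => (iteri (size (s a)) (step a) (s a, z a)).2)).
  move=> a; suff H k : (k <= size (s a))%N -> iteri k (step a) (s a, z a) =
      (drop k (s a), foldl (g a) (z a) (take k (s a))).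
    by rewrite H // take_size.
  elim: k => [|k IH] hk; first by rewrite drop0 take0.
  have E := drop_nth; case: (s a) hk IH => [//|b0 t0] hk IH.
  rewrite [LHS]/= IH 1?ltnW // /step [(_, _).1]/= (drop_nth b0) //.
  by rewrite (take_nth b0) // -cats1 foldl_cat.
apply: comp_snd; apply: comp_iteri; [exact: comp_size|by comp|].
apply: (comp_case (s := fun p : A * (nat * (seq B * D)) => p.2.2.1)
  (u := fun p => p.2.2) (v := fun p x s' => (s', g p.1 p.2.2.2 x))); by comp.
Qed.

Lemma comp_rev {A B : Type} {rA : Rep A} {rB : Rep B} (s : A -> seq B) :
  computable s -> computable (fun a => rev (s a)).
Proof.
move=> hs; apply: (@comp_ext _ _ _ _
  (fun a => foldl (fun t x => x :: t) [::] (s a))).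
  by move=> a; rewrite -[s a in LHS]revK foldl_rev; elim: (rev _) => //= x t ->.
by apply: comp_foldl => //; [apply: comp_cons; comp|apply: comp_nil].
Qed.

Lemma comp_foldr {A B D : Type} {rA : Rep A} {rB : Rep B} {rD : Rep D}
  (g : A -> B -> D -> D) (z : A -> D) (s : A -> seq B) :
  computable (fun p : A * (B * D) => g p.1 p.2.1 p.2.2) ->
  computable z -> computable s -> computable (fun a => foldr (g a) (z a) (s a)).
Proof.
move=> hg hz hs; apply: (@comp_ext _ _ _ _
  (fun a => foldl (fun t x => g a x t) (z a) (rev (s a)))).
  by move=> a; rewrite foldl_rev.
by apply: comp_foldl => //; [comp|apply: comp_rev].
Qed.

Lemma comp_map {A B D : Type} {rA : Rep A} {rB : Rep B} {rD : Rep D}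
  (g : A -> B -> D) (s : A -> seq B) :
  computable (fun p : A * B => g p.1 p.2) -> computable s ->
  computable (fun a => [seq g a x | x <- s a]).
Proof.
move=> hg hs; apply: (@comp_ext _ _ _ _
  (fun a => foldr (fun x t => g a x :: t) [::] (s a))).
  by move=> a; elim: (s a) => //= x t ->.
by apply: comp_foldr => //; [apply: comp_cons; comp|apply: comp_nil].
Qed.

Lemma comp_mkseq {A B : Type} {rA : Rep A} {rB : Rep B}
  (g : A -> nat -> B) (n : A -> nat) :
  computable (fun p : A * nat => g p.1 p.2) -> computable n ->
  computable (fun a => mkseq (g a) (n a)).
Proof.
move=> hg hn; apply: (@comp_ext _ _ _ _
  (fun a => rev (iteri (n a) (fun i t => g a i :: t) [::]))).
  move=> a; rewrite /mkseq; elim: (n a) => // m IH.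
  by rewrite -addn1 iotaD map_cat -IH addn1 [iteri _ _ _]/= rev_cons cats1 add0n.
apply: comp_rev; apply: comp_iteri => //; first exact: comp_nil.
by apply: comp_cons; comp.
Qed.

Ltac comp_ext0 ::= match goal with
  | |- computable (fun a => nil) => apply: comp_nil
  | |- computable (fun a => cons (@?f a) (@?g a)) => apply: (comp_cons (f := f) (g := g))
  | |- computable (fun a => seq_dec (@?f a)) => apply: (comp_seq_dec (f := f))
  | |- computable (fun a => size (@?f a)) => apply: (comp_size (s := f))
  | |- computable (fun a => nth (@?d a) (@?f a) (@?n a)) =>
      apply: (comp_nth (d := d) (s := f) (n := n))
  | |- computable (fun a => foldr (@?g a) (@?z a) (@?s a)) =>
      apply: (comp_foldr (g := g) (z := z) (s := s))
  | |- computable (fun a => map (@?g a) (@?s a)) => apply: (comp_map (g := g) (s := s))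
  | |- computable (fun a => mkseq (@?g a) (@?n a)) => apply: (comp_mkseq (g := g) (n := n))
  end.

(** * Rational and Gaussian rational numbers *)

Definition decR (x : nat) : RR := ratr (rat_dec x).
Definition decC (x : nat) : C := Complex (decR (unpair x).1) (decR (unpair x).2).

#[export] Instance Rep_R : Rep RR := fun x r => decR x = r.
#[export] Instance Rep_C : Rep C := fun x z => decC x = z.

(** A coded rational is handled as ([rpos] - [rneg]) / ([rden] + 1) with natural entries, so that
    field operations become arithmetic in nat. Odd numerator codes stand for negative integers,
    which explains the predecessor in [mkrat]. *)
Definition rpos (x : nat) : nat :=
  let a := (unpair x).1 in if odd a then 0%N else a./2.
Definition rneg (x : nat) : nat :=
  let a := (unpair x).1 in if odd a then a.+1./2 else 0%N.
Definition rden (x : nat) : nat := (unpair x).2.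
Definition mkrat (u v w : nat) : nat :=
  npair (if (v <= u)%N then ((u - v) * 2)%N else ((v - u) * 2).-1) w.

Lemma decRE (x : nat) :
  decR x = ((rpos x)%:R - (rneg x)%:R) / (rden x).+1%:R.
Proof.
rewrite /decR /rat_dec /rpos /rneg /rden /int_dec rmorphM fmorphV rmorph_nat.
congr (_ / _); case: odd; rewrite rmorph_int ?mulrNz ?sub0r ?subr0 //.
Qed.

Lemma decR_mkrat (u v w : nat) : decR (mkrat u v w) = (u%:R - v%:R) / w.+1%:R.
Proof.
rewrite /decR /rat_dec /mkrat unpair_npair rmorphM fmorphV rmorph_nat /int_dec.
congr (_ / _); rewrite rmorph_int; case: leqP => h; rewrite !muln2.
  by rewrite odd_double doubleK -pmulrn natrB.
have e : ((v - u).*2 = ((v - u).*2.-1).+1)%N by rewrite prednK // double_gt0 subn_gt0.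
have o : odd (v - u).*2.-1.
  by move: (odd_double (v - u)); rewrite e /=; move/negbFE.
by rewrite o -e doubleK mulrNz -pmulrn natrB 1?ltnW // opprB.
Qed.

Lemma comp_rpos {A : Type} {rA : Rep A} (f : A -> nat) :
  computable f -> computable (fun a => rpos (f a)).
Proof. by move=> hf; rewrite /rpos; comp. Qed.

Lemma comp_rneg {A : Type} {rA : Rep A} (f : A -> nat) :
  computable f -> computable (fun a => rneg (f a)).
Proof. by move=> hf; rewrite /rneg; comp. Qed.

Lemma comp_rden {A : Type} {rA : Rep A} (f : A -> nat) :
  computable f -> computable (fun a => rden (f a)).
Proof. by move=> hf; rewrite /rden; comp. Qed.

Lemma comp_mkrat {A : Type} {rA : Rep A} (f g h : A -> nat) :
  computable f -> computable g -> computable h ->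
  computable (fun a => mkrat (f a) (g a) (h a)).
Proof. by move=> hf hg hh; rewrite /mkrat; comp. Qed.

Ltac comp_ext1 ::= match goal with
  | |- computable (fun a => rpos (@?f a)) => apply: (comp_rpos (f := f))
  | |- computable (fun a => rneg (@?f a)) => apply: (comp_rneg (f := f))
  | |- computable (fun a => rden (@?f a)) => apply: (comp_rden (f := f))
  | |- computable (fun a => mkrat (@?f a) (@?g a) (@?h a)) =>
      apply: (comp_mkrat (f := f) (g := g) (h := h))
  end.

Lemma comp_decR {A : Type} {rA : Rep A} (f : A -> nat) :
  computable f -> computable (fun a => decR (f a)).
Proof.
by apply: (comp_code (h := fun x => x)); [comp|move=> x b ->].
Qed.

Lemma comp_decC {A : Type} {rA : Rep A} (f : A -> nat) :
  computable f -> computable (fun a => decC (f a)).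
Proof.
by apply: (comp_code (h := fun x => x)); [comp|move=> x b ->].
Qed.

Lemma comp_addR {A : Type} {rA : Rep A} (f g : A -> RR) :
  computable f -> computable g -> computable (fun a => f a + g a).
Proof.
move=> hf hg; pose h x := let: (y, z) := unpair x in
  mkrat (rpos y * (rden z).+1 + rpos z * (rden y).+1)
        (rneg y * (rden z).+1 + rneg z * (rden y).+1)
        ((rden y).+1 * (rden z).+1).-1.
apply: (comp_code (f := fun p : RR * RR => p.1 + p.2) (h := h)
  (g := fun a => (f a, g a))); last by comp.
  apply: (@comp_ext _ _ _ _ (fun x => let y := (unpair x).1 in
    let z := (unpair x).2 in
    mkrat (rpos y * (rden z).+1 + rpos z * (rden y).+1)
        (rneg y * (rden z).+1 + rneg z * (rden y).+1)
        ((rden y).+1 * (rden z).+1).-1)).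
    by move=> x; rewrite /h; case: (unpair x).
  by lazy zeta; comp.
move=> x [r s] []; rewrite /h /rep /Rep_R; case: (unpair x) => y z <- <-.
rewrite decR_mkrat !decRE prednK ?muln_gt0 // !natrD !natrM.
by field; rewrite !nat1r !pnatr_eq0.
Qed.

Lemma comp_mulR {A : Type} {rA : Rep A} (f g : A -> RR) :
  computable f -> computable g -> computable (fun a => f a * g a).
Proof.
move=> hf hg; pose h x := let y := (unpair x).1 in let z := (unpair x).2 in
  mkrat (rpos y * rpos z + rneg y * rneg z)
        (rpos y * rneg z + rneg y * rpos z)
        ((rden y).+1 * (rden z).+1).-1.
apply: (comp_code (f := fun p : RR * RR => p.1 * p.2) (h := h)
  (g := fun a => (f a, g a))); last by comp.
  by rewrite /h; lazy zeta; comp.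
move=> x [r s] []; rewrite /h /rep /Rep_R; case: (unpair x) => y z <- <-.
rewrite decR_mkrat !decRE prednK ?muln_gt0 // !natrD !natrM.
by field; rewrite !nat1r !pnatr_eq0.
Qed.

Lemma comp_oppR {A : Type} {rA : Rep A} (f : A -> RR) :
  computable f -> computable (fun a => - f a).
Proof.
apply: (comp_code (h := fun x => mkrat (rneg x) (rpos x) (rden x))); first by comp.
move=> x r; rewrite /rep /Rep_R => <-.
by rewrite decR_mkrat decRE -mulNr opprB.
Qed.

Lemma comp_leR {A : Type} {rA : Rep A} (f g : A -> RR) :
  computable f -> computable g -> computable (fun a => f a <= g a).
Proof.
move=> hf hg; pose h x := let y := (unpair x).1 in let z := (unpair x).2 in
  nat_of_bool (rpos y * (rden z).+1 + rneg z * (rden y).+1 <=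
   rpos z * (rden y).+1 + rneg y * (rden z).+1)%N.
apply: (comp_code (f := fun p : RR * RR => p.1 <= p.2) (h := h)
  (g := fun a => (f a, g a))); last by comp.
  by rewrite /h; lazy zeta; comp.
move=> x [r s] [/=]; rewrite /h /rep /Rep_R /Rep_bool.
case: (unpair x) => y z /= <- <-; congr nat_of_bool.
rewrite !decRE ler_pdivrMr ?ltr0n // mulrAC ler_pdivlMr ?ltr0n //.
rewrite -(ler_nat RR) !natrD !natrM.
by apply/idP/idP => ?; lra.
Qed.

Lemma comp_natR {A : Type} {rA : Rep A} (f : A -> nat) :
  computable f -> computable (fun a => (f a)%:R : RR).
Proof.
apply: (comp_code (f := fun n => n%:R : RR) (h := fun x => mkrat x 0 0));
  first by comp.
by move=> x n ->; rewrite /rep /Rep_R decR_mkrat subr0 divr1.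
Qed.

Lemma comp_invS {A : Type} {rA : Rep A} (f : A -> nat) :
  computable f -> computable (fun a => ((f a).+1%:R : RR)^-1).
Proof.
apply: (comp_code (f := fun n => (n.+1%:R : RR)^-1) (h := fun x => mkrat 1 0 x));
  first by comp.
by move=> x n ->; rewrite /rep /Rep_R decR_mkrat subr0 mul1r.
Qed.

Lemma comp_inv2X {A : Type} {rA : Rep A} (f : A -> nat) :
  computable f -> computable (fun a => (2 : RR) ^- (f a)).
Proof.
move=> hf; apply: (@comp_ext _ _ _ _
  (fun a => (((2 ^ f a).-1).+1%:R : RR)^-1)).
  by move=> a; rewrite prednK ?expn_gt0 // natrX.
by apply: comp_invS; comp.
Qed.

Lemma comp_eqR {A : Type} {rA : Rep A} (f g : A -> RR) :
  computable f -> computable g -> computable (fun a => f a == g a).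
Proof.
move=> hf hg; apply: (@comp_ext _ _ _ _ (fun a => (f a <= g a) && (g a <= f a))).
  by move=> a; rewrite eq_le.
by apply: comp_andb; apply: comp_leR.
Qed.

Lemma comp_ltR {A : Type} {rA : Rep A} (f g : A -> RR) :
  computable f -> computable g -> computable (fun a => f a < g a).
Proof.
move=> hf hg; apply: (@comp_ext _ _ _ _ (fun a => ~~ (g a <= f a))).
  by move=> a; rewrite ltNge.
by apply: comp_negb; apply: comp_leR.
Qed.

Lemma comp_Complex {A : Type} {rA : Rep A} (f g : A -> RR) :
  computable f -> computable g -> computable (fun a => Complex (f a) (g a) : C).
Proof.
move=> hf hg; apply: (comp_code (f := fun p : RR * RR => Complex p.1 p.2 : C)
  (h := fun x => x) (g := fun a => (f a, g a))); [by comp| |by comp].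
by move=> x [r s] [/= h1 h2]; rewrite /rep /Rep_C /decC h1 h2.
Qed.

Lemma comp_Re {A : Type} {rA : Rep A} (f : A -> C) :
  computable f -> computable (fun a => complex.Re (f a)).
Proof.
by apply: (comp_code (h := fun x => (unpair x).1)); [comp|move=> x z <-].
Qed.

Lemma comp_Im {A : Type} {rA : Rep A} (f : A -> C) :
  computable f -> computable (fun a => complex.Im (f a)).
Proof.
by apply: (comp_code (h := fun x => (unpair x).2)); [comp|move=> x z <-].
Qed.

Ltac comp_ext2 ::= match goal with
  | |- computable (fun a => decR (@?f a)) => apply: (comp_decR (f := f))
  | |- computable (fun a => decC (@?f a)) => apply: (comp_decC (f := f))
  | |- computable (fun a => @GRing.inv _ (@GRing.exp _ _ (@?f a))) =>
      apply: (comp_inv2X (f := f))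
  | |- computable (fun a => @GRing.add _ (@?f a) (@?g a)) =>
      apply: (comp_addR (f := f) (g := g))
  | |- computable (fun a => @GRing.mul _ (@?f a) (@?g a)) =>
      apply: (comp_mulR (f := f) (g := g))
  | |- computable (fun a => @GRing.opp _ (@?f a)) => apply: (comp_oppR (f := f))
  | |- computable (fun a => @GRing.natmul _ _ (@?f a)) => apply: (comp_natR (f := f))
  | |- computable (fun a => @Order.le _ _ (@?f a) (@?g a)) =>
      apply: (comp_leR (f := f) (g := g))
  | |- computable (fun a => @Order.lt _ _ (@?f a) (@?g a)) =>
      apply: (comp_ltR (f := f) (g := g))
  | |- computable (fun a => @eq_op _ (@?f a) (@?g a)) =>
      apply: (comp_eqR (f := f) (g := g))
  | |- computable (fun a => Complex (@?f a) (@?g a)) =>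
      apply: (comp_Complex (f := f) (g := g))
  | |- computable (fun a => complex.Re (@?f a)) => apply: (comp_Re (f := f))
  | |- computable (fun a => complex.Im (@?f a)) => apply: (comp_Im (f := f))
  end.

(** * Arithmetic of Gaussian rationals and finite sums *)

Lemma comp_addC {A : Type} {rA : Rep A} (f g : A -> C) :
  computable f -> computable g -> computable (fun a => f a + g a).
Proof.
move=> hf hg; apply: (@comp_ext _ _ _ _ (fun a =>
  Complex (complex.Re (f a) + complex.Re (g a))
          (complex.Im (f a) + complex.Im (g a)) : C)).
  by move=> a; case: (f a) => ? ?; case: (g a).
by comp.
Qed.

Lemma comp_oppC {A : Type} {rA : Rep A} (f : A -> C) :
  computable f -> computable (fun a => - f a).
Proof.
move=> hf; apply: (@comp_ext _ _ _ _ (fun a =>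
  Complex (- complex.Re (f a)) (- complex.Im (f a)) : C)).
  by move=> a; case: (f a).
by comp.
Qed.

Lemma comp_mulC {A : Type} {rA : Rep A} (f g : A -> C) :
  computable f -> computable g -> computable (fun a => f a * g a).
Proof.
move=> hf hg; apply: (@comp_ext _ _ _ _ (fun a =>
  Complex (complex.Re (f a) * complex.Re (g a) - complex.Im (f a) * complex.Im (g a))
          (complex.Re (f a) * complex.Im (g a) + complex.Im (f a) * complex.Re (g a))
  : C)).
  by move=> a; case: (f a) => ? ?; case: (g a).
by comp.
Qed.

Lemma comp_conjC {A : Type} {rA : Rep A} (f : A -> C) :
  computable f -> computable (fun a => (f a)^*).
Proof.
move=> hf; apply: (@comp_ext _ _ _ _ (fun a =>
  Complex (complex.Re (f a)) (- complex.Im (f a)) : C)).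
  by move=> a; case: (f a).
by comp.
Qed.

Lemma comp_eqC {A : Type} {rA : Rep A} (f g : A -> C) :
  computable f -> computable g -> computable (fun a => f a == g a).
Proof.
move=> hf hg; apply: (@comp_ext _ _ _ _ (fun a =>
  (complex.Re (f a) == complex.Re (g a)) && (complex.Im (f a) == complex.Im (g a)))).
  by move=> a; rewrite -eq_complex.
by comp.
Qed.

Lemma comp_natC {A : Type} {rA : Rep A} (f : A -> nat) :
  computable f -> computable (fun a => (f a)%:R : C).
Proof.
move=> hf; apply: (@comp_ext _ _ _ _ (fun a => Complex (f a)%:R 0 : C)).
  by move=> a; rewrite complexr0 rmorph_nat.
by comp; apply: comp_const; exists 0%N; rewrite /rep /Rep_R decRE /= subr0 mul0r.
Qed.

(** The summand takes a natural rather than an ordinal, so that the number of terms may itself be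
    computed. *)
Definition bsum (V : nmodType) (n : nat) (F : nat -> V) : V := \sum_(i < n) F i.

Lemma comp_bsumR {A : Type} {rA : Rep A} (n : A -> nat) (F : A -> nat -> RR) :
  computable n -> computable (fun p : A * nat => F p.1 p.2) ->
  computable (fun a => bsum (n a) (F a)).
Proof.
move=> hn hF; apply: (@comp_ext _ _ _ _
  (fun a => iteri (n a) (fun i s => s + F a i) 0)).
  by move=> a; rewrite /bsum; elim: (n a) => [|m /= ->];
    rewrite ?big_ord0 // big_ord_recr.
apply: comp_iteri => //; last by comp.
by apply: comp_const; exists 0%N; rewrite /rep /Rep_R decRE /= subr0 mul0r.
Qed.

Lemma comp_bsumC {A : Type} {rA : Rep A} (n : A -> nat) (F : A -> nat -> C) :
  computable n -> computable (fun p : A * nat => F p.1 p.2) ->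
  computable (fun a => bsum (n a) (F a)).
Proof.
move=> hn hF; apply: (@comp_ext _ _ _ _
  (fun a => iteri (n a) (fun i s => s + F a i) 0)).
  by move=> a; rewrite /bsum; elim: (n a) => [|m /= ->];
    rewrite ?big_ord0 // big_ord_recr.
apply: comp_iteri => //; last by apply: comp_addC; comp.
by apply: (comp_natC (f := fun _ => 0%N)); comp.
Qed.

(** * Clocked evaluation *)

(* [clock M r]: r x t is y.+1 if M on x yields y within the time bound t, and 0
   if no value has been found yet. *)
Definition clock (M : prf) (r : nat -> nat -> nat) : Prop :=
  [/\ computable (fun p : nat * nat => r p.1 p.2),
      forall x t t' y, (t <= t')%N -> r x t = y.+1 -> r x t' = y.+1 &
      forall x y, peval M x y <-> exists t, r x t = y.+1].

Lemma clock_basic (M : prf) (f : nat -> nat) : computable f ->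
  (forall x, peval M x (f x)) -> exists r, clock M r.
Proof.
move=> hf hM; exists (fun x _ => (f x).+1); split => // [|x y].
  by comp.
split=> [/peval_fun h|[_ [<-]] //].
by exists 0%N; rewrite -(h _ (hM x)).
Qed.

(** State of the search for the least zero within time t: 0 while all values seen are known and
    nonzero, 1 once a value is not yet available, n+2 once the zero n is found. Since [r] returns
    the value plus one, a zero shows as [r = 1]. *)
Definition mu_step (r : nat -> nat -> nat) (x t i s : nat) : nat :=
  if s == 0%N then
    if r (npair i x) t == 0%N then 1%N
    else if r (npair i x) t == 1%N then i.+2 else 0%N
  else s.

Lemma mu_stepP (r : nat -> nat -> nat) (x t j : nat) :
  (iteri j (mu_step r x t) 0 = 0 <->
     forall k, (k < j)%N -> (1 < r (npair k x) t)%N)%N /\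
  (forall n, iteri j (mu_step r x t) 0 = n.+2 <->
     [/\ (n < j)%N, r (npair n x) t = 1 &
      forall k, (k < n)%N -> (1 < r (npair k x) t)%N])%N.
Proof.
elim: j => [|j [IH0 IHS]]; first by split=> // n; split=> // -[].
rewrite [iteri _ _ _]/=; set s := iteri j _ _ in IH0 IHS *.
rewrite /mu_step; case: (eqVneq s 0%N) => [s0|sn0].
  move/IH0: s0 => all1; case: eqVneq => [r0|r0].
    split=> [|n]; split=> //; first by move/(_ _ (ltnSn j)); rewrite r0.
    case; rewrite ltnS leq_eqVlt => /orP[/eqP -> //|lt rn]; first by rewrite r0.
    by move: (all1 _ lt); rewrite rn.
  case: eqVneq => [r1|r1].
    split=> [|n]; split=> //; first by move/(_ _ (ltnSn j)); rewrite r1.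
      by case=> <-.
    case; rewrite ltnS leq_eqVlt => /orP[/eqP -> //|lt rn].
    by move: (all1 _ lt); rewrite rn.
  split=> [|n]; split=> //.
    move=> _ k; rewrite ltnS leq_eqVlt => /orP[/eqP ->|/all1 //].
    by case: (r _ _) r0 r1 => [|[]].
  case; rewrite ltnS leq_eqVlt => /orP[/eqP -> //|lt rn]; first by move: r1 => /eqP.
  by move: (all1 _ lt); rewrite rn.
split=> [|n]; split=> //.
- by move=> h; rewrite h in sn0.
- by move=> h; apply/IH0 => k lt; apply: h; apply: ltnW.
- by move/IHS => [lt rn h]; split=> //; apply: ltnW.
- case; rewrite ltnS leq_eqVlt => /orP[/eqP ->|lt] rn h; last by apply/IHS.
  by move/IH0: h => h; rewrite h in sn0.
Qed.

Lemma clock_exists (M : prf) : exists r, clock M r.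
Proof.
elim: M => [|||||f [rf [cf mf Sf]] g [rg [cg mg Sg]]|
  f [rf [cf mf Sf]] g [rg [cg mg Sg]]|
  f [rf [cf mf Sf]] g [rg [cg mg Sg]]|f [rf [cf mf Sf]]].
- by apply: (clock_basic (f := fun _ => 0%N)); [comp|constructor].
- by apply: (clock_basic (f := fun x => x.+1)); [comp|constructor].
- by apply: (clock_basic (f := fun x => x)); [comp|constructor].
- by apply: (clock_basic (f := fun x => (unpair x).1)); [comp|constructor].
- by apply: (clock_basic (f := fun x => (unpair x).2)); [comp|constructor].
- exists (fun x t => if rg x t == 0%N then 0%N else rf (rg x t).-1 t); split.
  + by comp.
  + move=> x t t' y tt'; case: eqVneq => // gn0.
    have E : rg x t = (rg x t).-1.+1 by rewrite prednK // lt0n.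
    by rewrite (mg _ _ _ _ tt' E) /=; apply: mf.
  + move=> x y; split.
      move=> /peval_inv[u /Sg[t1 h1] /Sf[t2 h2]]; exists (maxn t1 t2).
      rewrite (mg _ _ _ _ (leq_maxl t1 t2) h1) /=.
      exact: mf (leq_maxr t1 t2) h2.
    move=> [t]; case: eqVneq => // gn0 h.
    apply: (@ev_comp _ _ _ (rg x t).-1); last by apply/Sf; exists t.
    by apply/Sg; exists t; rewrite prednK // lt0n.
- exists (fun x t => if (rf x t == 0%N) || (rg x t == 0%N) then 0%N
                     else (npair (rf x t).-1 (rg x t).-1).+1); split.
  + by comp.
  + move=> x t t' y tt'; case: (eqVneq (rf x t)) => //= fn0.
    case: (eqVneq (rg x t)) => //= gn0.
    have E : rg x t = (rg x t).-1.+1 by rewrite prednK // lt0n.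
    have E' : rf x t = (rf x t).-1.+1 by rewrite prednK // lt0n.
    by rewrite (mg _ _ _ _ tt' E) (mf _ _ _ _ tt' E').
  + move=> x y; split.
      move=> /peval_inv[u [v [/Sf[t1 h1] /Sg[t2 h2] ->]]]; exists (maxn t1 t2).
      rewrite (mf _ _ _ _ (leq_maxl t1 t2) h1).
      by rewrite (mg _ _ _ _ (leq_maxr t1 t2) h2).
    move=> [t]; case: (eqVneq (rf x t)) => //= fn0.
    case: (eqVneq (rg x t)) => //= gn0 [<-].
    apply: ev_pair; [apply/Sf|apply/Sg]; exists t; by rewrite prednK // lt0n.
(* State 0, no value within the time bound, is absorbing; any other state is the current value plus
   one. *)
- pose st a t i s := if s == 0%N then 0%N else rg (npair i (npair s.-1 a)) t.
  pose R n a t := iteri n (st a t) (rf a t).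
  have mR n a t t' y : (t <= t')%N -> R n a t = y.+1 -> R n a t' = y.+1.
    move=> tt'; elim: n y => [|n IH] y; first exact: mf.
    rewrite /R [LHS]/= -/(R n a t) [in X in _ -> X]/= -/(R n a t') {1}/st.
    case: eqVneq => // Rn0.
    have E : R n a t = (R n a t).-1.+1 by rewrite prednK // lt0n.
    by rewrite (IH _ E) /st /=; apply: mg.
  exists (fun x t => R (unpair x).1 (unpair x).2 t); split.
  + by rewrite /R /st; comp.
  + by move=> x t t' y; apply: mR.
  + move=> x y; rewrite -{1}[x]npair_unpair; move: (unpair x).1 (unpair x).2 => n a.
    elim: n y => [|n IH] y; split.
    * by move=> /peval_inv; rewrite unpair_npair => /Sf.
    * by move=> [t h]; apply: ev_rec0; apply/Sf; exists t.
    * move=> /peval_inv; rewrite unpair_npair => -[u /IH[t1 h1] /Sg[t2 h2]].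
      exists (maxn t1 t2); rewrite /R /= -/(R n a _).
      rewrite (mR _ _ _ _ _ (leq_maxl t1 t2) h1) /st /=.
      exact: mg (leq_maxr t1 t2) h2.
    * move=> [t]; rewrite /R /= -/(R n a _) /st; case: eqVneq => // Rn0 h.
      apply: (@ev_recS _ _ _ _ (R n a t).-1); last by apply/Sg; exists t.
      by apply/IH; exists t; rewrite prednK // lt0n.
(* The time bound also limits the range of the search. The predecessor maps both undecided states 0
   and 1 to 0, and n+2 to the expected n+1. *)
- exists (fun x t => (iteri t (mu_step rf x t) 0%N).-1).
  have spec x t n : ((iteri t (mu_step rf x t) 0).-1 = n.+1 <->
      [/\ (n < t)%N, rf (npair n x) t = 1 &
      forall k, (k < n)%N -> (1 < rf (npair k x) t)%N])%N.
    rewrite -(proj2 (mu_stepP rf x t t)); case: (iteri _ _ _) => [|[|m]] //.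
    by split=> [[->]|[->]].
  have mf1 x t t' k : (t <= t')%N -> (1 < rf (npair k x) t)%N ->
      (1 < rf (npair k x) t')%N.
    by move=> tt'; case E: (rf _ t) => [|u] // h; rewrite (mf _ _ _ _ tt' E).
  split.
  + by rewrite /mu_step; comp.
  + move=> x t t' n tt' /spec[lt r1 h]; apply/spec; split.
    * exact: leq_trans tt'.
    * exact: mf tt' r1.
    * by move=> k /h; apply: mf1.
  + move=> x n; split.
      move=> /peval_inv[/Sf[t0 h0] hk].
      suff [T hT] : exists T, forall k, (k < n)%N -> (1 < rf (npair k x) T)%N.
        exists (maxn n.+1 (maxn t0 T)); apply/spec; split.
        - by rewrite leq_max leqnn.
        - by apply: mf h0; rewrite !leq_max leqnn !orbT.
        - by move=> k /hT; apply: mf1; rewrite !leq_max leqnn !orbT.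
      elim: n hk {h0} => [|n IH] hk; first by exists 0%N.
      have [|T hT] := IH; first by move=> k lt; apply: hk; apply: ltnW.
      have [v v0 /Sf[t1 h1]] := hk _ (ltnSn n); exists (maxn t1 T) => k.
      rewrite ltnS leq_eqVlt => /orP[/eqP ->|lt].
        by rewrite (mf _ _ _ _ (leq_maxl t1 T) h1) ltnS lt0n.
      by apply: mf1 (hT _ lt); rewrite leq_maxr.
    move=> [t /spec[lt r1 h]]; apply: ev_mu; first by apply/Sf; exists t.
    move=> k /h lk; exists (rf (npair k x) t).-1.
      by rewrite -lt0n -ltnS prednK // ltnW.
    by apply/Sf; exists t; rewrite prednK // ltnW.
Qed.

(** * Binary strings *)

Lemma bcode_surj (x : nat) : exists p, bcode p = x.
Proof.
have [n] := ubnP x; elim: n x => // n IH [|x] lt; first by exists [::].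
have [|p hp] := IH x./2; first by rewrite ltnS in lt; apply: leq_trans lt; lia.
exists (odd x :: p); rewrite /= hp; have := odd_double_half x.
by case: odd => /=; lia.
Qed.

Lemma bcode_inj : injective bcode.
Proof.
elim=> [|b p IH] [|c q] //=; try by case: b; lia.
  by case: c; lia.
move=> h; have e : b = c by case: b c h => [] [] //; lia.
by rewrite e in h *; rewrite (IH q) //; lia.
Qed.

Definition bval (p : seq bool) : nat :=
  foldl (fun v (b : bool) => v * 2 + b)%N 0%N p.

Lemma bval_foldl (v : nat) (p : seq bool) :
  (foldl (fun v (b : bool) => v * 2 + b) v p = v * 2 ^ size p + bval p)%N.
Proof.
elim: p v => [|b p IH] v /=; first by rewrite muln1 addn0.
have -> : bval (b :: p) = (b * 2 ^ size p + bval p)%N by exact: (IH b).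
by rewrite IH expnS; nia.
Qed.

Lemma bval_cat (p q : seq bool) : bval (p ++ q) = (bval p * 2 ^ size q + bval q)%N.
Proof. by rewrite {1}/bval foldl_cat bval_foldl. Qed.

Lemma bval_lt (p : seq bool) : (bval p < 2 ^ size p)%N.
Proof.
elim/last_ind: p => // p b IH.
rewrite -cats1 bval_cat size_cat /= /bval /= expnD expn1 add0n -/(bval p).
by case: b; lia.
Qed.

Lemma bval_surj (l u : nat) : (u < 2 ^ l)%N ->
  exists p, size p = l /\ bval p = u.
Proof.
elim: l u => [|l IH] u; first by case: u => // _; exists [::].
rewrite expnS => lt; have [|p [sp vp]] := IH u./2; first by lia.
exists (rcons p (odd u)); rewrite size_rcons sp -cats1 bval_cat vp.
by split=> //; rewrite /bval /=; have := odd_double_half u; lia.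
Qed.

(** Reads one bit off a bijective base-2 code: an odd code starts with [false], an even nonzero one
    with [true]. The accumulators hold the binary value and the length read so far. *)
Definition str_step (s : nat * (nat * nat)) : nat * (nat * nat) :=
  if s.1 == 0%N then s
  else (s.1.-1./2, (s.2.1 * 2 + ~~ odd s.1, s.2.2.+1))%N.

Definition str_info (x : nat) : nat * nat :=
  (iteri x (fun _ s => str_step s) (x, (0, 0)))%N.2.

Lemma comp_str_info {A : Type} {rA : Rep A} (f : A -> nat) :
  computable f -> computable (fun a => str_info (f a)).
Proof. by move=> hf; rewrite /str_info /str_step; comp. Qed.

Lemma str_infoE (p : seq bool) : str_info (bcode p) = (bval p, size p).
Proof.
rewrite /str_info.
(* The code itself serves as the number of iterations; once the string is used up, [str_step]
   changes nothing. *)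
have szp : (size p <= bcode p)%N by elim: p => //= b p; case: b; lia.
suff H n v l : (size p <= n)%N ->
    iter n str_step (bcode p, (v, l)) =
    (0, (foldl (fun v (b : bool) => v * 2 + b) v p, l + size p))%N.
  have -> : iteri (bcode p) (fun _ s => str_step s) (bcode p, (0, 0))%N =
      iter (bcode p) str_step (bcode p, (0, 0))%N.
    by elim: {1 3}(bcode p) => //= m ->.
  by rewrite H.
elim: p n v l {szp} => [|b p IH] n v l /=.
  move=> _; elim: n => [|n /= ->] //; by rewrite addn0.
case: n => // n lt; rewrite iterSr /str_step /=.
have -> : ((bcode p).*2 + (if b then 2 else 1) == 0)%N = false by case: b; lia.
have -> : (((bcode p).*2 + (if b then 2 else 1)).-1)./2 = bcode p by case: b; lia.
have -> : ~~ odd ((bcode p).*2 + (if b then 2 else 1)) = b.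
  by rewrite oddD odd_double; case: b.
by rewrite IH // addSnnS.
Qed.

(** * Codes of Gaussian rationals as algebraic numbers *)

(** A copy of [C] represented by isolating disks, because [C] itself is already represented by its
    Gaussian rational points. *)
Record alg := Alg { alg_val : C }.
#[export] Instance Rep_alg : Rep alg := fun x z => alg_dec x (alg_val z).

(** The polynomial is (X - z)(X - conj z), with rational coefficients. The disk is centered at z,
    and its radius |Im z| excludes the conjugate root at distance 2 |Im z|; for real z the two roots
    coincide and any positive radius will do. *)
Definition gauss_code (z : C) : seq RR * (RR * (RR * RR)) :=
  let a := complex.Re z in let b := complex.Im z in
  ([:: a * a + b * b; - (a + a); 1],
   (a, (b, if b == 0 then 1 else if 0 <= b then b else - b))).

Lemma gauss_root (a b : RR) (w : C) :
  w ^+ 2 - (a + a)%:C%C * w + (a * a + b * b)%:C%C =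
  (w - Complex a b) * (w - Complex a (- b)).
Proof.
case: w => x y; rewrite expr2; apply/eqP; rewrite eq_complex /=.
by apply/andP; split; apply/eqP; ring.
Qed.

Lemma gauss_codeP (x : nat) (z : C) : rep x (gauss_code z) -> alg_dec x z.
Proof.
case: z => a b; rewrite /gauss_code /=.
case=> /= hp [/= ha [/= hb hr]].
rewrite /alg_dec.
set p := Poly _.
have pE w : p.[w] = (w - Complex a b) * (w - Complex a (- b)).
  rewrite -gauss_root /p horner_Poly.
  move: hp; rewrite /rep /Rep_seq.
  case: (seq_dec _) => [//|c0 [[]//|c1 [[_ []]//|c2 [|c3 l]]]] /=; last by case=> _ [_ []].
  rewrite /rep /Rep_R /decR => -[e0 [e1 [e2 _]]].
  have E (q : rat) : (ratr q : C) = (ratr q : RR)%:C%C by rewrite fmorph_rat.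
  by rewrite !E e0 e1 e2 rmorphN; ring.
move: ha hb hr; rewrite /rep /Rep_R /decR => -> -> ->.
split.
- apply/eqP => p0; have := pE (Complex (a + 1) (b + 1)); rewrite p0 horner0.
  move/eqP; rewrite eq_sym mulf_eq0 !subr_eq0 !eq_complex /=.
  move=> /orP[] /andP[/eqP h _]; move: h; lra.
- by rewrite rootE pE subrr mul0r.
- rewrite subrr normr0 ltcE /= eqxx /=.
  by case: eqVneq => // bn0; case: ifP => h; lra.
- move=> w; rewrite rootE pE mulf_eq0 !subr_eq0 => /orP[/eqP -> //|/eqP ->].
  have -> : Complex a (- b) - Complex a b = Complex 0 (- b - b) :> C.
    by apply/eqP; rewrite eq_complex /= subrr !eqxx.
  rewrite normc_def ltcE /= => /andP[_]; rewrite expr0n add0r sqrtr_sqr.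
  case: eqVneq => [-> |bn0]; first by rewrite oppr0.
  have -> : - b - b = - (b *+ 2) by rewrite mulr2n opprD.
  rewrite normrN normrMn; case: ifP => h.
    by rewrite ger0_norm // mulr2n => lt; exfalso; lra.
  move: h => /negbT; rewrite -ltNge => h.
  by rewrite ltr0_norm // mulr2n => lt; exfalso; lra.
Qed.

Lemma comp_Alg {A : Type} {rA : Rep A} (f : A -> C) :
  computable f -> computable (fun a => Alg (f a)).
Proof.
move=> hf; have [e he] : computable (fun a => gauss_code (f a)).
  rewrite /gauss_code; lazy zeta.
  have h0 : computable (fun _ : A => 0 : RR) by exact: (comp_natR (comp_nat 0)).
  have h1 : computable (fun _ : A => 1 : RR) by exact: (comp_natR (comp_nat 1)).
  by comp.
exists e => x a /he[y p1 h1]; exists y => //.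
exact: gauss_codeP.
Qed.

(** * Series with a computable rate of convergence *)

(** For computable nonnegative terms this is equivalent to having a computable finite sum, but
    unlike that property it visibly passes to termwise smaller series. *)
Definition sum_modulus (a : nat -> RR) : Prop :=
  exists2 N : nat -> nat, computable N &
    forall k n, \sum_(N k <= m < n) a m <= 2 ^- k.

Section Esum.
Variables (a : nat -> RR) (a0 : forall m, 0 <= a m).

Lemma partial_le_esum (n : nat) :
  ((\sum_(m < n) a m)%:E <= \esum_(m in [set: nat]) (a m)%:E)%E.
Proof.
rewrite -nneseries_esumT; last by move=> m; rewrite lee_fin.
apply: le_trans (nneseries_lim_ge n _); last by move=> m _; rewrite lee_fin.
by rewrite -sumEFin big_mkord.
Qed.

Lemma esum_le_bound (B : RR) : (forall n, \sum_(m < n) a m <= B) ->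
  (\esum_(m in [set: nat]) (a m)%:E <= B%:E)%E.
Proof.
move=> h; rewrite -nneseries_esumT; last by move=> m; rewrite lee_fin.
apply: lime_le; first by apply: is_cvg_nneseries => m _; rewrite lee_fin.
by near=> n; rewrite sumEFin lee_fin big_mkord.
Unshelve. all: by end_near.
Qed.

Lemma sum_split_le (M n : nat) :
  \sum_(m < n) a m <= \sum_(m < M) a m + \sum_(M <= m < n) a m.
Proof.
rewrite -!(big_mkord predT a); case: (leqP M n) => h.
  by rewrite -big_cat_nat.
rewrite (big_geq (m := M)) 1?ltnW // addr0 [leRHS](big_cat_nat _ (n := n)) //= 1?ltnW //.
by rewrite lerDl sumr_ge0.
Qed.

Lemma modulus_of_esum (r : RR) : computable a ->
  (\esum_(m in [set: nat]) (a m)%:E = r%:E)%E -> computable_real r ->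
  sum_modulus a.
Proof.
move=> ca er [e he].
have hle n : \sum_(m < n) a m <= r by rewrite -lee_fin -er partial_le_esum.
have [q] := choice he; rewrite -/decR => hq.
have cq : computable q.
  by exists e => x k ->; exists (q k) => //; case: (hq k).
have pos k : 0 < (2 : RR) ^- k by rewrite invr_gt0 exprn_gt0.
(* With e = 2^-(k+2), the approximation is within e of r. The margin 2e guarantees that some partial
   sum passes, and passing leaves a tail of at most 3e, below 2^-k. *)
pose P k n := decR (q k.+2) - 2 ^- k.+2 - 2 ^- k.+2 <= bsum n a.
have cP : computable (fun p : nat * nat => P p.1 p.2).
  by rewrite /P; comp; apply: comp_bsumR; comp.
have exP k : exists n, P k n.
  apply: contrapT => /forallNP nP.
  have : (\esum_(m in [set: nat]) (a m)%:E <=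
      (decR (q k.+2) - 2 ^- k.+2 - 2 ^- k.+2)%:E)%E.
    apply: esum_le_bound => n; rewrite leNgt; apply/negP => /ltW h.
    exact: (nP n).
  rewrite er lee_fin; case: (hq k.+2) => _; rewrite ler_distl => /andP[h1 h2].
  by have := pos k.+2; lra.
have [N [cN PN _]] := comp_search cP exP.
exists N => // k n; have := PN k; rewrite /P /bsum.
case: (leqP (N k) n) => h; last first.
  by rewrite big_geq ?(ltW (pos k)) // ltnW.
have := hle n; rewrite -!(big_mkord predT a) (big_cat_nat (n := N k)) //=.
case: (hq k.+2) => _; rewrite ler_distl => /andP[h1 h2].
have : (2 : RR) ^- k = 4 * 2 ^- k.+2.
  by rewrite !exprS; field; rewrite expf_neq0.
by have := pos k; lra.
Qed.

Lemma esum_of_modulus : computable a -> sum_modulus a ->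
  exists r : RR, (\esum_(m in [set: nat]) (a m)%:E = r%:E)%E /\ computable_real r.
Proof.
move=> ca [N cN hN].
have hub k : (\esum_(m in [set: nat]) (a m)%:E <=
    (\sum_(m < N k) a m + 2 ^- k)%:E)%E.
  apply: esum_le_bound => n; apply: le_trans (sum_split_le (N k) n) _.
  by rewrite lerD2l.
have fin : (\esum_(m in [set: nat]) (a m)%:E \is a fin_num)%E.
  rewrite ge0_fin_numE; first by apply: le_lt_trans (hub 0%N) _; rewrite ltry.
  by apply: esum_ge0 => m _; rewrite lee_fin.
exists (fine (\esum_(m in [set: nat]) (a m)%:E)%E); rewrite fineK //; split=> //.
have [e he] : computable (fun k => bsum (N k) a) by apply: comp_bsumR; comp.
exists e => k; have [y p1 h1] := he k k erefl; exists y; split=> //.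
rewrite -/(decR y) h1 /bsum; have := partial_le_esum (N k); have := hub k.
by rewrite -(fineK fin) !lee_fin ler_distl => h2 h3; have : 0 < (2 : RR) ^- k;
  [rewrite invr_gt0 exprn_gt0 | lra].
Qed.
End Esum.

Lemma sum_modulus_le (a b : nat -> RR) : (forall m, a m <= b m) ->
  sum_modulus b -> sum_modulus a.
Proof.
move=> ab [N cN hN]; exists N => // k n; apply: le_trans (hN k n).
by apply: ler_sum => m _.
Qed.

Lemma comp_bsumn {A : Type} {rA : Rep A} (n : A -> nat) (F : A -> nat -> nat) :
  computable n -> computable (fun p : A * nat => F p.1 p.2) ->
  computable (fun a => \sum_(i < n a) F a i)%N.
Proof.
move=> hn hF; apply: (@comp_ext _ _ _ _
  (fun a => iteri (n a) (fun i s => s + F a i)%N 0%N)).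
  by move=> a; elim: (n a) => [|m /= ->]; rewrite ?big_ord0 // big_ord_recr.
by comp.
Qed.

Lemma geom_tail (K n : nat) :
  \sum_(K <= k < n) (2 : RR) ^- k.+2 <= 2 ^- K.+1.
Proof.
have pos k : 0 < (2 : RR) ^- k by rewrite invr_gt0 exprn_gt0.
case: (leqP K n) => h; last by rewrite big_geq ?(ltW (pos _)) // ltnW.
suff -> : \sum_(K <= k < n) (2 : RR) ^- k.+2 = 2 ^- K.+1 - 2 ^- n.+1.
  by have := pos n.+1; lra.
elim: n h => [|n IH] h; first by move: h; rewrite leqn0 => /eqP ->; rewrite big_geq // subrr.
move: h; rewrite leq_eqVlt => /orP[/eqP ->|h]; first by rewrite big_geq // subrr.
rewrite big_nat_recr //= IH // !exprS.
by field; rewrite !expf_neq0.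
Qed.

Lemma geom_head (n : nat) : \sum_(0 <= k < n) (2 : RR) ^+ k <= 2 ^+ n.
Proof.
elim: n => [|n IH]; first by rewrite big_geq // expr0 ler01.
by rewrite big_nat_recr //= exprS; lra.
Qed.

(** G is a sum of layers: layer k adds 2^k to every index from N(2k+2) on, where the tail of a is at
    most 2^-(2k+2). So layer k costs at most 2^-(k+2), while every layer is eventually present. The
    cutoff k < m makes G m a finite sum. *)
Lemma divergent_weights (a : nat -> RR) : (forall m, 0 <= a m) -> sum_modulus a ->
  exists G : nat -> nat, [/\ computable G,
    forall K, exists M, forall m, (M <= m)%N -> (2 ^ K <= G m)%N,
    forall n, \sum_(m < n) (G m)%:R * a m <= 1 &
    sum_modulus (fun m => (G m)%:R * a m)].
Proof.
move=> a0 [N cN hN].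
pose c k m := (if (N (2 * k + 2) <= m)%N then 2 ^ k else 0)%N.
pose G m := (\sum_(k < m) c k m)%N; exists G.
have pos k : 0 < (2 : RR) ^- k by rewrite invr_gt0 exprn_gt0.
have pow k : 0 < (2 : RR) ^+ k by rewrite exprn_gt0.
have hG M n : \sum_(M <= m < n) (G m)%:R * a m <=
    \sum_(0 <= k < n) \sum_(M <= m < n) (c k m)%:R * a m.
  rewrite exchange_big /= big_nat_cond [leRHS]big_nat_cond.
  apply: ler_sum => m; rewrite andbT => /andP[_ mn].
  rewrite -mulr_suml ler_wpM2r // /G natr_sum -(big_mkord predT (fun k => (c k m)%:R)).
  rewrite [leRHS](big_cat_nat _ (n := m)) //= 1?ltnW //.
  by rewrite lerDl sumr_ge0.
have hc M n k : \sum_(M <= m < n) (c k m)%:R * a m <= 2 ^- k.+2.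
  have -> : (2 : RR) ^- k.+2 = 2 ^+ k * 2 ^- (2 * k + 2).
    rewrite mul2n -addnn !exprD !exprS expr0; field; by rewrite !expf_neq0.
  apply: le_trans (_ : 2 ^+ k * \sum_(N (2 * k + 2)%N <= m < n) a m <= _); last first.
    by rewrite ler_pM2l.
  rewrite mulr_sumr [leRHS](big_nat_widenl _ 0) //=.
  apply: le_trans (_ : \sum_(0 <= m < n) (c k m)%:R * a m <= _).
    rewrite [leLHS](big_nat_widenl _ 0) // [leLHS]big_mkcond /=.
    by apply: ler_sum => m _; case: ifP => // _; rewrite mulr_ge0.
  rewrite [leRHS]big_mkcond /=; apply: ler_sum => m _; rewrite /c.
  by case: ifP => _; rewrite ?natrX ?mul0r.
split.
- apply: (comp_bsumn (n := fun m => m) (F := fun m k => c k m)); rewrite /c; by comp.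
- move=> K; exists (maxn K.+1 (N (2 * K + 2)%N)) => m; rewrite geq_max => /andP[h1 h2].
  rewrite /G (bigD1 (Ordinal h1)) //= {1}/c h2; exact: leq_addr.
- move=> n; rewrite -(big_mkord predT (fun m => (G m)%:R * a m)).
  apply: le_trans (hG 0%N n) _; apply: le_trans (_ : \sum_(0 <= k < n) 2 ^- k.+2 <= 1).
    by apply: ler_sum => k _; apply: hc.
  by apply: le_trans (geom_tail 0 n) _; rewrite invf_le1 // expr1; lra.
(* Beyond N(2K+1) the layers below K together cost at most 2^K 2^-(2K+1), and those from K on cost a
   geometric tail; each part is at most 2^-(K+1). *)
- exists (fun K => N (2 * K + 1)%N); first by comp.
  move=> K n; apply: le_trans (hG _ n) _.
  have hc' k : \sum_(N (2 * K + 1)%N <= m < n) (c k m)%:R * a m <=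
      2 ^+ k * 2 ^- (2 * K + 1).
    apply: le_trans (_ : 2 ^+ k * \sum_(N (2 * K + 1)%N <= m < n) a m <= _).
      rewrite mulr_sumr; apply: ler_sum => m _; rewrite ler_wpM2r // /c -natrX.
      by case: ifP => // _; rewrite ler_nat.
    by rewrite ler_pM2l.
  have e1 : (2 : RR) ^- K = 2 ^+ K * 2 ^- (2 * K + 1) + 2 ^- K.+1.
    rewrite mul2n -addnn addn1 !exprS exprD; field; by rewrite expf_neq0.
  have hd : \sum_(0 <= k < minn K n) (2 : RR) ^+ k * 2 ^- (2 * K + 1) <=
      2 ^+ K * 2 ^- (2 * K + 1).
    rewrite -mulr_suml ler_pM2r //; apply: le_trans (geom_head _) _.
    by rewrite ler_weXn2l ?ler1n // geq_minl.
  rewrite (big_cat_nat _ (n := minn K n)) ?geq_minr //= e1.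
  apply: lerD.
    by apply: le_trans hd; apply: ler_sum => k _; apply: hc'.
  apply: le_trans (geom_tail K n); case: (leqP K n) => h.
    by apply: ler_sum => k _; apply: hc.
  by rewrite !big_geq // ltnW.
Qed.

Local Open Scope sesquilinear_scope.

(** * Matrices: adjoints and the entrywise l1 norm *)

Lemma adjmxM (m n p : nat) (A : 'M[C]_(m, n)) (B : 'M[C]_(n, p)) :
  (A *m B) ^t* = B ^t* *m A ^t*.
Proof. by rewrite trmx_mul map_mxM. Qed.

Lemma adjmxD (m n : nat) (A B : 'M[C]_(m, n)) : (A + B) ^t* = A ^t* + B ^t*.
Proof. by rewrite linearD map_mxD. Qed.

Lemma adjmxN (m n : nat) (A : 'M[C]_(m, n)) : (- A) ^t* = - A ^t*.
Proof. by rewrite linearN map_mxN. Qed.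

Lemma adjmx1 (n : nat) : (1%:M : 'M[C]_n) ^t* = 1%:M.
Proof. by rewrite trmx1 map_mx1. Qed.

Lemma adjmxE (m n : nat) (A : 'M[C]_(m, n)) i j : (A ^t*) i j = (A j i)^*.
Proof. by rewrite !mxE. Qed.

(** This norm is submultiplicative, invariant under adjoints, and dominates entries, traces and
    traces against density matrices. The price is only factors of the dimension, absorbed by extra
    bits of precision. *)
Definition mxn (m n : nat) (A : 'M[C]_(m, n)) : C := \sum_i \sum_j `|A i j|.

Section L1norm.
Variables m n p : nat.
Implicit Types (A B : 'M[C]_(m, n)).

Lemma mxn_ge0 A : 0 <= mxn A.
Proof. by rewrite sumr_ge0 // => i _; rewrite sumr_ge0. Qed.

Lemma mxnD A B : mxn (A + B) <= mxn A + mxn B.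
Proof.
rewrite /mxn -big_split /=; apply: ler_sum => i _; rewrite -big_split /=.
by apply: ler_sum => j _; rewrite mxE ler_normD.
Qed.

Lemma mxnN A : mxn (- A) = mxn A.
Proof. by apply: eq_bigr => i _; apply: eq_bigr => j _; rewrite mxE normrN. Qed.

Lemma mxnB A B : mxn (A - B) <= mxn A + mxn B.
Proof. by rewrite -(mxnN B) mxnD. Qed.

Lemma mxn_entry A i j : `|A i j| <= mxn A.
Proof.
rewrite /mxn (bigD1 i) //= (bigD1 j) //= -addrA lerDl addr_ge0 ?sumr_ge0 //.
by move=> k _; rewrite sumr_ge0.
Qed.

Lemma mxn_bound A (e : C) : (forall i j, `|A i j| <= e) -> mxn A <= (m * n)%:R * e.
Proof.
move=> h; apply: le_trans (_ : \sum_(i < m) \sum_(j < n) e <= _).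
  by apply: ler_sum => i _; apply: ler_sum => j _.
rewrite !sumr_const !card_ord -mulrnA mulnC mulr_natl; exact: lexx.
Qed.

Lemma mxn_eq0 A : mxn A = 0 -> A = 0.
Proof.
move=> h; apply/matrixP => i j; rewrite mxE; apply/eqP; rewrite -normr_le0 -h.
exact: mxn_entry.
Qed.

Lemma mxnM A (B : 'M[C]_(n, p)) : mxn (A *m B) <= mxn A * mxn B.
Proof.
rewrite /mxn mulr_suml; apply: ler_sum => i _.
apply: le_trans (_ : \sum_k \sum_j `|A i k| * `|B k j| <= _).
  rewrite exchange_big /=; apply: ler_sum => j _; rewrite mxE.
  by apply: le_trans (ler_norm_sum _ _ _) _; apply: ler_sum => k _; rewrite normrM.
rewrite mulr_suml; apply: ler_sum => k _; rewrite -mulr_sumr ler_wpM2l //.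
by rewrite [leRHS](bigD1 k) //= lerDl sumr_ge0 // => l _; rewrite sumr_ge0.
Qed.

Lemma mxn_adj A : mxn (A ^t*) = mxn A.
Proof.
rewrite /mxn exchange_big /=; apply: eq_bigr => i _; apply: eq_bigr => j _.
by rewrite adjmxE norm_conjC.
Qed.
End L1norm.

Lemma mxn_diag (n : nat) (d : 'rV[C]_n) : mxn (diag_mx d) = \sum_i `|d 0 i|.
Proof.
apply: eq_bigr => i _; rewrite (bigD1 i) //= mxE eqxx mulr1n big1 ?addr0 //.
by move=> j ji; rewrite mxE eq_sym (negbTE ji) mulr0n normr0.
Qed.

Lemma mxn1 (n : nat) : mxn (1%:M : 'M[C]_n) = n%:R.
Proof.
rewrite -diag_const_mx mxn_diag; under eq_bigr do rewrite mxE normr1.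
by rewrite sumr_const card_ord.
Qed.

Lemma isometry_entry (m n : nat) (U : 'M[C]_(m, n)) i j :
  U ^t* *m U = 1%:M -> `|U i j| <= 1.
Proof.
move=> h; have : (U ^t* *m U) j j = 1 by rewrite h mxE eqxx.
rewrite mxE (bigD1 i) //= adjmxE mulrC -normCK => e.
have : `|U i j| ^+ 2 <= 1.
  rewrite -e lerDl sumr_ge0 // => k _; by rewrite adjmxE mulrC mul_conjC_ge0.
by rewrite -[X in _ <= X](expr1n _ 2) ler_pXn2r ?nnegrE.
Qed.

Lemma mxn_isometry (m n : nat) (U : 'M[C]_(m, n)) :
  U ^t* *m U = 1%:M -> mxn U <= (m * n)%:R.
Proof.
by move=> h; rewrite -[leRHS]mulr1; apply: mxn_bound => i j; apply: isometry_entry.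
Qed.

(** * The Cayley transform *)

Section Cayley.
Variable n : nat.
Implicit Types (A V W : 'M[C]_n).

Lemma unitmx_row0 (M : 'M[C]_n) :
  (forall x : 'rV[C]_n, x *m M = 0 -> x = 0) -> M \in unitmx.
Proof.
move=> h; rewrite -row_free_unit -kermx_eq0; apply/eqP/row_matrixP => i.
by rewrite row0; apply: h; rewrite -row_mul mulmx_ker row0.
Qed.

(** If x (1 + A) = 0, then the form of A at x equals -|x|^2, a real number, but for skew-Hermitian A
    it is purely imaginary; hence x = 0. *)
Lemma skew_unit A : A ^t* = - A -> 1%:M + A \in unitmx.
Proof.
move=> hA; apply: unitmx_row0 => x; rewrite mulmxDr mulmx1 => /eqP.
rewrite addr_eq0 => /eqP hx.
pose s := (x *m x ^t*) 0 0.
have sE : s = \sum_j `|x 0 j| ^+ 2.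
  by rewrite /s mxE; apply: eq_bigr => j _; rewrite adjmxE normCK.
have s0 : 0 <= s by rewrite sE sumr_ge0 // => j _; rewrite exprn_ge0.
have e1 : x *m A *m x ^t* = - (x *m x ^t*) by rewrite [X in - (X *m _)]hx mulNmx opprK.
have e2 : (x *m A *m x ^t*) ^t* = - (x *m A *m x ^t*).
  by rewrite !adjmxM trmxCK hA mulNmx mulmxN mulmxA.
have : s = - s.
  have sJ : s^* = s by apply/CrealP; exact: ger0_real.
  have /matrixP/(_ 0 0) := e2; rewrite e1 opprK adjmxE.
  have -> : (- (x *m x ^t*)) 0 0 = - s by rewrite mxE.
  by have -> : (- s)^* = - s; [rewrite rmorphN; congr (- _)|move=> ->].
move/eqP; rewrite -addr_eq0 -mulr2n mulrn_eq0 /= sE => /eqP /psumr_eq0P hs.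
apply/rowP => j; rewrite mxE; apply/eqP; rewrite -normr_eq0 -sqrf_eq0.
by rewrite hs // => k _; rewrite exprn_ge0.
Qed.

(** Multiplying A + adjoint of A by 1 + V on the right and by its adjoint on the left clears the
    denominators, and unitarity of V cancels the result. [cayley_unitary] uses the same device. *)
Lemma cayley_skew V A : V ^t* *m V = 1%:M -> 1%:M + V \in unitmx ->
  A *m (1%:M + V) = 1%:M - V -> A ^t* = - A.
Proof.
move=> hV uV hA; apply/eqP; rewrite -addr_eq0; apply/eqP.
have uV' : (1%:M + V) ^t* \in unitmx by rewrite map_unitmx unitmx_tr.
have : (1%:M + V) ^t* *m (A ^t* + A) *m (1%:M + V) = 0.
  have key (X Y : 'M[C]_n) : A *m X = Y ->
      X ^t* *m (A ^t* + A) *m X = Y ^t* *m X + X ^t* *m Y.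
    by move=> <-; rewrite mulmxDr mulmxDl adjmxM -!mulmxA.
  rewrite (key _ _ hA) !adjmxD adjmxN adjmx1.
  rewrite !(mulmxDl, mulmxDr, mulmxN, mulNmx, mulmx1, mul1mx) hV.
  by apply/matrixP => i j; rewrite !mxE; ring.
rewrite -[RHS](mul0mx _ (1%:M + V)) => /(can_inj (mulmxK uV)).
by rewrite -[RHS](mulmx0 _ ((1%:M + V) ^t*)) => /(can_inj (mulKmx uV')).
Qed.

Lemma cayley_unitary W A : A ^t* = - A -> W *m (1%:M + A) = 1%:M - A ->
  W ^t* *m W = 1%:M.
Proof.
move=> hA hW; have uA := skew_unit hA.
have uA' : (1%:M + A) ^t* \in unitmx by rewrite map_unitmx unitmx_tr.
have E : (1%:M + A) ^t* *m (W ^t* *m W) *m (1%:M + A) =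
         (1%:M + A) ^t* *m 1%:M *m (1%:M + A).
  rewrite mulmx1 !mulmxA -adjmxM -mulmxA hW !adjmxD adjmxN adjmx1 hA.
  rewrite !(mulmxDl, mulmxDr, mulmxN, mulNmx, mulmx1, mul1mx, opprK).
  by apply/matrixP => i j; rewrite !mxE; ring.
exact: (can_inj (mulKmx uA') (can_inj (mulmxK uA) E)).
Qed.

(** The Cayley transform breaks down at the eigenvalue -1. The unimodular numbers (1 + ki)/(1 - ki)
    are infinitely many, so one of them is not an eigenvalue of U, and minus its inverse is a
    suitable phase. *)
Lemma unit_phase (U : 'M[C]_n) :
  exists2 c : C, `|c| = 1 & 1%:M + c *: U \in unitmx.
Proof.
pose w k : C := Complex 1 k%:R; pose a k := w k / (w k)^*.
have wn0 k : w k != 0 by rewrite eq_complex /= oner_eq0.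
have wJn0 k : (w k)^* != 0 by rewrite conjC_eq0.
have ainj : injective a.
  move=> k l /eqP; rewrite /a eqr_div ?wJn0 // => /eqP /(congr1 (@complex.Im _)).
  rewrite /= => h; apply/eqP; rewrite -(eqr_nat RR); apply/eqP.
  by move: h; lra.
have cp0 : char_poly U != 0 by rewrite monic_neq0 // char_poly_monic.
have [k hk] : exists k, ~~ root (char_poly U) (a k).
  apply: contrapT => /forallNP hall.
  have := max_poly_roots (rs := [seq a k | k <- iota 0 (size (char_poly U))]) cp0.
  rewrite size_map size_iota ltnn => h; suff: false by []; apply: h.
    by apply/allP => _ /mapP[k _ ->]; apply: contrapT => /negP /hall.
  by rewrite map_inj_uniq // iota_uniq.
have an0 : a k != 0 by rewrite mulf_neq0 // invr_eq0.
exists (- (a k)^-1).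
  by rewrite normrN normfV normf_div norm_conjC divff ?invr1 // normr_eq0.
have -> : 1%:M + - (a k)^-1 *: U = - (a k)^-1 *: (U - (a k)%:M).
  by rewrite scalerBr scale_scalar_mx mulNr mulVf // raddfN opprK addrC.
rewrite unitmxZ ?unitfE ?oppr_eq0 ?invr_eq0 //.
move: hk; rewrite -eigenvalue_root_char /eigenvalue /eigenspace negbK.
by rewrite kermx_eq0 row_free_unit.
Qed.
End Cayley.

(** * Gaussian rational approximation *)

Definition gq : {pred C} :=
  fun z => `[< exists a b : rat, z = Complex (ratr a) (ratr b) >].

Lemma gqP (z : C) :
  reflect (exists a b : rat, z = Complex (ratr a) (ratr b)) (z \in gq).
Proof. exact: asboolP. Qed.

Lemma gq_divring_closed : divring_closed gq.
Proof.
split.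
- by apply/gqP; exists 1, 0; rewrite rmorph1 rmorph0.
- move=> _ _ /gqP[a [b ->]] /gqP[c [d ->]]; apply/gqP; exists (a - c), (b - d).
  by rewrite !rmorphB.
- move=> _ _ /gqP[a [b ->]] /gqP[c [d ->]]; apply/gqP.
  exists (a * (c / (c ^+ 2 + d ^+ 2)) - b * (- (d / (c ^+ 2 + d ^+ 2)))).
  exists (a * (- (d / (c ^+ 2 + d ^+ 2))) + b * (c / (c ^+ 2 + d ^+ 2))).
  by rewrite !(rmorphB, rmorphD, rmorphM, fmorphV, rmorphXn, rmorphN).
Qed.

HB.instance Definition _ := GRing.isDivringClosed.Build C gq gq_divring_closed.

Lemma gq_conj (z : C) : z \in gq -> z^* \in gq.
Proof. by move=> /gqP[a [b ->]]; apply/gqP; exists a, (- b); rewrite rmorphN. Qed.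

Lemma gq_invmx (n : nat) (M : 'M[C]_n) :
  (forall i j, M i j \in gq) -> forall i j, invmx M i j \in gq.
Proof.
have hdet k (A : 'M[C]_k) : (forall i j, A i j \in gq) -> \det A \in gq.
  move=> h; rewrite rpred_sum // => s _; rewrite rpredMsign rpred_prod //.
move=> h i j; rewrite /invmx; case: ifP => _ //.
rewrite mxE rpredM ?rpredV ?hdet // mxE rpredMsign hdet // => k l.
by rewrite !mxE.
Qed.

Lemma gq_mulmx (m n p : nat) (A : 'M[C]_(m, n)) (B : 'M[C]_(n, p)) :
  (forall i j, A i j \in gq) -> (forall i j, B i j \in gq) ->
  forall i j, (A *m B) i j \in gq.
Proof. by move=> hA hB i j; rewrite mxE rpred_sum // => k _; rewrite rpredM. Qed.

Lemma gq_dense (z e : C) : 0 < e -> exists2 q, q \in gq & `|z - q| <= e.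
Proof.
case: e => e e'; rewrite ltcE /= => /andP[/eqP -> e0]; case: z => x y.
have h t : exists q : rat, `|t - ratr q| <= e / 2.
  have [|q] := @rat_in_itvoo RR (t - e / 2) (t + e / 2); first by lra.
  rewrite in_itv /= => /andP[h1 h2]; exists q.
  by rewrite ler_distl; apply/andP; split; lra.
have [[a ha] [b hb]] := (h x, h y); exists (Complex (ratr a) (ratr b)).
  by apply/gqP; exists a, b.
have -> : Complex x y - Complex (ratr a) (ratr b) =
    (x - ratr a)%:C%C + Complex 0 1 * (y - ratr b)%:C%C.
  by apply/eqP; rewrite eq_complex /=; apply/andP; split; apply/eqP; ring.
apply: le_trans (ler_normD _ _) _; rewrite normrM.
have nR (t : RR) : `|t%:C%C| = `|t|%:C%C.
  by rewrite normc_def /= expr0n addr0 sqrtr_sqr.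
have -> : `|Complex 0 1 : C| = 1.
  by rewrite normc_def /= expr0n expr1n add0r sqrtr1.
rewrite mul1r !nR -rmorphD lecR; by lra.
Qed.

Lemma gq_dense_mx (m n : nat) (A : 'M[C]_(m, n)) (e : C) : 0 < e ->
  exists2 B : 'M[C]_(m, n), forall i j, B i j \in gq & mxn (B - A) <= e.
Proof.
move=> e0; have d0 : 0 < e / (m * n).+1%:R by rewrite divr_gt0.
have /(_ _ _)/cid2 h i j := gq_dense (A i j) d0.
exists (\matrix_(i, j) projT1 (h i j)).
  by move=> i j; rewrite mxE; case: (h i j).
apply: le_trans (_ : (m * n)%:R * (e / (m * n).+1%:R) <= _).
  apply: mxn_bound => i j; rewrite !mxE distrC; by case: (h i j).
rewrite mulrCA ger_pMr // ler_pdivrMr // mul1r ler_nat; exact: leqnSn.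
Qed.

(** Unitarity cannot survive entrywise rounding, but skewness can: round the Cayley transform A of V
    to a skew Gaussian rational matrix A' and transform back. *)
Lemma rational_unitary (n : nat) (V : 'M[C]_n) (e : C) :
  V ^t* *m V = 1%:M -> 1%:M + V \in unitmx -> 0 < e ->
  exists W : 'M[C]_n, [/\ W ^t* *m W = 1%:M, forall i j, W i j \in gq &
    mxn (W - V) <= e].
Proof.
move=> hV uV e0; pose A := (1%:M - V) *m invmx (1%:M + V).
have hA : A *m (1%:M + V) = 1%:M - V by rewrite mulmxKV.
have sA := cayley_skew hV uV hA.
(* Below, 1 + W and 1 + V have norm at most 2 n^2 and A' - A at most 2d, so W - V is at most 4 n^4
   d; the added 1 keeps the denominator positive. *)
pose d := e / (4 * (n * n)%:R ^+ 2 + 1).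
have D0 : 0 < 4 * (n * n)%:R ^+ 2 + 1 :> C.
  by rewrite ltr_wpDl // mulr_ge0 // exprn_ge0.
have d0 : 0 < d by rewrite divr_gt0.
have [B qB hB] := gq_dense_mx (2^-1 *: A) d0.
(* B approximates A/2, so B minus its adjoint is exactly skew and approximates A. *)
pose A' := B - B ^t*.
have sA' : A' ^t* = - A' by rewrite adjmxD adjmxN trmxCK opprB.
have dA : mxn (A' - A) <= 2 * d.
  have -> : A' - A = (B - 2^-1 *: A) - (B - 2^-1 *: A) ^t*.
    rewrite adjmxD adjmxN; have -> : (2^-1 *: A) ^t* = - (2^-1 *: A).
      by apply/matrixP => i j; rewrite -[in RHS]scalerN -sA !mxE rmorphM fmorphV
        rmorph_nat.
    by apply/matrixP => i j; rewrite !mxE; field.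
  apply: le_trans (mxnB _ _) _; rewrite mxn_adj; apply: le_trans (lerD hB hB) _.
  by rewrite [2 * d]mulr_natl mulr2n.
have uA' := skew_unit sA'.
pose W := (1%:M - A') *m invmx (1%:M + A').
have hW : W *m (1%:M + A') = 1%:M - A' by rewrite mulmxKV.
have uW := cayley_unitary sA' hW; exists W; split=> //.
  have qA' i j : A' i j \in gq by rewrite 3!mxE rpredB // mxE gq_conj // mxE.
  have q1 i j : (1%:M : 'M[C]_n) i j \in gq by rewrite mxE rpred_nat.
  apply: gq_mulmx => [i j|]; last apply: gq_invmx => i j.
    by rewrite mxE rpredD // mxE rpredN.
  by rewrite mxE rpredD.
(* This identity avoids any bound on the inverse of 1 + V, which may be arbitrarily large. *)
have E : (1%:M + W) *m (A' - A) *m (1%:M + V) = - (2 *: (W - V)).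
  have -> : A' - A = (1%:M + A') - (1%:M + A) by apply/matrixP=> i j; rewrite !mxE; ring.
  have e1 : (1%:M + W) *m (1%:M + A') = 2%:M.
    by rewrite mulmxDl mul1mx hW; apply/matrixP=> i j; rewrite !mxE; case: eqP => _; ring.
  have e2 : (1%:M + A) *m (1%:M + V) = 2%:M.
    by rewrite mulmxDl mul1mx hA; apply/matrixP=> i j; rewrite !mxE; case: eqP => _; ring.
  rewrite mulmxBr e1 mulmxBl -mulmxA e2 mul_scalar_mx mul_mx_scalar.
  by apply/matrixP => i j; rewrite !mxE; ring.
have n1 (X : 'M[C]_n) : X ^t* *m X = 1%:M -> mxn (1%:M + X) <= 2 * (n * n)%:R.
  move=> hX; apply: le_trans (mxnD _ _) _; rewrite mxn1 mulr2n mulrDl !mul1r.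
  by rewrite lerD ?mxn_isometry // ler_nat; case: (n) => // k; rewrite leq_pmulr.
have : mxn (- (2 *: (W - V))) <= (2 * (n * n)%:R) * (2 * d) * (2 * (n * n)%:R).
  rewrite -E; apply: le_trans (mxnM _ _) _; apply: ler_pM; rewrite ?mxn_ge0 ?n1 //.
  by apply: le_trans (mxnM _ _) _; apply: ler_pM; rewrite ?mxn_ge0 ?n1.
have -> : mxn (- (2 *: (W - V))) = 2 * mxn (W - V).
  rewrite mxnN /mxn mulr_sumr; apply: eq_bigr => i _; rewrite mulr_sumr.
  by apply: eq_bigr => j _; rewrite [in LHS]mxE normrM normr_nat.
move=> h; have : 2 * mxn (W - V) <= 2 * e.
  apply: le_trans h _.
  have -> : 2 * (n * n)%:R * (2 * d) * (2 * (n * n)%:R) =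
      2 * (e * ((4 * (n * n)%:R ^+ 2) / (4 * (n * n)%:R ^+ 2 + 1))).
    by rewrite /d; field; rewrite gt_eqF.
  by rewrite ler_pM2l // ger_pMr // ler_pdivrMr // mul1r lerDl.
by rewrite ler_pM2l.
Qed.

(** * Approximating Hermitian projections by Gaussian rational frames *)

Definition hprojection (n : nat) (P : 'M[C]_n) : Prop := P ^t* = P /\ P *m P = P.

(** Diagonalize P = V D V^* with D of entries 0 and 1; a phase on V does not change P and makes
    [rational_unitary] applicable. Keeping exactly the columns of the rational unitary with
    eigenvalue 1 preserves the rank. *)
Lemma rational_frame (n : nat) (P : 'M[C]_n) (e : C) : hprojection P -> 0 < e ->
  exists r (W : 'M[C]_(n, r)), [/\ W ^t* *m W = 1%:M, forall i j, W i j \in gq,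
    mxn (W *m W ^t* - P) <= e & r%:R = \tr P].
Proof.
move=> [hP iP] e0.
have /orthomx_spectralP : P \is normalmx by apply/normalmxP; rewrite hP.
set U := spectralmx P; set d := spectral_diag P.
have uU : U \is unitarymx := spectral_unitarymx P.
rewrite (invmx_unitary uU) => PE.
have [c c1 uc] := unit_phase (U ^t*).
have cc : c * c^* = 1 by rewrite -normCK c1 expr1n.
pose V := c *: U ^t*; pose D := diag_mx d.
have VJ : V ^t* = c^* *: U.
  by apply/matrixP => i j; rewrite !mxE rmorphM /= conjCK.
have hV : V ^t* *m V = 1%:M.
  by rewrite VJ -scalemxAl -scalemxAr scalerA mulrC cc scale1r (unitarymxP uU).
have PV : P = V *m D *m V ^t*.
  by rewrite VJ -!scalemxAl -scalemxAr scalerA cc scale1r.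
have DE : D = V ^t* *m P *m V by rewrite PV !mulmxA hV mul1mx -mulmxA hV mulmx1.
have hV' : V *m V ^t* = 1%:M by apply: mulmx1C.
have DD : D *m D = D.
  rewrite DE -[in RHS]iP !mulmxA.
  by rewrite -[X in X *m P *m V]mulmxA hV' mulmx1.
have d01 i : d 0 i = (d 0 i == 1)%:R.
  move/matrixP/(_ i i): DD; rewrite mulmx_diag !mxE eqxx !mulr1n => /eqP.
  rewrite -subr_eq0 -[X in _ - X]mulr1 -mulrBr mulf_eq0 subr_eq0.
  by case/orP => /eqP ->; rewrite ?eqxx // eq_sym oner_eq0.
pose A := [set i | d 0 i == 1].
have dA i : d 0 i = (i \in A)%:R by rewrite inE -d01.
pose N2 : C := (n * n)%:R; have N20 : 0 <= N2 by [].
have den0 : 0 < 2 * N2 ^+ 2 + 1 by rewrite ltr_wpDl // mulr_ge0 // exprn_ge0.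
have [|W' [uW' qW' hW']] := @rational_unitary _ V (e / (2 * N2 ^+ 2 + 1)) hV uc.
  by rewrite divr_gt0.
pose W := \matrix_(i < n, k < #|A|) W' i (enum_val k).
have WW : W *m W ^t* = W' *m D *m W' ^t*.
  apply/matrixP => i j; rewrite mxE [RHS]mxE.
  under eq_bigr do rewrite adjmxE !mxE.
  rewrite -(big_enum_val (fun l => W' i l * (W' j l)^*)) big_mkcond /=.
  apply: eq_bigr => l _; rewrite adjmxE mul_mx_diag mxE dA.
  by case: ifP; rewrite ?mulr1 ?mulr0 ?mul0r.
exists #|A|, W; split.
- apply/matrixP => k l.
  transitivity ((W' ^t* *m W') (enum_val k) (enum_val l)); last first.
    by rewrite uW' !mxE (inj_eq enum_val_inj).
  by rewrite mxE [RHS]mxE; apply: eq_bigr => i _; rewrite !adjmxE !mxE.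
- by move=> i j; rewrite mxE.
- rewrite WW PV.
  have -> : W' *m D *m W' ^t* - V *m D *m V ^t* =
      (W' - V) *m D *m W' ^t* + V *m D *m (W' - V) ^t*.
    rewrite adjmxD adjmxN !(mulmxBl, mulmxBr) addrA subrK; exact: erefl.
  have nD : mxn D <= N2.
    rewrite mxn_diag; apply: le_trans (_ : \sum_(i < n) 1 <= _).
      by apply: ler_sum => i _; rewrite dA normr_nat lern1 leq_b1.
    rewrite sumr_const card_ord ler_nat; by case: (n) => // k; rewrite leq_pmulr.
  have nW := mxn_isometry uW'; have nV := mxn_isometry hV.
  apply: le_trans (mxnD _ _) _.
  set del := e / _ in hW'.
  have n1 : mxn ((W' - V) *m D *m W' ^t*) <= del * N2 * N2.
    apply: le_trans (mxnM _ _) _; apply: ler_pM; rewrite ?mxn_ge0 ?mxn_adj //.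
    by apply: le_trans (mxnM _ _) _; apply: ler_pM; rewrite ?mxn_ge0.
  have n2 : mxn (V *m D *m (W' - V) ^t*) <= N2 * N2 * del.
    apply: le_trans (mxnM _ _) _; apply: ler_pM; rewrite ?mxn_ge0 ?mxn_adj //.
    by apply: le_trans (mxnM _ _) _; apply: ler_pM; rewrite ?mxn_ge0.
  apply: le_trans (lerD n1 n2) _.
  have -> : del * N2 * N2 + N2 * N2 * del =
      e * ((2 * N2 ^+ 2) / (2 * N2 ^+ 2 + 1)).
    by rewrite /del; field; rewrite gt_eqF.
  by rewrite ger_pMr // ler_pdivrMr // mul1r lerDl.
- rewrite PV mxtrace_mulC mulmxA hV mul1mx mxtrace_diag.
  under eq_bigr do rewrite dA.
  by rewrite -natr_sum -sum1_card big_mkcond /=; congr (_%:R); apply: eq_bigr => i _;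
    case: (i \in A).
Qed.

Lemma trace_hprojection_nat (n : nat) (P : 'M[C]_n) :
  hprojection P -> exists r : nat, \tr P = r%:R.
Proof.
by move=> hP; have [r [W [_ _ _ <-]]] := rational_frame hP ltr01; exists r.
Qed.

Lemma isometry_hprojection (n r : nat) (W : 'M[C]_(n, r)) :
  W ^t* *m W = 1%:M -> hprojection (W *m W ^t*).
Proof.
move=> h; split; first by rewrite adjmxM trmxCK.
by rewrite mulmxA -[X in X *m _]mulmxA h mulmx1.
Qed.

Lemma isometry_trace (n r : nat) (W : 'M[C]_(n, r)) :
  W ^t* *m W = 1%:M -> \tr (W *m W ^t*) = r%:R.
Proof. by move=> h; rewrite mxtrace_mulC h mxtrace1. Qed.

(* A (A* A)^-1 A* is the orthogonal projection onto the column space of A. *)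
Lemma near_isometry_projection (n r : nat) (A : 'M[C]_(n, r)) :
  mxn (1%:M - A ^t* *m A) <= 2^-1 ->
  exists P : 'M[C]_n, [/\ hprojection P, \tr P = r%:R &
    mxn (P - A *m A ^t*) <= mxn A ^+ 2 * (2 * r%:R * mxn (1%:M - A ^t* *m A))].
Proof.
set G := A ^t* *m A => hE.
have GJ : G ^t* = G by rewrite /G adjmxM trmxCK.
have half0 (x : C) : 0 <= x -> x <= x * 2^-1 -> x = 0.
  move=> x0; rewrite -subr_le0 => h; apply/eqP; rewrite eq_le x0 andbT.
  have : x * 2^-1 <= 0 by apply: le_trans h; rewrite -[X in X - _]mulr1 -mulrBr;
    have -> : 1 - 2^-1 = 2^-1 :> C by field.
  by rewrite pmulr_lle0 // invr_gt0.
have uG : G \in unitmx.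
  apply: unitmx_row0 => x hx; apply: mxn_eq0; apply: half0; first exact: mxn_ge0.
  have {1}-> : x = x *m (1%:M - G) by rewrite mulmxBr hx subr0 mulmx1.
  by apply: le_trans (mxnM _ _) _; rewrite ler_wpM2l // mxn_ge0.
(* Writing the inverse as a fixed point bounds its norm by r plus half of itself; the same
   contraction, x = x (1 - G), has just shown that G has trivial kernel. *)
have E1 : invmx G = 1%:M + invmx G *m (1%:M - G).
  by rewrite mulmxBr mulmx1 mulVmx // addrC subrK.
have iJ : (invmx G) ^t* = invmx G.
  have : (invmx G) ^t* *m G = 1%:M by rewrite -{2}GJ -adjmxM mulmxV // adjmx1.
  by move/(congr1 (fun M => M *m invmx G)); rewrite mulmxK // mul1mx.
have nI : mxn (invmx G) <= 2 * r%:R.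
  have : mxn (invmx G) <= r%:R + mxn (invmx G) * 2^-1.
    rewrite {1}E1; apply: le_trans (mxnD _ _) _; rewrite mxn1 lerD2l.
    by apply: le_trans (mxnM _ _) _; rewrite ler_wpM2l // mxn_ge0.
  rewrite -lerBlDr; have -> : mxn (invmx G) - mxn (invmx G) * 2^-1 = mxn (invmx G) / 2.
    by field.
  by rewrite ler_pdivrMr // mulrC.
exists (A *m invmx G *m A ^t*); split.
- split; first by rewrite !adjmxM trmxCK iJ mulmxA.
  rewrite -[LHS]mulmxA; have -> : A ^t* *m (A *m invmx G *m A ^t*) = A ^t*.
    by rewrite !mulmxA mulmxV // mul1mx.
  by [].
- by rewrite mxtrace_mulC mulmxA mulmxV // mxtrace1.
- have -> : A *m invmx G *m A ^t* - A *m A ^t* =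
      A *m (invmx G *m (1%:M - G)) *m A ^t*.
    have -> : invmx G *m (1%:M - G) = invmx G - 1%:M by rewrite mulmxBr mulmx1 mulVmx.
    by rewrite mulmxBr mulmxBl mulmx1.
  apply: le_trans (mxnM _ _) _; rewrite mxn_adj expr2 [leRHS]mulrAC.
  rewrite ler_wpM2r ?mxn_ge0 //; apply: le_trans (mxnM _ _) _.
  rewrite ler_wpM2l ?mxn_ge0 //; apply: le_trans (mxnM _ _) _.
  by rewrite ler_wpM2r ?mxn_ge0.
Qed.

(** * Density matrices *)

(** Positivity at e_j - w e_i, with w the phase of the entry (i, j), gives 2 |rho_ij| <= rho_ii +
    rho_jj <= 2. *)
Lemma density_entry (n : nat) (rho : 'M[C]_n) i j :
  density_matrix rho -> `|rho i j| <= 1.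
Proof.
move=> [hJ pos tr1].
have diag k : 0 <= rho k k.
  have := pos (delta_mx k 0); have -> : (delta_mx k 0 : 'cV[C]_n) ^t* = delta_mx 0 k.
    by apply/matrixP => a b; rewrite !mxE conjC_nat andbC.
  by rewrite -rowE -colE !mxE.
have diag1 k : rho k k <= 1.
  by rewrite -tr1 /mxtrace (bigD1 k) //= lerDl sumr_ge0.
have [-> |nz] := eqVneq (rho i j) 0; first by rewrite normr0 ler01.
have n0 : `|rho i j| != 0 by rewrite normr_eq0.
pose w := rho i j / `|rho i j|.
pose v : 'cV[C]_n := delta_mx j 0 - w *: delta_mx i 0.
have wJ : w^* * rho i j = `|rho i j|.
  by rewrite /w rmorphM fmorphV /= (CrealP (normr_real _)) mulrAC -normCKC expr2 mulfK.
have ww : w^* * w = 1.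
  by rewrite -normCKC /w normf_div normr_id divff // expr1n.
have rJ : rho j i = (rho i j)^* by rewrite -{1}hJ adjmxE.
have := pos v.
have -> : (v ^t* *m rho *m v) 0 0 =
    rho j j - w * rho j i - w^* * rho i j + w^* * w * rho i i.
  have vJ : v ^t* = delta_mx 0 j - w^* *: delta_mx 0 i.
    by apply/matrixP => a b; rewrite !mxE !rmorphB !rmorphM /= !conjC_nat [(b == _) && _]andbC
      [(b == i) && _]andbC.
  rewrite vJ mulmxBl -scalemxAl -!rowE /v mulmxBr -scalemxAr -!colE !mxE.
  by ring.
have -> : w * rho j i = `|rho i j|.
  by rewrite rJ -[w]conjCK -rmorphM wJ; apply/CrealP; exact: normr_real.
rewrite wJ ww mul1r => h.
have : `|rho i j| + `|rho i j| <= 1 + 1.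
  apply: le_trans (lerD (diag1 j) (diag1 i)); rewrite -subr_ge0.
  by apply: le_trans h _; rewrite le_eqVlt; apply/orP; left; apply/eqP; ring.
by rewrite -!mulr2n lerMn2r.
Qed.

Lemma density_trace_bound (n : nat) (rho X : 'M[C]_n) :
  density_matrix rho -> `|\tr (rho *m X)| <= mxn X.
Proof.
move=> hr; rewrite mxtrace_mulC /mxtrace /mxn; apply: le_trans (ler_norm_sum _ _ _) _.
apply: ler_sum => i _; rewrite mxE; apply: le_trans (ler_norm_sum _ _ _) _.
apply: ler_sum => j _; by rewrite normrM ler_piMr // density_entry.
Qed.

(** * A lower bound for nonzero eigenvalues of Gaussian integer matrices *)

Definition gz : {pred C} :=
  fun z => (complex.Re z \is a Num.int) && (complex.Im z \is a Num.int).

Lemma gzE (a b : RR) :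
  (Complex a b \in gz) = (a \is a Num.int) && (b \is a Num.int).
Proof. by []. Qed.

Lemma gz_subring_closed : subring_closed gz.
Proof.
split.
- by rewrite -[1]/(Complex 1 0) gzE rpred1 rpred0.
- case=> a b [c d]; rewrite !gzE => /andP[h1 h2] /andP[h3 h4].
  suff : Complex (a - c) (b - d) \in gz by [].
  by rewrite gzE !rpredB.
- case=> a b [c d]; rewrite !gzE => /andP[h1 h2] /andP[h3 h4].
  suff : Complex (a * c - b * d) (a * d + b * c) \in gz by [].
  by rewrite gzE rpredB ?rpredD ?rpredM.
Qed.

HB.instance Definition _ := GRing.isSubringClosed.Build C gz gz_subring_closed.

Lemma gz_conj (z : C) : z \in gz -> z^* \in gz.
Proof.
case: z => a b; rewrite gzE => /andP[h1 h2].
by rewrite -[_^*]/(Complex a (- b)) gzE rpredN h1 h2.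
Qed.

Lemma gz_real (x : RR) : x \is a Num.int -> x%:C%C \in gz.
Proof. by move=> h; rewrite -[x%:C%C]/(Complex x 0) gzE h rpred0. Qed.

Lemma gz_norm_ge1 (z : C) : z \in gz -> z != 0 -> 1 <= `|z|.
Proof.
have h1 (x : RR) : x \is a Num.int -> x != 0 -> 1 <= x ^+ 2.
  by move=> hx x0; rewrite -[x ^+ 2]real_normK ?num_real // exprn_ege1 // norm_intr_ge1.
case: z => a b; rewrite gzE => /andP[ha hb].
rewrite eq_complex negb_and /= => hz; rewrite normc_def lecE /= eqxx /=.
rewrite -[X in X <= _]sqrtr1 ler_wsqrtr //.
by case/orP: hz => [/(h1 _ ha)|/(h1 _ hb)] h; [rewrite ler_wpDr ?sqr_ge0|
  rewrite ler_wpDl ?sqr_ge0].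
Qed.

Lemma prod_XsubC_split (r : seq C) : exists k,
  \prod_(z <- r) ('X - z%:P) = 'X^k * \prod_(z <- r | z != 0) ('X - z%:P).
Proof.
elim: r => [|z r [k IH]]; first by exists 0%N; rewrite !big_nil mulr1.
rewrite !big_cons IH; case: eqVneq => [-> |_].
  by exists k.+1; rewrite subr0 exprS mulrA.
by exists k; rewrite mulrCA.
Qed.

Lemma prod_norm_le (r : seq C) (B l : C) : 1 <= B -> all (fun z => `|z| <= B) r ->
  l \in r -> l != 0 -> \prod_(z <- r | z != 0) `|z| <= `|l| * B ^+ size r.
Proof.
move=> B1 hB lr l0; have B0 : 0 <= B := le_trans ler01 B1.
have hprod (s : seq C) : all (fun z => `|z| <= B) s ->
    \prod_(z <- s | z != 0) `|z| <= B ^+ size s.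
  elim: s => [|z s IH] /=; first by rewrite big_nil expr0.
  case/andP => hz /IH h; rewrite big_cons exprS; case: ifP => _.
    by rewrite ler_pM // prodr_ge0.
  by apply: le_trans h _; rewrite ler_peMl // exprn_ge0.
elim: r lr hB => //= z r IH; rewrite inE => /orP[/eqP e|lr] /andP[hz hr].
  rewrite big_cons -e l0 ler_wpM2l //; apply: le_trans (hprod _ hr) _.
  by rewrite exprS ler_peMl // exprn_ge0.
rewrite big_cons exprS mulrCA; case: ifP => _.
  by rewrite ler_pM ?prodr_ge0 // IH.
by apply: le_trans (IH lr hr) _; rewrite ler_peMl // mulr_ge0 // exprn_ge0.
Qed.

(** The lowest nonzero coefficient of the characteristic polynomial is, up to sign, the product of
    the nonzero eigenvalues. It is a nonzero Gaussian integer, so of modulus at least 1, and all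
    other factors are at most B. *)
Lemma eigenvalue_gap (n : nat) (T : 'M[C]_n) (B l : C) (x : 'rV[C]_n) :
  (forall i j, T i j \in gz) -> mxn T <= B -> 1 <= B ->
  x != 0 -> x *m T = l *: x -> l != 0 -> 1 <= `|l| * B ^+ n.
Proof.
move=> gT hB B1 x0 hx l0.
have lroot : root (char_poly T) l.
  by rewrite -eigenvalue_root_char; apply/eigenvalueP; exists x.
have [r hr] := closed_field_poly_normal (char_poly T).
rewrite (monicP (char_poly_monic T)) scale1r in hr.
have szr : size r = n.
  by have := size_char_poly T; rewrite hr size_prod_XsubC => -[].
have lr : l \in r by rewrite -root_prod_XsubC -hr.
have rB : all (fun z => `|z| <= B) r.
  apply/allP => z; rewrite -root_prod_XsubC -hr -eigenvalue_root_char.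
  move/eigenvalueP => [v hv v0].
  have nv : 0 < mxn v.
    rewrite lt_def mxn_ge0 andbT; apply: contraNN v0 => /eqP /mxn_eq0 ->.
    by rewrite eqxx.
  have : mxn (v *m T) <= mxn v * mxn T by apply: mxnM.
  have -> : mxn (v *m T) = mxn v * `|z|.
    rewrite hv /mxn mulr_suml; apply: eq_bigr => i _; rewrite mulr_suml.
    by apply: eq_bigr => j _; rewrite mxE normrM mulrC.
  by rewrite ler_pM2l // => h; apply: le_trans hB.
have [k hk] := prod_XsubC_split r.
(* Here k is the multiplicity of the eigenvalue 0, so this is the lowest nonzero coefficient. *)
have gk : (char_poly T)`_k \in gz.
  suff /polyOverP -> : char_poly T \is a polyOver gz by [].
  rewrite /char_poly rpred_sum // => s _; rewrite rpredMsign rpred_prod // => i _.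
  by rewrite !mxE rpredB ?rpredMn ?polyOverX // polyOverC.
move: gk; rewrite hr hk coefXnM ltnn subnn -horner_coef0 horner_prod.
under eq_bigr do rewrite hornerXsubC sub0r.
move=> gk; have : 1 <= `|\prod_(z <- r | z != 0) - z|.
  apply: gz_norm_ge1 => //; rewrite prodf_seq_neq0; apply/allP => z _.
  by apply/implyP; rewrite oppr_eq0.
rewrite normr_prod; under eq_bigr do rewrite normrN.
by move=> h; apply: le_trans h _; rewrite -szr; apply: prod_norm_le.
Qed.

(** * Distance of a root to a rational circle *)

Lemma gz_lin_mx (m n : nat) (f : 'M[C]_n -> 'M[C]_m) :
  (forall Y : 'M[C]_n, (forall i j, Y i j \in gz) -> forall i j, f Y i j \in gz) ->
  forall i j, lin_mx f i j \in gz.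
Proof.
move=> hf i j; rewrite /lin_mx /lin1_mx mxE /=; case/mxvec_indexP: j => k l.
rewrite mxvecE; apply: hf => a b; rewrite !mxE rpred_nat //.
Qed.

Lemma mxn_lin_mx (n : nat) (f : 'M[C]_n -> 'M[C]_n) (b : C) : 0 <= b ->
  (forall Y, mxn (f Y) <= b * mxn Y) -> mxn (lin_mx f) <= (n * n * (n * n))%:R * b.
Proof.
move=> b0 hf; apply: mxn_bound => i j; rewrite /lin_mx /lin1_mx mxE /=.
case/mxvec_indexP: j => k l; rewrite mxvecE; apply: le_trans (mxn_entry _ _ _) _.
apply: le_trans (hf _) _; case/mxvec_indexP: i => a c.
rewrite vec_mx_delta -[leRHS]mulr1 ler_wpM2l //.
rewrite /mxn (bigD1 a) //= (bigD1 c) //= mxE !eqxx normr1 !big1 ?addr0 // => u ua.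
  by rewrite big1 // => v _; rewrite mxE (negbTE ua) normr0.
by rewrite mxE (negbTE ua) andbF normr0.
Qed.

(** The square of the modulus stays rational on Gaussian rationals, so comparisons with it are
    decidable. *)
Definition nrm2 (z : C) : RR := complex.Re z ^+ 2 + complex.Im z ^+ 2.

Section RootGap.
Variables (a : nat -> RR) (d Y : nat) (D c1 c2 R : RR) (z : C).
Hypotheses (d0 : (0 < d)%N) (ad : a d != 0) (dY : (d <= Y)%N) (Y0 : (0 < Y)%N).
Hypotheses (D0 : D != 0) (Dint : D \is a Num.int) (DY : `|D| <= Y%:R).
Hypotheses (aint : forall i, (i <= d)%N -> D * a i \is a Num.int)
  (aY : forall i, (i <= d)%N -> `|D * a i| <= Y%:R).
Hypotheses (cint1 : D * c1 \is a Num.int) (cint2 : D * c2 \is a Num.int)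
  (Rint : D * R \is a Num.int) (cY1 : `|D * c1| <= Y%:R) (cY2 : `|D * c2| <= Y%:R)
  (RY : `|D * R| <= Y%:R).
Hypotheses (zroot : \sum_(i < d.+1) (a i)%:C%C * z ^+ i = 0).

(* The columns (z^i)_i are eigenvectors of the companion matrix, so the outer
   product of such a column with itself is an eigenvector of
   Y |-> k^2 R^2 Y - k^2 (A - c) Y (A - c)*  for  k^2 (R^2 - |z - c|^2). *)
Lemma root_gap : nrm2 (z - Complex c1 c2) < R ^+ 2 ->
  1 <= (R ^+ 2 - nrm2 (z - Complex c1 c2)) *
       (Y ^ 4 * (10 * Y ^ 16) ^ (Y ^ 2))%:R.
Proof.
move=> zin.
pose c : C := Complex c1 c2.
(* The factor k = D^2 a_d clears all denominators: k a_j / a_d is D (D a_j), and k c is (D a_d)(D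
   c). *)
pose l := D * a d; pose k := l * D.
have k0 : k != 0 by rewrite !mulf_neq0.
pose A : 'M[C]_d := \matrix_(i, j)
  if (i.+1 < d)%N then (j == i.+1 :> nat)%:R else - (a j / a d)%:C%C.
pose x : 'cV[C]_d := \col_i z ^+ i.
have Ax : A *m x = z *: x.
  apply/matrixP => i j; rewrite [LHS]mxE [RHS]mxE [x i j]mxE -exprS.
  case: (ltnP i.+1 d) => hi.
    rewrite (bigD1 (Ordinal hi)) //= big1 ?addr0.
      by rewrite !mxE hi eqxx mul1r.
    move=> u ui; rewrite !mxE hi; have -> : (u == i.+1 :> nat) = false.
      by apply: contraNF ui => /eqP e; apply/eqP/val_inj.
    by rewrite mul0r.
  have -> : (i.+1 = d)%N by apply/eqP; rewrite eqn_leq hi andbT.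
  move/eqP: zroot; rewrite big_ord_recr /= addr_eq0 => /eqP h.
  have adC : (a d)%:C%C != 0 by rewrite fmorph_eq0.
  apply: (mulfI adC); rewrite mulr_sumr.
  transitivity (- \sum_(j < d) (a j)%:C%C * z ^+ j); last by rewrite h opprK.
  rewrite -sumrN; apply: eq_bigr => u _; rewrite !mxE ltnNge hi /=.
  by rewrite rmorphM fmorphV /=; field.
have kint : k \is a Num.int by rewrite /k /l rpredM ?aint.
have kY : `|k| <= (Y ^ 2)%:R.
  by rewrite /k normrM expnS expn1 natrM ler_pM ?aY.
have nR (t : RR) : `|t%:C%C| = `|t|%:C%C.
  by rewrite normc_def /= expr0n addr0 sqrtr_sqr.
have natC (m : nat) : (m%:R : C) = (m%:R : RR)%:C%C by rewrite rmorph_nat.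
pose B := k%:C%C *: (A - c%:M).
have BE i j : B i j = k%:C%C * A i j - (i == j)%:R * (k%:C%C * c).
  by rewrite !mxE mulrBr; case: (i == j); rewrite ?mul1r ?mul0r ?mulr0 ?mulr1n ?mulr0n ?mulr0.
have kc : k%:C%C * c = Complex (l * (D * c1)) (l * (D * c2)) :> C.
  rewrite /c /k; apply/eqP; rewrite eq_complex /=.
  by apply/andP; split; apply/eqP; ring.
have kA i j : k%:C%C * A i j = (if (i.+1 < d)%N then k * (j == i.+1 :> nat)%:R
    else - (D * (D * a j)))%:C%C :> C.
  rewrite mxE; case: ifP => _; first by case: (_ == _ :> nat); rewrite ?mulr1 ?mulr0.
  by rewrite -rmorphN -rmorphM; congr (_%:C)%C; rewrite /k /l; field.
have gB i j : B i j \in gz.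
  have kc' : k%:C%C * c \in gz.
    by rewrite kc gzE; apply/andP; split; apply: rpredM; rewrite ?aint.
  rewrite BE; apply: rpredB; last by apply: rpredM => //; exact: rpred_nat.
  rewrite kA gz_real //; case: ifP => _; first by rewrite rpredM ?rpred_nat.
  by rewrite rpredN rpredM ?aint // ltnW.
have B3 i j : `|B i j| <= (3 * Y ^ 2)%:R.
  rewrite BE; apply: le_trans (ler_normB _ _) _.
  have h1 : `|k%:C%C * A i j| <= (Y ^ 2)%:R.
    rewrite kA nR natC lecR; case: ifP => _.
      by rewrite normrM normr_nat; apply: le_trans kY; rewrite ler_piMr // lern1 leq_b1.
    by rewrite normrN normrM expnS expn1 natrM ler_pM ?aY // ltnW.
  have h2 : `|(i == j)%:R * (k%:C%C * c)| <= (2 * Y ^ 2)%:R.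
    apply: le_trans (_ : `|k%:C%C * c| <= _).
      by rewrite normrM normr_nat ler_piMl // lern1 leq_b1.
    rewrite kc; have -> : Complex (l * (D * c1)) (l * (D * c2)) =
      (l * (D * c1))%:C%C + Complex 0 1 * (l * (D * c2))%:C%C.
      by apply/eqP; rewrite eq_complex /=; apply/andP; split; apply/eqP; ring.
    apply: le_trans (ler_normD _ _) _; rewrite normrM !nR.
    have -> : `|Complex 0 1 : C| = 1.
      by rewrite normc_def /= expr0n expr1n add0r sqrtr1.
    rewrite mul1r -rmorphD natC lecR mul2n -addnn natrD expnS expn1 natrM.
    by rewrite lerD // normrM ler_pM ?aY.
  by apply: le_trans (lerD h1 h2) _; rewrite -natrD -mulSn.
have Bx : B *m x = (k%:C%C * (z - c)) *: x.
  by rewrite /B -scalemxAl mulmxBl Ax mul_scalar_mx -scalerBl scalerA.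
pose W0 := x *m x ^t*.
pose T := ((k * R) ^+ 2)%:C%C%:M - lin_mulmx B *m lin_mulmxr (B ^t*).
pose lam := k ^+ 2 * (R ^+ 2 - nrm2 (z - c)).
have WT : mxvec W0 *m T = lam%:C%C *: mxvec W0.
  rewrite /T mulmxBr mul_mx_scalar mulmxA !mul_vec_lin /=.
  have -> : B *m W0 *m B ^t* = (k ^+ 2 * nrm2 (z - c))%:C%C *: W0.
    rewrite /W0 !mulmxA -mulmxA -adjmxM Bx.
    have -> : ((k%:C%C * (z - c)) *: x) ^t* = (k%:C%C * (z - c))^* *: x ^t*.
      by apply/matrixP => i j; rewrite !mxE rmorphM.
    rewrite -scalemxAl -scalemxAr scalerA; congr (_ *: _).
    case: (z - c) => u v; apply/eqP; rewrite /nrm2 eq_complex /=.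
    by apply/andP; split; apply/eqP; ring.
  rewrite linearZ /= -scalerBl; congr (_ *: _).
  by rewrite -rmorphB; congr (_%:C)%C; rewrite /lam; ring.
have W00 : mxvec W0 != 0.
  apply/eqP => /(congr1 vec_mx); rewrite mxvecK linear0 => /matrixP.
  move=> /(_ (Ordinal d0) (Ordinal d0)); rewrite mxE big_ord1 !mxE /= expr0.
  by rewrite mul1r conjC1 => /eqP; rewrite oner_eq0.
have gT i j : T i j \in gz.
  rewrite mxE rpredD //.
    by rewrite mxE rpredMn // gz_real // rpredX // /k -mulrA rpredM ?aint.
  rewrite mxE rpredN mxE rpred_sum // => u _.
  rewrite rpredM //; apply: gz_lin_mx => Y1 hY1 i1 j1; rewrite mxE rpred_sum // => v _;
    rewrite rpredM //.
  by rewrite adjmxE gz_conj.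
have dd : (d * d * (d * d) <= Y ^ 4)%N.
  by rewrite -[4%N]/(2 + 2)%N expnD !expnS !expn0 !muln1 !leq_mul.
have nB : mxn B <= (3 * Y ^ 4)%:R.
  apply: le_trans (mxn_bound B3) _; rewrite -natrM ler_nat mulnCA leq_mul2l /=.
  by rewrite -[4%N]/(2 + 2)%N expnD leq_mul2r expnS expn1 leq_mul // orbT.
(* The constant collects Y^8 from the scalar part and 3 Y^8 from each of the left and right
   multiplications by B and its adjoint. *)
have nT : mxn T <= (10 * Y ^ 16)%:R.
  apply: le_trans (mxnB _ _) _.
  have n1 : mxn (((k * R) ^+ 2)%:C%C%:M : 'M[C]_(d * d)) <= (Y ^ 8)%:R.
    apply: le_trans (_ : (d * d * (d * d))%:R * ((Y ^ 4)%:R) <= _); last first.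
      by rewrite -natrM ler_nat -[8%N]/(4 + 4)%N expnD leq_mul2r dd orbT.
    apply: mxn_bound => i j; rewrite mxE; case: (i == j); last by rewrite mulr0n normr0.
    rewrite mulr1n nR natC lecR normrX -[4%N]/(2 * 2)%N expnM natrX.
    rewrite lerXn2r ?nnegrE // /k -mulrA normrM expnS expn1 natrM.
    by rewrite ler_pM ?aY.
  have hY8 : ((d * d * (d * d))%:R * (3 * Y ^ 4)%:R <= (3 * Y ^ 8)%:R :> C).
    by rewrite -natrM ler_nat mulnCA leq_mul2l /= -[8%N]/(4 + 4)%N expnD leq_mul2r dd orbT.
  have n2 : mxn (lin_mulmx B : 'M[C]_(d * d)) <= (3 * Y ^ 8)%:R.
    apply: le_trans _ hY8; apply: (@mxn_lin_mx d (mulmx B)) => // Y1.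
    by apply: le_trans (mxnM _ _) _; rewrite ler_wpM2r // mxn_ge0.
  have n3 : mxn (lin_mulmxr (B ^t*) : 'M[C]_(d * d)) <= (3 * Y ^ 8)%:R.
    apply: le_trans _ hY8; apply: (@mxn_lin_mx d (mulmxr (B ^t*))) => // Y1 /=.
    by apply: le_trans (mxnM _ _) _; rewrite mulrC mxn_adj ler_wpM2r // mxn_ge0.
  apply: le_trans (lerD n1 (le_trans (mxnM _ _) (ler_pM (mxn_ge0 _) (mxn_ge0 _) n2 n3))) _.
  rewrite -natrM -natrD ler_nat.
  have : (Y ^ 8 <= Y ^ 16)%N by rewrite leq_pexp2l.
  have -> : (3 * Y ^ 8 * (3 * Y ^ 8) = 9 * Y ^ 16)%N.
    by rewrite mulnACA -expnD.
  by move=> h; rewrite [(10 * _)%N]mulSn leq_add2r.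
have lam0 : 0 < lam by rewrite mulr_gt0 ?subr_gt0 // exprn_even_gt0.
have : 1 <= `|lam%:C%C| * (10 * Y ^ 16)%:R ^+ (d * d).
  apply: eigenvalue_gap gT nT _ W00 WT _.
    by rewrite ler1n muln_gt0 expn_gt0 Y0.
  by rewrite fmorph_eq0 gt_eqF.
rewrite nR gtr0_norm // -natrX natC -rmorphM -[1]/(1%:C)%C lecR => h.
apply: le_trans h _; rewrite natrM mulrA; apply: ler_pM => //; first exact: ltW.
  rewrite /lam mulrC ler_pM2l ?subr_gt0 // -[k ^+ 2]real_normK ?num_real //.
  by rewrite -[4%N]/(2 * 2)%N expnM [leRHS]natrX lerXn2r ?nnegrE.
rewrite ler_nat leq_pexp2l ?muln_gt0 ?expn_gt0 ?Y0 // expnS expn1; exact: leq_mul.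
Qed.
End RootGap.

(** * Approximating algebraic numbers from their codes *)

Lemma comp_0R {A : Type} {rA : Rep A} : computable (fun _ : A => 0 : RR).
Proof. exact: (comp_natR (comp_nat 0)). Qed.

Lemma comp_1R {A : Type} {rA : Rep A} : computable (fun _ : A => 1 : RR).
Proof. exact: (comp_natR (comp_nat 1)). Qed.

Lemma comp_0C {A : Type} {rA : Rep A} : computable (fun _ : A => 0 : C).
Proof. exact: (comp_natC (comp_nat 0)). Qed.

Lemma comp_nrm2 {A : Type} {rA : Rep A} (f : A -> C) :
  computable f -> computable (fun a => nrm2 (f a)).
Proof.
move=> hf; apply: (@comp_ext _ _ _ _ (fun a => complex.Re (f a) * complex.Re (f a) +
  complex.Im (f a) * complex.Im (f a))); first by move=> a; rewrite /nrm2 !expr2.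
by apply: comp_addR; apply: comp_mulR; (exact: comp_Re || exact: comp_Im).
Qed.

Ltac comp_ext2 ::= match goal with
  | |- computable (fun _ => @GRing.zero _) => first [exact: comp_0R | exact: comp_0C]
  | |- computable (fun _ => @GRing.one _) => exact: comp_1R
  | |- computable (fun a => nrm2 (@?f a)) => apply: (comp_nrm2 (f := f))
  | |- computable (fun a => decR (@?f a)) => apply: (comp_decR (f := f))
  | |- computable (fun a => decC (@?f a)) => apply: (comp_decC (f := f))
  | |- computable (fun a => str_info (@?f a)) => apply: (comp_str_info (f := f))
  | |- computable (fun a => Alg (@?f a)) => apply: (comp_Alg (f := f))
  | |- computable (fun a => @GRing.inv _ (@GRing.exp _ _ (@?f a))) =>
      apply: (comp_inv2X (f := f))
  | |- computable (fun a => @GRing.add _ (@?f a) (@?g a)) =>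
      first [apply: (comp_addR (f := f) (g := g)) | apply: (comp_addC (f := f) (g := g))]
  | |- computable (fun a => @GRing.mul _ (@?f a) (@?g a)) =>
      first [apply: (comp_mulR (f := f) (g := g)) | apply: (comp_mulC (f := f) (g := g))]
  | |- computable (fun a => @GRing.opp _ (@?f a)) =>
      first [apply: (comp_oppR (f := f)) | apply: (comp_oppC (f := f))]
  | |- computable (fun a => @GRing.natmul _ _ (@?f a)) =>
      first [apply: (comp_natR (f := f)) | apply: (comp_natC (f := f))]
  | |- computable (fun a => @bsum _ (@?n a) (@?f a)) =>
      first [apply: (comp_bsumR (n := n) (F := f)) | apply: (comp_bsumC (n := n) (F := f))]
  | |- computable (fun a => @Order.le _ _ (@?f a) (@?g a)) =>
      apply: (comp_leR (f := f) (g := g))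
  | |- computable (fun a => @Order.lt _ _ (@?f a) (@?g a)) =>
      apply: (comp_ltR (f := f) (g := g))
  | |- computable (fun a => @eq_op _ (@?f a) (@?g a)) =>
      first [apply: (comp_eqR (f := f) (g := g)) | apply: (comp_eqC (f := f) (g := g))]
  | |- computable (fun a => Complex (@?f a) (@?g a)) =>
      apply: (comp_Complex (f := f) (g := g))
  | |- computable (fun a => complex.Re (@?f a)) => apply: (comp_Re (f := f))
  | |- computable (fun a => complex.Im (@?f a)) => apply: (comp_Im (f := f))
  | |- computable (fun a => @Num.conj _ (@?f a)) => apply: (comp_conjC (f := f))
  end.

Definition nm (z : C) : RR := Num.sqrt (nrm2 z).

Lemma nmE (z : C) : `|z| = (nm z)%:C%C.
Proof. by rewrite normc_def. Qed.

Lemma nm_ge0 (z : C) : 0 <= nm z.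
Proof. exact: sqrtr_ge0. Qed.

Lemma nm_sqr (z : C) : nm z ^+ 2 = nrm2 z.
Proof. by rewrite sqr_sqrtr // addr_ge0 ?sqr_ge0. Qed.

Lemma nmM (x y : C) : nm (x * y) = nm x * nm y.
Proof. by apply: complexI; rewrite rmorphM /= -!nmE normrM. Qed.

Lemma nmX (x : C) (n : nat) : nm (x ^+ n) = nm x ^+ n.
Proof. by apply: complexI; rewrite rmorphXn /= -!nmE normrX. Qed.

Lemma nmD (x y : C) : nm (x + y) <= nm x + nm y.
Proof. by rewrite -lecR rmorphD /= -!nmE ler_normD. Qed.

Lemma nmN (x : C) : nm (- x) = nm x.
Proof. by apply: complexI; rewrite -!nmE normrN. Qed.

Lemma nm_dist (x y : C) : nm (x - y) = nm (y - x).
Proof. by rewrite -nmN opprB. Qed.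

Lemma nm_tri (x y z : C) : nm (x - z) <= nm (x - y) + nm (y - z).
Proof. by have := nmD (x - y) (y - z); rewrite addrA subrK. Qed.

Lemma nm_real (x : RR) : nm x%:C%C = `|x|.
Proof. by rewrite /nm /nrm2 /= expr0n addr0 sqrtr_sqr. Qed.

Lemma nm_sum (I : Type) (r : seq I) (F : I -> C) :
  nm (\sum_(i <- r) F i) <= \sum_(i <- r) nm (F i).
Proof.
elim/big_ind2: _ => [|x1 x2 y1 y2 h1 h2|//].
  by rewrite [nm _](nm_real 0) normr0.
by apply: le_trans (nmD _ _) _; apply: lerD.
Qed.

Lemma nm_Re (z : C) : `|complex.Re z| <= nm z.
Proof. by rewrite -lecR -nmE normc_ge_Re. Qed.

Lemma nm_Im (z : C) : `|complex.Im z| <= nm z.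
Proof.
by rewrite -[`|_|]sqrtr_sqr ler_wsqrtr // /nrm2 ler_wpDl ?sqr_ge0.
Qed.

Lemma nm_le_sum (z : C) : nm z <= `|complex.Re z| + `|complex.Im z|.
Proof.
have h : 0 <= `|complex.Re z| + `|complex.Im z| by rewrite addr_ge0.
rewrite -[leRHS]ger0_norm // -sqrtr_sqr ler_wsqrtr // /nrm2 sqrrD.
by rewrite !real_normK ?num_real // lerD2r lerDl mulrn_wge0 // mulr_ge0.
Qed.

Lemma nm_prod (I : Type) (r : seq I) (F : I -> C) :
  nm (\prod_(i <- r) F i) = \prod_(i <- r) nm (F i).
Proof.
elim/big_ind2: _ => [|x1 x2 y1 y2 <- <-|//]; last by rewrite nmM.
by rewrite [nm _](nm_real 1) normr1.
Qed.

(** The reason why all later bounds can be functions of the code alone. *)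
Lemma seq_dec_bound (n : nat) :
  (size (seq_dec n) <= n)%N /\ {in seq_dec n, forall k, (k < n)%N}.
Proof.
have [m] := ubnP n; elim: m n => // m IH [|n] lt //.
have [|h1 h2] := IH (unpair n).2.
  by apply: leq_ltn_trans (unpair2_le n) _.
rewrite seq_decS; split; first by rewrite /= ltnS (leq_trans h1) // unpair2_le.
move=> k; rewrite inE => /orP[/eqP ->|/h2 h]; first by rewrite ltnS unpair1_le.
by apply: leq_trans h _; apply: leq_trans (unpair2_le n) _.
Qed.

Section RationalCodes.
Variables (k c : nat).
Hypothesis kc : (k <= c)%N.

Lemma decR_num_bound : (rpos k <= c /\ rneg k <= c /\ rden k <= c)%N.
Proof.
have h1 := unpair1_le k; have h2 := unpair2_le k.
rewrite /rpos /rneg /rden; case: ifP => o; split; try split; try lia.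
Qed.

Lemma decR_bound : `|decR k| <= c.+1%:R.
Proof.
have [h1 [h2 h3]] := decR_num_bound.
rewrite decRE normrM normfV normr_nat ler_pdivrMr ?ltr0n //.
apply: le_trans (_ : c.+1%:R <= _); last by rewrite ler_peMr // ler1n.
have : (rpos k)%:R <= c%:R :> RR by rewrite ler_nat.
have : (rneg k)%:R <= c%:R :> RR by rewrite ler_nat.
have p1 : 0 <= (rpos k)%:R :> RR by []. have p2 : 0 <= (rneg k)%:R :> RR by [].
rewrite ler_norml -natr1 => a1 a2; apply/andP; split; lra.
Qed.

(** One factorial is a common denominator for all rationals coded below c, as [root_gap]
    requires. *)
Lemma decR_fact_int : (c.+1)`!%:R * decR k \is a Num.int.
Proof.
have [h1 [h2 h3]] := decR_num_bound.
rewrite decRE mulrCA; apply: rpredM; first by rewrite rpredB ?rpred_nat.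
have /dvdnP[q ->] : ((rden k).+1 %| (c.+1)`!)%N by rewrite dvdn_fact.
by rewrite natrM mulfK ?pnatr_eq0 // rpred_nat.
Qed.

Lemma decR_lower : decR k != 0 -> 1 <= c.+1%:R * `|decR k|.
Proof.
have [h1 [h2 h3]] := decR_num_bound.
rewrite decRE normrM normfV normr_nat => nz.
have n0 : (rpos k)%:R - (rneg k)%:R != 0 :> RR.
  by apply: contraNneq nz => ->; rewrite mul0r.
rewrite mulrCA; apply: le_trans (_ : `|(rpos k)%:R - (rneg k)%:R| * 1 <= _).
  by rewrite mulr1 norm_intr_ge1 // rpredB ?rpred_nat.
by rewrite ler_wpM2l // ler_pdivlMr ?ltr0n // mul1r ler_nat.
Qed.
End RationalCodes.

(** What matters is the bound on the code u: it lets the search for approximations stop even on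
    invalid input. *)
Lemma rational_grid (x : RR) (B M : nat) : (0 < B)%N -> (0 < M)%N -> `|x| <= B%:R ->
  exists2 u, (u <= 4 * (2 * (B * M)) * (2 * (B * M)) + 3 * (2 * (B * M)))%N &
    `|x - decR u| <= M%:R^-1.
Proof.
move=> B0 M0 xB; have MR : 0 < M%:R :> RR by rewrite ltr0n.
pose n := Num.truncn (`|x| * M%:R).
have /andP[n1 n2] : n%:R <= `|x| * M%:R < n.+1%:R.
  by apply: truncn_itv; rewrite mulr_ge0.
have nH : (n <= B * M)%N.
  by rewrite -(ler_nat RR) natrM (le_trans n1) // ler_pM2r.
have e : `| `|x| - n%:R / M%:R| <= M%:R^-1.
  rewrite ler_distl; apply/andP; split.
    apply: le_trans (_ : n%:R / M%:R <= _); first by rewrite gerBl invr_ge0.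
    by rewrite ler_pdivrMr.
  by rewrite -[X in _ + X]mul1r -mulrDl natr1 ler_pdivlMr // ltW.
case: (ger0P x) => x0.
  exists (mkrat n 0 M.-1).
    by apply: npair_le; rewrite ?subn0; [lia | nia].
  by rewrite decR_mkrat subr0 prednK // -{1}(ger0_norm x0).
exists (mkrat 0 n M.-1).
  by apply: npair_le; [case: ifP; lia | nia].
rewrite decR_mkrat sub0r prednK // mulNr opprK -normrN opprD.
by rewrite -{1}(ltr0_norm x0).
Qed.

Lemma gauss_grid (z : C) (B M : nat) : (0 < B)%N -> (0 < M)%N -> nm z <= B%:R ->
  let H := (2 * (B * M))%N in let H1 := (4 * H * H + 3 * H)%N in
  exists2 t, (t <= 4 * H1 * H1 + 3 * H1)%N & nm (z - decC t) <= 2 / M%:R.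
Proof.
move=> B0 M0 hz H H1.
have [u hu1 hu2] := rational_grid B0 M0 (le_trans (nm_Re z) hz).
have [v hv1 hv2] := rational_grid B0 M0 (le_trans (nm_Im z) hz).
exists (npair u v); first exact: npair_le.
apply: le_trans (nm_le_sum _) _; rewrite /decC unpair_npair.
case: z {hz} hu2 hv2 => x y /= hu2 hv2.
by rewrite mulr2n mulrDl !mul1r lerD.
Qed.

(** * Polynomials near their roots *)

Lemma horner_lipschitz (p : {poly C}) (n : nat) (A Z : RR) (x y : C) :
  (size p <= n)%N -> (forall i, nm p`_i <= A) -> 1 <= Z -> nm x <= Z -> nm y <= Z ->
  nm (p.[x] - p.[y]) <= nm (x - y) * (A * n%:R * n%:R * Z ^+ n).
Proof.
move=> sp hA Z1 hx hy; have Z0 : 0 <= Z := le_trans ler01 Z1.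
have A0 : 0 <= A := le_trans (nm_ge0 _) (hA 0%N).
rewrite !(horner_coef_wide _ sp) -sumrB.
apply: le_trans (nm_sum _ _) _.
have -> : nm (x - y) * (A * n%:R * n%:R * Z ^+ n) =
    \sum_(i < n) nm (x - y) * (A * n%:R * Z ^+ n).
  by rewrite sumr_const card_ord -mulr_natr; ring.
apply: ler_sum => i _; rewrite -mulrBr subrXX !nmM mulrCA ler_wpM2l ?nm_ge0 //.
rewrite -mulrA ler_pM ?nm_ge0 //; apply: le_trans (nm_sum _ _) _.
apply: le_trans (_ : \sum_(j < i) Z ^+ n <= _).
  apply: ler_sum => j _; rewrite nmM !nmX.
  apply: le_trans (_ : Z ^+ (i.-1 - j) * Z ^+ j <= _).
    by apply: ler_pM; rewrite ?exprn_ge0 ?nm_ge0 // lerXn2r ?nnegrE ?nm_ge0.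
  rewrite -exprD ler_weXn2l //; have := ltn_ord i; have := ltn_ord j; lia.
rewrite sumr_const card_ord -[leLHS]mulr_natl ler_wpM2r ?exprn_ge0 // ler_nat.
exact: ltnW.
Qed.

(** If every root were at distance at least e from q, the factored form would make |p(q)| at least L
    e^n; here e <= 1 lets n replace the degree. *)
Lemma near_root (p : {poly C}) (n : nat) (e L : RR) (q : C) :
  p != 0 -> (size p <= n.+1)%N -> 0 < e <= 1 -> 0 < L -> L <= nm (lead_coef p) ->
  nm p.[q] < L * e ^+ n -> exists2 w, root p w & nm (q - w) < e.
Proof.
move=> p0 sp /andP[e0 e1] L0 hL hq.
have [r hr] := closed_field_poly_normal p.
have lp0 : lead_coef p != 0 by rewrite lead_coef_eq0.
have szr : (size r <= n)%N.
  by move: sp; rewrite hr size_scale // size_prod_XsubC.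
apply: contrapT => hn.
have hw w : w \in r -> e <= nm (q - w).
  move=> wr; rewrite leNgt; apply/negP => lt; apply: hn; exists w => //.
  by rewrite hr rootZ // root_prod_XsubC.
move: hq; rewrite ltNge => /negP; apply.
rewrite hr hornerZ nmM horner_prod nm_prod.
apply: ler_pM => //; [exact: ltW|by rewrite exprn_ge0 // ltW|].
apply: le_trans (_ : e ^+ size r <= _); first by rewrite ler_wiXn2l // ltW.
elim: r hw {hr szr} => [|w r IH] hw; first by rewrite big_nil.
rewrite big_cons exprS; apply: ler_pM; rewrite ?exprn_ge0 ?(ltW e0) //.
  by rewrite hornerXsubC hw // mem_head.
by apply: IH => v vr; apply: hw; rewrite inE vr orbT.
Qed.

Definition cpol (c : nat) : seq nat := seq_dec (unpair c).1.
Definition cctr (c : nat) : C :=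
  Complex (decR (unpair (unpair c).2).1) (decR (unpair (unpair (unpair c).2).2).1).
Definition crad (c : nat) : RR := decR (unpair (unpair (unpair c).2).2).2.
Definition poly_of (c : nat) : {poly C} := Poly [seq (decR k)%:C%C | k <- cpol c].

Lemma alg_decE (c : nat) (z : C) : alg_dec c z <->
  [/\ poly_of c != 0, root (poly_of c) z, nm (z - cctr c) < crad c &
      forall w, root (poly_of c) w -> nm (w - cctr c) < crad c -> w = z].
Proof.
have pE : Poly [seq ratr (rat_dec k) | k <- seq_dec (unpair c).1] = poly_of c.
  by congr Poly; apply: eq_map => k; rewrite /decR fmorph_rat.
have nE w : (`|w - cctr c| < Complex (crad c) 0) = (nm (w - cctr c) < crad c).
  by rewrite nmE ltcR.
rewrite /alg_dec pE -/(decR _) -/(decR _) -/(decR _) -/(cctr c) -/(crad c).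
split=> -[h1 h2 h3 h4]; split=> //; try by rewrite -nE.
- by move=> w hw; rewrite -nE; apply: h4.
- by rewrite nE.
- by move=> w hw; rewrite nE; apply: h4.
Qed.

Definition evalp (c : nat) (q : C) : C :=
  foldr (fun k s => s * q + Complex (decR k) 0) 0 (cpol c).

Lemma evalpE (c : nat) (q : C) : evalp c q = (poly_of c).[q].
Proof.
rewrite /evalp /poly_of horner_Poly; by elim: (cpol c) => //= k s ->.
Qed.

(* Crude bounds: aG is the inverse gap between a root and the boundary of the
   isolating disk, aD an inverse precision, 1 / aM the mesh of the search grid
   and aB a bound for the codes of the grid points. *)
Definition aX (c : nat) : nat := c.+1.
Definition aY (c : nat) : nat := (aX c * (aX c)`!)%N.
Definition aG (c : nat) : nat := (aY c ^ 4 * (10 * aY c ^ 16) ^ (aY c ^ 2))%N.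
Definition aD (c k : nat) : nat := (2 ^ k * (8 * aG c * aX c))%N.
Definition aK (c : nat) : nat := (aX c * aX c * aX c * (4 * aX c) ^ aX c)%N.
Definition aM (c k : nat) : nat := (4 * aK c * aX c * aD c k ^ aX c)%N.
Definition aH (c k : nat) : nat := (2 * (4 * aX c * aM c k))%N.
Definition aH1 (c k : nat) : nat := (4 * aH c k * aH c k + 3 * aH c k)%N.
Definition aB (c k : nat) : nat := (4 * aH1 c k * aH1 c k + 3 * aH1 c k)%N.

(** The first clause forces a root within 1 / [aD] of the point; the second puts the point inside
    the disk with margin 1 / (2 [aG]) in squared distance. Together they identify that root as the
    isolated one. *)
Definition apt (c k t : nat) : bool :=
  (nrm2 (evalp c (decC t)) * ((aX c * aD c k ^ aX c) ^ 2)%:R < 1) &&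
  (nrm2 (decC t - cctr c) * (2 * aG c)%:R + 1 <= crad c * crad c * (2 * aG c)%:R).

Section Approximation.
Variables (c : nat) (z : C).
Hypothesis hz : alg_dec c z.
Let p := poly_of c.
Let X : RR := (aX c)%:R.
Let G : RR := (aG c)%:R.

Lemma aY_gt0 : (0 < aY c)%N. Proof. by rewrite muln_gt0 fact_gt0. Qed.
Lemma aG_gt0 : (0 < aG c)%N.
Proof. by rewrite muln_gt0 !expn_gt0 muln_gt0 expn_gt0 aY_gt0. Qed.
Lemma aD_gt0 k : (0 < aD c k)%N.
Proof.
move: aG_gt0; rewrite /aD; move: (aG c) => g g0.
by rewrite muln_gt0 expn_gt0 !muln_gt0 g0.
Qed.
Lemma aK_gt0 : (0 < aK c)%N. Proof. by rewrite !muln_gt0 expn_gt0 muln_gt0. Qed.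
Lemma aM_gt0 k : (0 < aM c k)%N.
Proof.
move: aK_gt0 (aD_gt0 k); rewrite /aM; move: (aK c) (aD c k) => g h g0 h0.
by rewrite !muln_gt0 g0 expn_gt0 h0.
Qed.

Lemma X_ge1 : 1 <= X. Proof. by rewrite /X ler1n. Qed.
Lemma G_gt0 : 0 < G. Proof. by rewrite /G ltr0n aG_gt0. Qed.

Lemma cpol_le (k : nat) : k \in cpol c -> (k <= c)%N.
Proof.
move=> hk; have [_ h] := seq_dec_bound (unpair c).1.
by apply: leq_trans (ltnW (h _ hk)) (unpair1_le c).
Qed.

Lemma size_p : (size p <= c)%N.
Proof.
apply: leq_trans (size_Poly _) _; rewrite size_map.
have [h _] := seq_dec_bound (unpair c).1.
exact: leq_trans h (unpair1_le c).
Qed.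

Let a (i : nat) : RR := nth 0 [seq decR k | k <- cpol c] i.

Lemma p_coef (i : nat) : p`_i = (a i)%:C%C.
Proof.
rewrite coef_Poly /a; case: (ltnP i (size (cpol c))) => h.
  by rewrite !(nth_map 0%N).
by rewrite !nth_default // size_map.
Qed.

Lemma a_code (i : nat) : a i = 0 \/ exists2 k, (k <= c)%N & a i = decR k.
Proof.
rewrite /a; case: (ltnP i (size (cpol c))) => h; last first.
  by left; rewrite nth_default // size_map.
right; exists (nth 0%N (cpol c) i); last by rewrite (nth_map 0%N).
by rewrite cpol_le // mem_nth.
Qed.

Lemma a_bound (i : nat) : `|a i| <= X.
Proof.
by case: (a_code i) => [->|[k kc ->]]; rewrite ?normr0 ?ler0n ?decR_bound.
Qed.

Lemma ctr_codes : exists u v r, [/\ (u <= c)%N, (v <= c)%N, (r <= c)%N,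
  cctr c = Complex (decR u) (decR v) & crad c = decR r].
Proof.
exists (unpair (unpair c).2).1, (unpair (unpair (unpair c).2).2).1,
  (unpair (unpair (unpair c).2).2).2.
have h1 := unpair2_le c; have h2 := unpair1_le (unpair c).2.
have h3 := unpair2_le (unpair c).2.
have h4 := unpair1_le (unpair (unpair c).2).2.
have h5 := unpair2_le (unpair (unpair c).2).2.
split=> //.
- exact: leq_trans h2 h1.
- exact: leq_trans h4 (leq_trans h3 h1).
- exact: leq_trans h5 (leq_trans h3 h1).
Qed.

Lemma rad_bounds : nm (z - cctr c) < crad c /\ 0 < crad c <= X.
Proof.
have [_ _ h _] := proj1 (alg_decE c z) hz; split=> //.
have [u [v [r [_ _ rc _ rE]]]] := ctr_codes.
apply/andP; split; first exact: le_lt_trans (nm_ge0 _) h.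
by rewrite rE; apply: le_trans (ler_norm _) (decR_bound rc).
Qed.

Lemma alg_gap : 1 <= (crad c ^+ 2 - nrm2 (z - cctr c)) * G.
Proof.
have [p0 pz hr _] := proj1 (alg_decE c z) hz.
have [u [v [r [uc vc rc cE rE]]]] := ctr_codes.
have sp : (1 < size p)%N by apply: root_size_gt1 pz.
pose d := (size p).-1; have dE : size p = d.+1 by rewrite prednK // ltnW.
pose D : RR := (c.+1)`!%:R.
have D0 : 0 < D by rewrite ltr0n fact_gt0.
have DX (x : RR) : `|x| <= X -> `|D * x| <= (aY c)%:R.
  by move=> hx; rewrite normrM (gtr0_norm D0) /aY natrM mulrC ler_pM2r.
have aint i : D * a i \is a Num.int.
  case: (a_code i) => [->|[k kc ->]]; first by rewrite mulr0 rpred0.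
  exact: decR_fact_int.
have aYle (n : nat) : (n <= c.+1)%N -> (n <= aY c)%N.
  by move=> h; apply: leq_trans h _; rewrite leq_pmulr // fact_gt0.
rewrite cE /G; apply: (@root_gap a d (aY c) D).
- by rewrite -ltnS -dE.
- have : p`_d != 0 by rewrite -lead_coefE lead_coef_eq0.
  by rewrite p_coef fmorph_eq0.
- by apply: aYle; apply: leq_trans (leq_pred _) _; apply: leq_trans size_p _.
- exact: aY_gt0.
- by rewrite gt_eqF.
- by rewrite rpred_nat.
- by rewrite (gtr0_norm D0) ler_nat leq_pmull.
- by move=> i _.
- by move=> i _; apply/DX/a_bound.
- exact: decR_fact_int.
- exact: decR_fact_int.
- by rewrite rE; apply: decR_fact_int.
- exact/DX/decR_bound.
- exact/DX/decR_bound.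
- by rewrite rE; exact/DX/decR_bound.
- move/rootP: pz; rewrite -/p horner_coef dE => h; rewrite -[RHS]h.
  by apply: eq_bigr => i _; rewrite p_coef.
- rewrite -cE -nm_sqr ltr_pXn2r ?nnegrE ?nm_ge0 //.
  by have [_ /andP[/ltW]] := rad_bounds.
Qed.

Lemma apt_complete (k : nat) : exists2 t, (t <= aB c k)%N & apt c k t.
Proof.
have [p0 pz _ _] := proj1 (alg_decE c z) hz.
have [hr /andP[r0 rX]] := rad_bounds.
have [u [v [r [uc vc rc cE rE]]]] := ctr_codes.
have X1 := X_ge1; have G0 := G_gt0; have gap := alg_gap.
have M0 := aM_gt0 k; have MR : 0 < (aM c k)%:R :> RR by rewrite ltr0n.
have hctr : nm (cctr c) <= X + X.
  by rewrite cE; apply: le_trans (nm_le_sum _) _; rewrite lerD ?decR_bound.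
have zX : nm z <= 3 * X.
  by have := nm_tri z (cctr c) 0; rewrite !subr0; lra.
have [||t ht1 ht2] := @gauss_grid z (4 * aX c) (aM c k) _ M0 _.
- by rewrite muln_gt0.
- by rewrite natrM; apply: le_trans zX _; rewrite -/X; lra.
exists t => //; set q := decC t in ht2 *.
set M : RR := (aM c k)%:R in MR ht2 *.
pose E : RR := (aX c * aD c k ^ aX c)%:R.
have DE : (1 <= aD c k ^ aX c)%N by rewrite expn_gt0 aD_gt0.
have ME : M = 4 * (aK c)%:R * E by rewrite /M /E /aM -mulnA !natrM.
have E0 : 0 < E by rewrite ltr0n muln_gt0 expn_gt0 aD_gt0.
have K1 : 1 <= (aK c)%:R :> RR by rewrite ler1n aK_gt0.
have E8 : 8 * G * X <= E.
  rewrite /E /G /X -!natrM ler_nat; apply: leq_trans (_ : aD c k <= _)%N.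
    by rewrite leq_pmull // expn_gt0.
  apply: leq_trans (_ : aD c k ^ aX c <= _)%N; last exact: leq_pmull.
  by rewrite -{1}[aD c k]expn1 leq_pexp2l // aD_gt0.
have M32 : 32 * G * X <= M.
  rewrite ME; apply: le_trans (_ : 4 * E <= _); first by lra.
  by rewrite ler_pM2r // ler_peMr.
have MI : M^-1 * M = 1 by rewrite mulVf // gt_eqF.
have Mi0 : 0 < M^-1 by rewrite invr_gt0.
have qX : nm q <= 4 * X.
  have := nm_tri q z 0; rewrite !subr0 nm_dist => h.
  suff : 2 / M <= 1 by lra.
  rewrite ler_pdivrMr // mul1r; apply: le_trans M32.
  have : 1 <= (aG c)%:R :> RR by rewrite ler1n aG_gt0.
  by rewrite -/G => G1; nra.
apply/andP; split.
  (* [aK] is the Lipschitz constant of p on the disk of radius 4X, which contains both z and q. *)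
  have pq : nm p.[q] <= 2 / M * (aK c)%:R.
    have -> : p.[q] = p.[q] - p.[z] by rewrite (rootP pz) subr0.
    apply: le_trans (@horner_lipschitz p (aX c) X (4 * X) q z _ _ _ _ _) _ => //.
    - exact: leq_trans size_p (leqnSn c).
    - by move=> i; rewrite p_coef nm_real a_bound.
    - by lra.
    - by lra.
    rewrite nm_dist; apply: ler_pM => //; rewrite ?nm_ge0 //.
      by rewrite !mulr_ge0 // ?exprn_ge0 //; lra.
    by rewrite /aK !natrM natrX natrM -/X lexx.
  rewrite evalpE -/p -nm_sqr natrX -/E -exprMn expr_lt1 //; last first.
    by rewrite mulr_ge0 ?nm_ge0 // ltW.
  apply: le_lt_trans (_ : 2 / M * (aK c)%:R * E < 1); first by rewrite ler_pM2r.
  have -> : 2 / M * (aK c)%:R * E = 2^-1.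
    have K0 : (aK c)%:R != 0 :> RR by rewrite pnatr_eq0 -lt0n aK_gt0.
    have En0 : E != 0 by rewrite gt_eqF.
    have HK (K F : RR) : K != 0 -> F != 0 -> 2 / (4 * K * F) * K * F = 2^-1.
      by move=> k0 f0; field; rewrite k0 f0.
    by rewrite ME HK.
  by rewrite invf_lt1 // ltr1n.
(* Moving from z to the grid point raises the squared distance to the center by at most 8X/M <=
   1/(4G), which is less than half of the gap 1/G from [alg_gap]. *)
have h2 : nm (q - cctr c) <= nm (z - cctr c) + 2 * M^-1.
  by have := nm_tri q z (cctr c); rewrite (nm_dist q z); lra.
move: gap; rewrite -!nm_sqr natrM -/G expr2; set s := nm (z - cctr c) in hr h2 *.
set s' := nm (q - cctr c) in h2 *; set w := M^-1 in MI Mi0 h2 *.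
have s0 : 0 <= s by exact: nm_ge0.
have s'0 : 0 <= s' by exact: nm_ge0.
rewrite !expr2 => gap.
have w1 : w * (32 * G * X) <= 1 by rewrite -[leRHS]MI ler_pM2l.
have wX : w <= X.
  have : 1 <= (aG c)%:R :> RR by rewrite ler1n aG_gt0.
  rewrite -/G => G1; nra.
have k1 : s' * s' <= (s + 2 * w) * (s + 2 * w) by apply: ler_pM.
have k2 : (s + 2 * w) * (s + 2 * w) <= s * s + 8 * X * w by nra.
have k3 : s' * s' * G <= s * s * G + 8 * X * w * G by rewrite -mulrDl ler_pM2r //; lra.
by lra.
Qed.

Lemma apt_sound (k t : nat) : apt c k t -> nm (z - decC t) <= 2 ^- k.
Proof.
have [p0 pz _ uniq] := proj1 (alg_decE c z) hz.
have [hr /andP[r0 rX]] := rad_bounds.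
have X1 := X_ge1; have G0 := G_gt0.
move=> /andP[]; set q := decC t; rewrite evalpE -/p -!nm_sqr natrX.
pose E : RR := (aX c * aD c k ^ aX c)%:R; rewrite -/E -exprMn.
pose Dl : RR := (aD c k)%:R; have D0 : 0 < Dl by rewrite ltr0n aD_gt0.
have EE : E = X * Dl ^+ aX c by rewrite /E natrM natrX.
have E0 : 0 < E by rewrite ltr0n muln_gt0 expn_gt0 aD_gt0.
rewrite expr_lt1 ?mulr_ge0 ?nm_ge0 ?(ltW E0) // => hp h2.
have DlE : Dl = 2 ^+ k * (8 * G * X) by rewrite /Dl /aD natrM natrX natrM natrM.
have G1 : 1 <= G by rewrite ler1n aG_gt0.
have GX1 : 1 <= G * X by rewrite mulr_ege1.
have p21 : 1 <= (2 : RR) ^+ k by rewrite exprn_ege1 // ler1n.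
have D8 : 8 * G * X <= Dl by rewrite DlE ler_peMl // !mulr_ge0 // ltW //; lra.
have D1 : 1 <= Dl by nra.
(* The leading coefficient is a nonzero rational coded below c, hence at least 1/X in modulus. *)
have [w wr hw] : exists2 w, root p w & nm (q - w) < Dl^-1.
  apply: (@near_root p (aX c) Dl^-1 X^-1).
  - exact: p0.
  - exact: leq_trans size_p (leq_trans (leqnSn _) (leqnSn _)).
  - by rewrite invr_gt0 D0 invf_le1.
  - by rewrite invr_gt0; lra.
  - have lp : lead_coef p != 0 by rewrite lead_coef_eq0.
    move: lp; rewrite lead_coefE p_coef fmorph_eq0 nm_real.
    case: (a_code (size p).-1) => [->|[i ic ->]]; first by rewrite eqxx.
    by move=> /(decR_lower ic); rewrite -[X^-1]mul1r ler_pdivrMr ?(lt_le_trans ltr01 X1) // mulrC.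
  - rewrite exprVn -invfM -EE -[ltRHS]mul1r ltr_pdivlMr //.
have Di : Dl^-1 * Dl = 1 by rewrite mulVf // gt_eqF.
have Di0 : 0 < Dl^-1 by rewrite invr_gt0.
set e := Dl^-1 in hw Di Di0.
suff wz : w = z.
  rewrite -wz nm_dist; apply: ltW; apply: lt_le_trans hw _.
  have p20 : 0 < (2 : RR) ^+ k by rewrite exprn_gt0.
  have GX0 : 1 <= 8 * G * X by lra.
  rewrite /e DlE lef_pV2 ?posrE //; last by rewrite mulr_gt0 // (lt_le_trans ltr01 GX0).
  by rewrite ler_peMr // ltW.
(* By uniqueness it remains to place w in the disk: going from q to w raises the squared distance by
   at most 3Xe <= 3/(8G), less than the margin 1/(2G). *)
apply: uniq wr _.
have h3 : nm (w - cctr c) < nm (q - cctr c) + e.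
  by have := nm_tri w q (cctr c); rewrite (nm_dist w q); lra.
apply: lt_le_trans h3 _; move: h2; rewrite natrM -/G expr2.
set s := nm (q - cctr c); have s0 : 0 <= s by exact: nm_ge0.
move=> h2; rewrite leNgt; apply/negP => lt.
have e8 : e * (8 * G * X) <= 1 by rewrite -[leRHS]Di ler_pM2l.
have sr : s <= crad c.
  rewrite leNgt; apply/negP => lts.
  have : crad c * crad c * G <= s * s * G by rewrite ler_pM2r //; apply: ler_pM; lra.
  by lra.
have l1 : crad c * crad c * G <= (s + e) * (s + e) * G.
  by rewrite ler_pM2r //; apply: ler_pM; lra.
have e1 : e <= 1 by nra.
have l2 : s * e * G <= X * e * G by rewrite ler_pM2r // ler_pM2r //; lra.
have l3 : e * e * G <= X * e * G by rewrite ler_pM2r // ler_pM2r //; lra.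
by lra.
Qed.
End Approximation.

Lemma alg_approx : exists2 f : nat -> nat -> C,
  computable (fun q : nat * nat => f q.1 q.2) &
  forall c k z, alg_dec c z -> nm (z - f c k) <= 2 ^- k.
Proof.
(* The second disjunct ends the search on every input. For a valid code a point passing [apt] occurs
   no later, so the least hit passes it. *)
pose P (q : nat * nat) t := apt q.1 q.2 t || (t == aB q.1 q.2).
have cP : computable (fun q : (nat * nat) * nat => P q.1 q.2).
  rewrite /P /apt /aB /aH1 /aH /aM /aK /aD /aG /aY /aX /evalp /cpol /cctr /crad.
  by comp.
have [|f [cf Pf mf]] := comp_search cP.
  by move=> q; exists (aB q.1 q.2); rewrite /P eqxx orbT.
exists (fun c k => decC (f (c, k))); first by comp.
move=> c k z hz; apply: (apt_sound hz).
have := Pf (c, k); rewrite /P /= => /orP[//|/eqP e].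
have [t ht1 ht2] := apt_complete hz k.
suff <- : t = f (c, k) by [].
apply/eqP; rewrite eqn_leq {1}e ht1 leqNgt; apply/negP => /(mf (c, k)).
by rewrite /P /= ht2.
Qed.

(** * Searching for Gaussian rational frames *)

Lemma seq_dec_surj (l : seq nat) : exists x, seq_dec x = l.
Proof.
elim: l => [|a l [x hx]]; first by exists 0%N.
by exists (npair a x).+1; rewrite seq_decS unpair_npair hx.
Qed.

Lemma decR_surj (q : rat) : exists x, decR x = ratr q.
Proof.
have qE : (ratr q : RR) = (numq q)%:~R / (denq q)%:~R.
  by rewrite -{1}(divq_num_den q) rmorphM fmorphV !rmorph_int.
have := denq_gt0 q; case: (denq q) qE => // -[//|w] -> _.
case: (numq q) => n; first by exists (mkrat n 0 w); rewrite decR_mkrat subr0.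
by exists (mkrat 0 n.+1 w); rewrite decR_mkrat sub0r NegzE mulrNz.
Qed.

Lemma decC_surj (z : C) : z \in gq -> exists x, decC x = z.
Proof.
move=> /gqP[a [b ->]]; have [x hx] := decR_surj a; have [y hy] := decR_surj b.
by exists (npair x y); rewrite /decC unpair_npair hx hy.
Qed.

Definition dec_frame (t : nat) : seq (seq C) :=
  [seq [seq decC x | x <- seq_dec y] | y <- seq_dec t].

Lemma dec_frame_surj (s : seq (seq C)) :
  (forall v, v \in s -> forall z, z \in v -> z \in gq) -> exists t, dec_frame t = s.
Proof.
have h1 (v : seq C) : (forall z, z \in v -> z \in gq) ->
    exists l : seq nat, [seq decC x | x <- l] = v.
  elim: v => [|z v IH] hv; first by exists [::].
  have [|l hl] := IH; first by move=> w wv; apply: hv; rewrite inE wv orbT.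
  have [|x hx] := @decC_surj z; first by apply: hv; rewrite mem_head.
  by exists (x :: l); rewrite /= hx hl.
move=> hs; suff [l hl] : exists l : seq nat,
    [seq [seq decC x | x <- seq_dec y] | y <- l] = s.
  by have [t ht] := seq_dec_surj l; exists t; rewrite /dec_frame ht.
elim: s hs => [|v s IH] hs; first by exists [::].
have [|l hl] := IH; first by move=> w ws; apply: hs; rewrite inE ws orbT.
have [|u hu] := h1 v; first by apply: hs; rewrite mem_head.
have [y hy] := seq_dec_surj u.
by exists (y :: l); rewrite /= hy hu hl.
Qed.

Lemma submxE (m n : nat) (A B : 'M[C]_(m, n)) i j : (A - B) i j = A i j - B i j.
Proof. by rewrite !mxE. Qed.

Definition ent (s : seq (seq C)) (k i : nat) : C := nth 0 (nth [::] s k) i.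

Definition fmx (N : nat) (s : seq (seq C)) : 'M[C]_(N, size s) :=
  \matrix_(i, k) ent s k i.

Definition gram (N : nat) (s : seq (seq C)) (k l : nat) : C :=
  bsum N (fun i => (ent s k i)^* * ent s l i).

Definition proj (s : seq (seq C)) (i l : nat) : C :=
  bsum (size s) (fun k => ent s k i * (ent s k l)^*).

Lemma fmx_gram (N : nat) (s : seq (seq C)) (k l : 'I_(size s)) :
  ((fmx N s) ^t* *m fmx N s) k l = gram N s k l.
Proof. by rewrite mxE; apply: eq_bigr => i _; rewrite adjmxE !mxE. Qed.

Lemma fmx_proj (N : nat) (s : seq (seq C)) (i l : 'I_N) :
  (fmx N s *m (fmx N s) ^t*) i l = proj s i l.
Proof. by rewrite mxE; apply: eq_bigr => k _; rewrite adjmxE !mxE. Qed.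

(** Decidable because all entries are Gaussian rational: orthonormality is tested exactly, closeness
    through squared moduli, whence the exponent 2m. *)
Definition frame_ok (N m : nat) (B : nat -> nat -> C) (s : seq (seq C)) : bool :=
  all (fun k => all (fun l => gram N s k l == (k == l)%:R) (iota 0 (size s)))
    (iota 0 (size s)) &&
  all (fun i => all (fun l => nrm2 (proj s i l - B i l) <= 2 ^- (2 * m)) (iota 0 N))
    (iota 0 N).

Lemma all_iotaP (n : nat) (P : pred nat) :
  reflect (forall k, (k < n)%N -> P k) (all P (iota 0 n)).
Proof.
apply: (iffP allP) => h k; first by move=> kn; apply: h; rewrite mem_iota.
by rewrite mem_iota => /h.
Qed.

Lemma nm_le_2X (z : C) (m : nat) : (nrm2 z <= 2 ^- (2 * m)) = (nm z <= 2 ^- m).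
Proof.
by rewrite -nm_sqr mulnC exprM -exprVn ler_pXn2r // ?nnegrE ?nm_ge0.
Qed.

Lemma frame_okP (N m : nat) (B : nat -> nat -> C) (s : seq (seq C)) :
  frame_ok N m B s <->
  (fmx N s) ^t* *m fmx N s = 1%:M /\
  forall i l : 'I_N, nm ((fmx N s *m (fmx N s) ^t*) i l - B i l) <= 2 ^- m.
Proof.
split.
  move=> /andP[/all_iotaP h1 /all_iotaP h2]; split.
    apply/matrixP => k l; rewrite fmx_gram mxE.
    by have /all_iotaP/(_ _ (ltn_ord l))/eqP := h1 _ (ltn_ord k).
  move=> i l; rewrite fmx_proj -nm_le_2X.
  by have /all_iotaP/(_ _ (ltn_ord l)) := h2 _ (ltn_ord i).
move=> [/matrixP h1 h2]; apply/andP; split; apply/all_iotaP => k hk; apply/all_iotaP => l hl.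
  by have := h1 (Ordinal hk) (Ordinal hl); rewrite fmx_gram mxE => ->.
by have := h2 (Ordinal hk) (Ordinal hl); rewrite fmx_proj -nm_le_2X.
Qed.

Lemma comp_frame_ok {A : Type} {rA : Rep A} (N m : A -> nat)
  (B : A -> nat -> nat -> C) (s : A -> seq (seq C)) :
  computable N -> computable m ->
  computable (fun q : A * (nat * nat) => B q.1 q.2.1 q.2.2) -> computable s ->
  computable (fun a => frame_ok (N a) (m a) (B a) (s a)).
Proof.
move=> hN hm hB hs; rewrite /frame_ok /gram /proj /ent.
by comp.
Qed.

Lemma trace_le_mxn (n : nat) (X : 'M[C]_n) : `|\tr X| <= mxn X.
Proof.
apply: le_trans (ler_norm_sum _ _ _) _; apply: ler_sum => i _.
by rewrite (bigD1 i) //= lerDl sumr_ge0.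
Qed.

Lemma nat_close_eq (m n : nat) (e : RR) : e < 1 -> `|(m%:R : C) - n%:R| <= e%:C%C -> m = n.
Proof.
move=> e1; rewrite nmE lecR => h.
have : `|(m%:R - n%:R : RR)| < 1.
  apply: le_lt_trans e1; apply: le_trans h; rewrite -nm_real rmorphB !rmorph_nat.
  exact: lexx.
move=> lt; apply/eqP; apply: contraTT lt => mn; rewrite -leNgt norm_intr_ge1 //.
  by rewrite rpredB ?rpred_nat.
by rewrite subr_eq0 eqr_nat.
Qed.

(** P itself is not given to the program, only its approximation B. [rational_frame] guarantees that
    the unbounded search succeeds, and closeness to P then fixes the number of vectors. *)
Lemma frame_search (n : nat -> nat) (B : nat -> nat -> nat -> C) (j : nat)
  (P : forall x, 'M[C]_(2 ^ n x)) :
  computable n -> computable (fun q : nat * (nat * nat) => B q.1 q.2.1 q.2.2) ->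
  (forall x, hprojection (P x)) ->
  (forall x (i l : 'I_(2 ^ n x)), nm (P x i l - B x i l) <= 2 ^- (2 * n x + j + 3)) ->
  exists2 s : nat -> seq (seq C), computable s &
    forall x, let W := fmx (2 ^ n x) (s x) in
      [/\ W ^t* *m W = 1%:M, mxn (W *m W ^t* - P x) <= (2 ^- j : RR)%:C%C &
          (size (s x))%:R = \tr (P x)].
Proof.
move=> cn cB hP hB.
have pos k : 0 < (2 : RR) ^- k by rewrite invr_gt0 exprn_gt0.
have half k : (2 : RR) ^- k = 2 ^- k.+1 + 2 ^- k.+1.
  by rewrite exprS; field; rewrite expf_neq0.
(* The tolerance 2^-(2n+j+2) is twice the error of B, leaving equal room for the frame. A frame
   found is within 2^-(2n+j+1) of P in each of the 4^n entries. *)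
pose T x t := frame_ok (2 ^ n x) (2 * n x + j + 2) (B x) (dec_frame t).
have cT : computable (fun q : nat * nat => T q.1 q.2).
  by apply: comp_frame_ok; rewrite /dec_frame; comp.
have exT x : exists t, T x t.
  have [r [W [hW qW hWP _]]] := @rational_frame _ (P x)
    ((2 ^- (2 * n x + j + 3) : RR)%:C%C) (hP x) ltac:(by rewrite ltcR).
  pose s : seq (seq C) := [seq [seq W i k | i <- enum 'I_(2 ^ n x)] | k <- enum 'I_r].
  have [|t ht] := @dec_frame_surj s.
    by move=> v /mapP[k _ ->] z /mapP[i _ ->].
  exists t; rewrite /T ht.
  have sz : size s = r by rewrite size_map size_enum_ord.
  have entE (k : 'I_r) (i : 'I_(2 ^ n x)) : ent s k i = W i k.
    rewrite /ent /s (nth_map k) ?size_enum_ord // nth_ord_enum.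
    by rewrite (nth_map i) ?size_enum_ord // nth_ord_enum.
  have gramE (k l : 'I_r) : gram (2 ^ n x) s k l = (k == l)%:R.
    transitivity ((W ^t* *m W) k l); last by rewrite hW mxE.
    by rewrite mxE; apply: eq_bigr => i _; rewrite adjmxE !entE.
  have projE (i l : 'I_(2 ^ n x)) : proj s i l = (W *m W ^t*) i l.
    rewrite mxE /proj sz; apply: eq_bigr => k _; by rewrite adjmxE !entE.
  apply/andP; split; apply/all_iotaP => k; rewrite ?sz => hk; apply/all_iotaP => l;
    rewrite ?sz => hl.
    by rewrite (gramE (Ordinal hk) (Ordinal hl)).
  rewrite nm_le_2X (projE (Ordinal hk) (Ordinal hl)) -/(Ordinal hk).
  apply: le_trans (nm_tri _ (P x (Ordinal hk) (Ordinal hl)) _) _.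
  rewrite half; apply: lerD; last by have := hB x (Ordinal hk) (Ordinal hl); rewrite addnS.
  rewrite -lecR -nmE -addnS; apply: le_trans hWP.
  by have := mxn_entry (W *m W ^t* - P x) (Ordinal hk) (Ordinal hl); rewrite !mxE.
have [f [cf Tf _]] := comp_search cT exT.
exists (fun x => dec_frame (f x)); first by rewrite /dec_frame; comp.
move=> x; have /frame_okP[] := Tf x; move: (dec_frame (f x)) => s h1 h2 W.
have hmx : mxn (W *m W ^t* - P x) <= (2 ^- j.+1 : RR)%:C%C.
  apply: le_trans (_ : (2 ^ n x * 2 ^ n x)%:R * (2 ^- (2 * n x + j + 1) : RR)%:C%C <= _).
    apply: mxn_bound => i l.
    rewrite submxE nmE lecR; apply: le_trans (nm_tri _ (B x i l) _) _.
    rewrite half; apply: lerD; first by have := h2 i l; rewrite !addnS.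
    rewrite nm_dist; apply: le_trans (hB x i l) _.
    rewrite -!exprVn ler_wiXn2l ?invr_ge0 ?invf_le1 ?ler1n //; lia.
  rewrite -(rmorph_nat (real_complex RR)) -rmorphM lecR natrM natrX.
  rewrite mul2n -addnn !exprD expr1 le_eqVlt; apply/orP; left; apply/eqP.
  by rewrite exprS; field; rewrite !expf_neq0.
split=> //.
  by apply: le_trans hmx _; rewrite lecR [leRHS]half lerDl ltW.
have [r hr] := trace_hprojection_nat (hP x).
(* The bound was proved for j+1 rather than j so that it stays below 1 even for j = 0. *)
rewrite hr; congr (_%:R); apply: (@nat_close_eq _ _ (2 ^- j.+1)).
  by rewrite invf_lt1 ?exprn_gt0 // exprn_egt1 // ltr1n.
rewrite -hr -(isometry_trace h1) -raddfB; apply: le_trans (trace_le_mxn _) hmx.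
Qed.

(** * Approximate frames and traces against density matrices *)

Lemma pow2V_gt0 (k : nat) : 0 < (2 : RR) ^- k.
Proof. by rewrite invr_gt0 exprn_gt0. Qed.

Lemma pow2V_le (k l : nat) : (l <= k)%N -> (2 : RR) ^- k <= 2 ^- l.
Proof. by move=> h; rewrite -!exprVn ler_wiXn2l ?invr_ge0 ?invf_le1 ?ler1n. Qed.

Lemma pow2VM (a b : nat) : (2 : RR) ^+ a * 2 ^- (a + b) = 2 ^- b.
Proof. by rewrite exprD invfM mulrA divff ?mul1r // expf_neq0. Qed.

Lemma pow2V_le1 (k : nat) : (2 : RR) ^- k <= 1.
Proof. by have := pow2V_le (leq0n k); rewrite expr0 invr1. Qed.

Lemma natC (m : nat) : (m%:R : C) = (m%:R : RR)%:C%C.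
Proof. by rewrite rmorph_nat. Qed.

Lemma ReD (x y : C) : complex.Re (x + y) = complex.Re x + complex.Re y.
Proof. by case: x y => a b [c d]. Qed.

Lemma Re_sum (I : Type) (r : seq I) (P : pred I) (F : I -> C) :
  complex.Re (\sum_(i <- r | P i) F i) = \sum_(i <- r | P i) complex.Re (F i).
Proof. by apply: (big_morph _ ReD). Qed.

(** Precision budget: summing over at most 4^n Gram entries leaves 2^-(7n+j+6).
    [near_isometry_projection] multiplies this by the squared norm of A, at most 2^(4n+2), and by 2r
    <= 2^(n+1), giving 2^-(2n+j+3), the accuracy [frame_search] asks for. *)
Lemma near_frame_projection (n j : nat) (s : seq (seq C)) :
  (size s <= 2 ^ n)%N ->
  (forall k l, (k < size s)%N -> (l < size s)%N ->
    nm (gram (2 ^ n) s k l - (k == l)%:R) <= 2 ^- (9 * n + j + 6)) ->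
  exists P : 'M[C]_(2 ^ n), [/\ hprojection P, \tr P = (size s)%:R &
    forall i l : 'I_(2 ^ n), nm (P i l - proj s i l) <= 2 ^- (2 * n + j + 3)].
Proof.
move=> sz hg; set A := fmx (2 ^ n) s; set g := (9 * n + j + 6)%N in hg.
have szR : (size s)%:R <= (2 : RR) ^+ n by rewrite -natrX ler_nat.
have p0 (k : nat) : 0 <= (2 : RR) ^+ k by rewrite exprn_ge0.
have nE : mxn (1%:M - A ^t* *m A) <= (2 ^+ (2 * n) * 2 ^- g : RR)%:C%C.
  apply: le_trans (_ : (size s * size s)%:R * (2 ^- g : RR)%:C%C <= _).
    apply: mxn_bound => k l; rewrite submxE fmx_gram mxE nmE lecR nm_dist.
    exact: hg.
  rewrite natC -rmorphM lecR ler_pM2r ?pow2V_gt0 // natrM mul2n -addnn exprD.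
  by rewrite ler_pM.
have E1 : 2 ^+ (2 * n) * 2 ^- g = 2 ^- (7 * n + j + 6) :> RR.
  by rewrite (_ : g = 2 * n + (7 * n + j + 6))%N ?pow2VM // /g; lia.
rewrite E1 in nE.
have hE : mxn (1%:M - A ^t* *m A) <= 2^-1.
  apply: le_trans nE _; have -> : (2^-1 : C) = (2^-1 : RR)%:C%C.
    by rewrite fmorphV rmorph_nat.
  rewrite lecR -[X in _ <= X^-1]expr1; apply: pow2V_le; lia.
have nA : mxn A <= (2 ^+ (2 * n + 1) : RR)%:C%C.
  apply: le_trans (_ : (2 ^ n * size s)%:R * (2 : RR)%:C%C <= _).
    apply: mxn_bound => i k; rewrite nmE lecR.
    have : nm (A i k) ^+ 2 <= 2.
      have -> : nm (A i k) ^+ 2 = complex.Re ((A i k)^* * A i k).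
        by rewrite nm_sqr /nrm2; case: (A i k) => a b /=; ring.
      apply: le_trans (_ : complex.Re (gram (2 ^ n) s k k) <= _).
        rewrite -fmx_gram -/A [(_ *m _) k k]mxE (bigD1 i) //= ReD adjmxE lerDl.
        rewrite Re_sum sumr_ge0 // => u _; rewrite adjmxE.
        case: (A u k) => a b /=; rewrite mulNr opprK -!expr2.
        by rewrite addr_ge0 ?sqr_ge0.
      have := hg k k (ltn_ord k) (ltn_ord k); rewrite eqxx => h.
      have := le_trans (nm_Re _) h; rewrite ReD ler_norml /= => /andP[_ h1].
      have := pow2V_le1 g; lra.
    move=> h; rewrite leNgt; apply/negP => lt.
    have := nm_ge0 (A i k); nra.
  rewrite natC -rmorphM lecR addn1 mul2n -addnn exprS exprD natrM natrX mulrC.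
  by rewrite ler_pM2l // ler_pM2l ?exprn_gt0.
have [P [hP tP dP]] := near_isometry_projection hE.
exists P; split=> // i l; rewrite -fmx_proj -/A -submxE -lecR -nmE.
apply: le_trans (mxn_entry _ _ _) _; apply: le_trans dP _.
apply: le_trans (_ : ((2 ^+ (2 * n + 1)) ^+ 2 *
    (2 * 2 ^+ n * 2 ^- (7 * n + j + 6)) : RR)%:C%C <= _).
  rewrite rmorphM rmorphXn /= ler_pM ?exprn_ge0 ?mxn_ge0 //.
  - by rewrite !mulr_ge0 ?mxn_ge0.
  - by rewrite lerXn2r ?nnegrE ?mxn_ge0 // ler0c.
  - rewrite [leRHS]rmorphM /= ler_pM ?mxn_ge0 ?mulr_ge0 //.
    by rewrite rmorphM /= rmorph_nat ler_pM2l // natC lecR.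
rewrite lecR -exprM -exprS mulrA -exprD.
have -> : (7 * n + j + 6 = ((2 * n + 1) * 2 + n.+1) + (2 * n + j + 3))%N by lia.
by rewrite pow2VM.
Qed.

Section FrameApproximation.
Variables (N r : nat) (F : 'M[C]_(N, r)) (s : seq (seq C)) (e : RR).
Hypotheses (hF : F ^t* *m F = 1%:M) (sz : size s = r) (e01 : 0 <= e <= 1).
Hypothesis hs : forall (i : 'I_N) (k : 'I_r), nm (F i k - ent s k i) <= e.

Lemma product_close (a b a' b' : C) : nm a <= 1 -> nm b <= 1 ->
  nm (a - a') <= e -> nm (b - b') <= e -> nm (a' * b' - a * b) <= 3 * e.
Proof.
move=> ha hb haa hbb; have /andP[e0 e1] := e01.
have -> : a' * b' - a * b = (a' - a) * b' + a * (b' - b) by ring.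
apply: le_trans (nmD _ _) _; rewrite !nmM (nm_dist a') (nm_dist b').
have hb' : nm b' <= 2.
  by have := nm_tri b' b 0; rewrite !subr0 nm_dist; lra.
have := nm_ge0 (a - a'); have := nm_ge0 (b - b'); have := nm_ge0 a; have := nm_ge0 b'.
move=> *; nra.
Qed.

Lemma F_entry i k : nm (F i k) <= 1.
Proof. by rewrite -lecR -nmE; apply: isometry_entry hF. Qed.

Lemma nm_conj (z : C) : nm (z^*) = nm z.
Proof. by apply: complexI; rewrite -!nmE norm_conjC. Qed.

Lemma gram_close (k l : nat) : (k < r)%N -> (l < r)%N ->
  nm (gram N s k l - (k == l)%:R) <= N%:R * (3 * e).
Proof.
move=> hk hl; have /matrixP/(_ (Ordinal hk) (Ordinal hl)) := hF.
rewrite [X in _ = X]mxE => <-; rewrite mxE /gram /bsum -sumrB.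
apply: le_trans (nm_sum _ _) _; apply: le_trans (_ : \sum_(i < N) 3 * e <= _).
  apply: ler_sum => i _; rewrite adjmxE; apply: product_close.
  - by rewrite nm_conj F_entry.
  - exact: F_entry.
  - by rewrite -rmorphB nm_conj; apply: (hs i (Ordinal hk)).
  - exact: (hs i (Ordinal hl)).
by rewrite sumr_const card_ord [leRHS]mulr_natl.
Qed.

Lemma proj_close (i l : 'I_N) :
  nm (proj s i l - (F *m F ^t*) i l) <= r%:R * (3 * e).
Proof.
rewrite mxE /proj /bsum sz -sumrB; apply: le_trans (nm_sum _ _) _.
apply: le_trans (_ : \sum_(k < r) 3 * e <= _).
  apply: ler_sum => k _; rewrite adjmxE; apply: product_close.
  - exact: F_entry.
  - by rewrite nm_conj F_entry.
  - exact: hs.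
  - by rewrite -rmorphB nm_conj.
by rewrite sumr_const card_ord [leRHS]mulr_natl.
Qed.
End FrameApproximation.

Lemma trace_frame (n r : nat) (rho : 'M[C]_n) (W : 'M[C]_(n, r)) :
  \tr (rho *m (W *m W ^t*)) = \sum_k ((col k W) ^t* *m rho *m col k W) 0 0.
Proof.
rewrite mulmxA mxtrace_mulC mulmxA /mxtrace; apply: eq_bigr => k _.
rewrite !mxE; apply: eq_bigr => i _; rewrite !mxE; congr (_ * _).
by apply: eq_bigr => l _; rewrite !mxE.
Qed.

Lemma trace_frame_ge0 (n r : nat) (rho : 'M[C]_n) (W : 'M[C]_(n, r)) :
  density_matrix rho -> 0 <= \tr (rho *m (W *m W ^t*)).
Proof. by move=> [_ pos _]; rewrite trace_frame sumr_ge0. Qed.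

Lemma trace_proj_ge0 (n : nat) (rho P : 'M[C]_n) :
  density_matrix rho -> hprojection P -> 0 <= \tr (rho *m P).
Proof. by move=> hr [h1 h2]; rewrite -h2 -{2}h1; apply: trace_frame_ge0. Qed.

Lemma trace_close (n : nat) (rho P Q : 'M[C]_n) (eps del : RR) :
  density_matrix rho -> 0 <= \tr (rho *m P) -> 0 <= \tr (rho *m Q) ->
  mxn (P - Q) <= del%:C%C -> Complex eps 0 < \tr (rho *m P) ->
  Complex (eps - del) 0 < \tr (rho *m Q).
Proof.
move=> hr p0 q0 hd hP.
have := le_trans (density_trace_bound _ hr) hd; rewrite mulmxBr raddfB /=.
move: hP; rewrite -(RRe_real (ger0_real p0)) -(RRe_real (ger0_real q0)).
rewrite -[Complex eps 0]/(eps%:C)%C -[Complex (eps - del) 0]/((eps - del)%:C)%C.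
rewrite -rmorphB nmE nm_real lecR !ltcR => h1 h2.
by have := ler_norm (complex.Re (\tr (rho *m P)) - complex.Re (\tr (rho *m Q))); lra.
Qed.

(** * Decoding machine outputs *)

Lemma alg_dec_algebraic (c : nat) (z : C) : alg_dec c z -> is_algebraic z.
Proof.
rewrite /alg_dec; set q := Poly _ => -[q0 qz _ _].
exists (Poly [seq rat_dec k | k <- seq_dec (unpair c).1]).
have e : map_poly (ratr : rat -> C) (Poly [seq rat_dec k | k <- seq_dec (unpair c).1]) = q.
  by rewrite map_Poly ?rmorph0 // -map_comp.
split; last by rewrite e.
by apply: contraNneq q0 => p0; rewrite -e p0 map_poly0.
Qed.

Lemma vec_decP (N c : nat) (v : 'cV[C]_N) (w : seq alg) :
  rep c w -> size w = N -> (forall i : 'I_N, alg_val (nth (Alg 0) w i) = v i 0) ->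
  vec_dec c v.
Proof.
move=> /(rep_listP _ (Alg 0))[sz h] sw hv; split; first by rewrite sz.
by move=> i; rewrite -hv; apply: h; rewrite sw.
Qed.

Lemma mx_decP (N c : nat) (S : 'M[C]_N) (f : nat -> nat -> C) :
  rep c (mkseq (fun i => mkseq (fun l => Alg (f i l)) N) N) ->
  (forall i l : 'I_N, f i l = S i l) -> mx_dec c S.
Proof.
move=> /(rep_listP _ [::])[sz h] hf; rewrite size_mkseq in sz h; split=> // i.
have := h i (ltn_ord i); rewrite nth_mkseq // => hi.
apply: vec_decP hi _ _; first by rewrite size_mkseq.
by move=> l; rewrite nth_mkseq //= !mxE hf.
Qed.

Lemma vset_decP (N c : nat) (s : seq (seq C)) :
  rep c (mkseq (fun k => mkseq (fun i => Alg (ent s k i)) N) (size s)) ->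
  vset_dec c [seq col k (fmx N s) | k <- enum 'I_(size s)].
Proof.
move=> /(rep_listP _ [::])[sz h]; rewrite size_mkseq in sz h.
rewrite /vset_dec size_map size_enum_ord sz; split=> // k hk.
rewrite (nth_map (Ordinal hk)) ?size_enum_ord //.
rewrite (nth_ord_enum _ (Ordinal hk)); have := h k hk; rewrite nth_mkseq // => hc.
apply: vec_decP hc _ _; first by rewrite size_mkseq.
by move=> i; rewrite nth_mkseq //= !mxE.
Qed.

(** * From machines to Schnorr tests *)

(** The exponent of an exact power of two, and 0 otherwise; comparing [2 ^ lg N] with N then
    recognizes the powers of two. *)
Definition lg (N : nat) : nat :=
  iteri N (fun i s => if (2 ^ i == N)%N then i else s) 0%N.

Lemma lg_pow2 (n : nat) : lg (2 ^ n) = n.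
Proof.
have H k : iteri k (fun i s => if (2 ^ i == 2 ^ n)%N then i else s) 0%N =
    (if n < k then n else 0)%N.
  elim: k => //= k ->; rewrite eqn_exp2l // ltnS.
  by case: (ltngtP n k) => // ->.
by rewrite /lg H ltn_expl.
Qed.

Definition cmx (N : nat) (F : seq 'cV[C]_N) : 'M[C]_(N, size F) :=
  \matrix_(i, k) (F`_k) i 0.

Lemma precision_split (n j : nat) : (n + 2 + (9 * n + j + 6) = 10 * n + j + 8)%N.
Proof. lia. Qed.

Lemma precision_le (n j : nat) : (2 * n + (j + 3) <= 9 * n + j + 6)%N.
Proof. lia. Qed.

Section MachineTest.
Variables (M : prf) (r : nat -> nat -> nat) (f : nat -> nat -> C) (j : nat).
Hypotheses (hr : clock M r) (cf : computable (fun q : nat * nat => f q.1 q.2))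
  (hf : forall c k z, alg_dec c z -> nm (z - f c k) <= 2 ^- k).

(* The index m encodes an input and a time bound; [halts_at m] holds when the
   bound is the first one at which the machine is seen to halt. *)
Definition halts_at (m : nat) : bool :=
  ~~ (r (unpair m).1 (unpair m).2 == 0%N) &&
  (((unpair m).2 == 0%N) || (r (unpair m).1 (unpair m).2.-1 == 0%N)).

Definition rows (m : nat) : seq (seq nat) :=
  [seq seq_dec y | y <- seq_dec (r (unpair m).1 (unpair m).2).-1].

Definition width (m : nat) : nat := size (nth [::] (rows m) 0).

(** With n qubits the Gram error is at most 3 * 2^n * 2^-(10n+j+8), which is below the 2^-(9n+j+6)
    demanded by [near_frame_projection]. *)
Definition appf (m : nat) : seq (seq C) :=
  mkseq (fun k => mkseq (fun i =>
    f (nth 0%N (nth [::] (rows m) k) i) (10 * lg (width m) + j + 8)) (width m))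
    (size (rows m)).

(** A decidable substitute for orthonormality: true orthonormal outputs pass it, and anything that
    passes is close to a projection of the right rank. *)
Definition near_on (m : nat) : bool :=
  all (fun k => all (fun l => nrm2 (gram (width m) (appf m) k l - (k == l)%:R) <=
     2 ^- (2 * (9 * lg (width m) + j + 6))) (iota 0 (size (rows m))))
    (iota 0 (size (rows m))).

(** The inequality |F| 2^|p| <= 2^n encodes |p| + log |F| <= n without logarithms, and says that the
    tau-mass is at most 2^-|p|. It also gives |F| <= 2^n. *)
Definition good (m : nat) : bool :=
  halts_at m && ((0 < size (rows m))%N && ((2 ^ lg (width m) == width m)%N &&
  ((size (rows m) * 2 ^ (str_info (unpair m).1).2 <= width m)%N && near_on m))).

(** A test is a total sequence, so indices that are not good are filled with the zero projection on
    zero qubits. *)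
Definition tdim (m : nat) : nat := if good m then lg (width m) else 0%N.
Definition tgt (m i l : nat) : C := if good m then proj (appf m) i l else 0.
Definition weight (m : nat) : RR :=
  if halts_at m then 2 ^- (str_info (unpair m).1).2 else 0.

Lemma comp_test : [/\ computable tdim, computable weight &
  computable (fun q : nat * (nat * nat) => tgt q.1 q.2.1 q.2.2)].
Proof.
have [cr _ _] := hr.
have c1 : computable halts_at by rewrite /halts_at; comp.
have c2 : computable rows by rewrite /rows; comp.
have c3 : computable width by rewrite /width; comp.
have c4 : computable lg by rewrite /lg; comp.
have c5 : computable appf by rewrite /appf; comp.
have c6 : computable near_on by rewrite /near_on /gram /ent; comp.
have c7 : computable good by rewrite /good; comp.
by split; [rewrite /tdim|rewrite /weight|rewrite /tgt /proj /ent]; comp.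
Qed.

Lemma test_projection (m : nat) : exists P : 'M[C]_(2 ^ tdim m),
  [/\ hprojection P, \tr P = (if good m then size (rows m) else 0%N)%:R &
   forall i l : 'I_(2 ^ tdim m), nm (P i l - tgt m i l) <= 2 ^- (2 * tdim m + j + 3)].
Proof.
rewrite /tgt /tdim; case: ifP => [g|_]; last first.
  exists 0; split; first by split; rewrite ?mulmx0 // trmx0 map_mx0.
    by rewrite mxtrace0.
  by move=> i l; rewrite mxE subrr (nm_real 0) normr0 ltW // pow2V_gt0.
move/and5P: g => [_ _ /eqP wE hs /all_iotaP hg].
have sz : size (appf m) = size (rows m) by rewrite size_mkseq.
have [||P [h1 h2 h3]] := @near_frame_projection (lg (width m)) j (appf m).
- rewrite sz wE; apply: leq_trans hs; rewrite leq_pmulr // expn_gt0 //.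
- move=> k l; rewrite sz => hk hl; rewrite wE -nm_le_2X.
  by have /all_iotaP/(_ _ hl) := hg _ hk.
by exists P; rewrite h2 sz.
Qed.

Lemma weight_ge0 (m : nat) : 0 <= weight m.
Proof. by rewrite /weight; case: ifP => // _; rewrite ltW // pow2V_gt0. Qed.

Lemma halts_at_inj (m m' : nat) : halts_at m -> halts_at m' ->
  (unpair m).1 = (unpair m').1 -> m = m'.
Proof.
have [_ mono _] := hr.
move=> /andP[h1 h2] /andP[h3 h4] e; rewrite -[m]npair_unpair -[m']npair_unpair.
rewrite e in h1 h2 *; congr npair; move: (unpair m').1 (unpair m).2 (unpair m').2 h1 h2 h3 h4.
have aux x t t' : (t < t')%N -> r x t != 0%N -> (t' == 0%N) || (r x t'.-1 == 0%N) -> False.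
  case: t' => // t'; rewrite ltnS => lt h /= /eqP.
  by case E: (r x t) h => [|y] // _; rewrite (mono _ _ _ _ lt E).
move=> x t t' h1 h2 h3 h4; case: (ltngtP t t') => // lt.
  by case: (aux _ _ _ lt h1 h4).
by case: (aux _ _ _ lt h3 h2).
Qed.

Lemma halts_at_exists (x y : nat) : peval M x y -> exists m,
  [/\ halts_at m, (unpair m).1 = x & (r (unpair m).1 (unpair m).2).-1 = y].
Proof.
have [_ mono spec] := hr.
move=> /spec[t0 h0]; have ex : exists t, r x t != 0%N by exists t0; rewrite h0.
case: (ex_minnP ex) => t ht tmin; exists (npair x t); rewrite /halts_at unpair_npair ht.
split=> //.
  case: t {ht} tmin => // t tmin /=.
  by apply: contraT => /tmin; rewrite ltnn.
case E: (r x t) ht => [|y'] // _ /=; case: (leqP t t0) => h.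
  by have := mono _ _ _ _ h E; rewrite h0 => -[].
by have := mono _ _ _ _ (ltnW h) h0; rewrite E => -[].
Qed.

(** Each halting input has exactly one index with [halts_at], so these indices are in bijection with
    the domain. *)
Lemma esum_weight :
  (\esum_(m in [set: nat]) (weight m)%:E = domain_measure M)%E.
Proof.
have [_ mono spec] := hr.
have [bdec hb] := choice bcode_surj.
pose e m := bdec (unpair m).1.
have bij : set_bij [set m | halts_at m] [set p | halts_on M p] e.
  split.
  - move=> m /andP[h _]; exists (r (unpair m).1 (unpair m).2).-1.
    by rewrite /e hb; apply/spec; exists (unpair m).2; rewrite prednK // lt0n.
  - move=> m m' /set_mem h /set_mem h' /(congr1 bcode); rewrite /e !hb.
    exact: halts_at_inj.
  - move=> p [y /halts_at_exists[m [h1 h2 _]]]; exists m => //.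
    by apply: bcode_inj; rewrite /e hb.
rewrite /domain_measure (@reindex_esum _ _ _ _ _ e _ bij) [RHS]esum_mkcond.
apply: eq_esum => m _; rewrite /weight.
have -> : (m \in [set m | halts_at m]%classic) = halts_at m by apply/idP/idP; rewrite inE.
have <- : bcode (e m) = (unpair m).1 by rewrite /e hb.
by rewrite str_infoE /=; case: ifP.
Qed.

Lemma good_of_frame (n : nat) (p : seq bool) (y : nat) (F : seq 'cV[C]_(2 ^ n)) :
  peval M (bcode p) y -> vset_dec y F -> Defs.orthonormal F -> (0 < size F)%N ->
  (size F * 2 ^ size p <= 2 ^ n)%N ->
  exists m, [/\ good m, tdim m = n, size (appf m) = size F,
    (cmx F) ^t* *m cmx F = 1%:M &
    forall (i : 'I_(2 ^ n)) (k : 'I_(size F)),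
      nm ((F`_k) i 0 - ent (appf m) k i) <= 2 ^- (10 * n + j + 8)].
Proof.
move=> ev [szF hF] on F0 hsz.
have [m [hm mx my]] := halts_at_exists ev; exists m.
have rE : rows m = [seq seq_dec w | w <- seq_dec y] by rewrite /rows my.
have szr : size (rows m) = size F by rewrite rE size_map szF.
have rowE k : (k < size F)%N -> size (nth [::] (rows m) k) = (2 ^ n)%N /\
    forall i : 'I_(2 ^ n), alg_dec (nth 0%N (nth [::] (rows m) k) i) ((F`_k) i 0).
  move=> hk; rewrite rE (nth_map 0%N) -?szF //.
  by have [h1 h2] := hF k hk.
have wE : width m = (2 ^ n)%N by have [] := rowE _ F0.
have lE : lg (width m) = n by rewrite wE lg_pow2.
have sza : size (appf m) = size F by rewrite size_mkseq szr.
have on' : (cmx F) ^t* *m cmx F = 1%:M.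
  apply/matrixP => k l; rewrite [RHS]mxE -(on k l) // !mxE.
  by apply: eq_bigr => i _; rewrite !mxE.
have hent (i : 'I_(2 ^ n)) (k : 'I_(size F)) :
    nm ((F`_k) i 0 - ent (appf m) k i) <= 2 ^- (10 * n + j + 8).
  rewrite /ent /appf wE lg_pow2 nth_mkseq ?szr // nth_mkseq //.
  by apply: hf; have [_] := rowE k (ltn_ord k).
have g : good m.
  rewrite /good hm szr F0 lE wE eqxx /= mx str_infoE hsz /=.
  apply/all_iotaP => k; rewrite szr => hk; apply/all_iotaP => l hl.
  rewrite nm_le_2X lE wE.
  have := @gram_close _ _ _ (appf m) (2 ^- (10 * n + j + 8)) on' _ _ k l hk hl.
  move=> h; apply: le_trans (h _ _) _.
  - by rewrite ltW ?pow2V_gt0 // pow2V_le1.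
  - by move=> i u; rewrite mxE.
  apply: le_trans (_ : 2 ^+ (n + 2) * 2 ^- ((n + 2) + (9 * n + j + 6)) <= _); last first.
    by rewrite pow2VM.
  rewrite precision_split.
  rewrite mulrA ler_pM2r ?pow2V_gt0 // natrX exprD ler_pM2l ?exprn_gt0 //.
  by rewrite -natrX ler_nat.
by split; rewrite // /tdim g.
Qed.
End MachineTest.

Lemma pow2V_small (x : RR) : 0 < x -> exists k : nat, 2 ^- k < x.
Proof.
move=> x0; have xi : 0 <= x^-1 by rewrite invr_ge0 ltW.
exists (Num.truncn x^-1).+1; have /andP[_ hk] := truncn_itv xi.
rewrite -[ltRHS]invrK ltf_pV2 ?posrE ?exprn_gt0 ?invr_gt0 //.
by apply: lt_trans hk _; rewrite -natrX ltr_nat ltn_expl.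
Qed.

Lemma log2_le (a b : nat) (x : RR) : (0 < a)%N -> b%:R + log2 a%:R <= x ->
  0 <= x /\ forall n : nat, x <= n%:R -> (a * 2 ^ b <= 2 ^ n)%N.
Proof.
move=> a0; have ln20 : 0 < ln (2 : RR) by rewrite ln_gt0 // ltr1n.
have la : 0 <= ln (a%:R : RR) by rewrite ln_ge0 // ler1n.
rewrite /log2 => h; have l0 : 0 <= ln (a%:R : RR) / ln 2 by rewrite divr_ge0 // ltW.
have b0 : 0 <= b%:R :> RR by [].
split=> [|n xn]; first by lra.
rewrite -(ler_nat RR) natrM !natrX -ler_ln ?posrE ?mulr_gt0 ?exprn_gt0 ?ltr0n //.
rewrite lnM ?posrE ?exprn_gt0 ?ltr0n // !lnXn // -[_ *+ b]mulr_natl -[_ *+ n]mulr_natl.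
rewrite addrC -lerBrDl -mulrBl -ler_pdivrMr //; lra.
Qed.

Lemma schnorr_machine (rho : forall n : nat, 'M[C]_(2 ^ n)) : is_state rho ->
  quantum_schnorr_random rho ->
  forall M : prf, computable_measure_machine M ->
  forall eps : RR, 0 < eps ->
  exists d : RR, 0 < d /\ forall n : nat, ((n%:R - d)%:E < QK M eps (rho n))%E.
Proof.
move=> [hden _] hS M [_ [mu [muE cmu]]] eps eps0.
have [r hr] := clock_exists M; have [f cf hf] := alg_approx.
have [j hj] : exists j : nat, 2 ^- j < eps / 4 by apply: pow2V_small; rewrite divr_gt0.
have [cdim cw ctgt] := comp_test j hr cf.
pose P m := projT1 (cid (test_projection r f j m)).
have hP m := projT2 (cid (test_projection r f j m)).
have [||s cs hs] := @frame_search (tdim r f j) (tgt r f j) j P cdim ctgt.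
- by move=> m; have [] := hP m.
- by move=> m; have [] := hP m.
pose dim := tdim r f j.
pose S m : 'M[C]_(2 ^ dim m) := fmx (2 ^ dim m) (s m) *m (fmx (2 ^ dim m) (s m)) ^t*.
have szs m : size (s m) = (if good r f j m then size (rows r m) else 0%N).
  have [_ _ h] := hs m; have [_ h' _] := hP m; move: h; rewrite -/(P m) in h'.
  by rewrite h' => /eqP; rewrite eqr_nat => /eqP.
have hpS m : hprojection (S m) by have [h _ _] := hs m; apply: isometry_hprojection.
have tauE m : tauS (S m) = (size (s m))%:R * 2 ^- dim m.
  rewrite /tauS; have [h _ _] := hs m; rewrite (isometry_trace h) natC /=.
  by rewrite mulrC.
have tau0 m : 0 <= tauS (S m) by rewrite tauE mulr_ge0 // ltW // pow2V_gt0.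
have ctau : computable (fun m => tauS (S m)).
  apply: (@comp_ext _ _ _ _ (fun m => (size (s m))%:R * 2 ^- dim m)); first by move=> m.
  by rewrite /dim; comp.
have tau_le m : tauS (S m) <= weight r m.
  rewrite tauE szs /dim /tdim /weight; case: ifP => g.
    move/and5P: g => [-> _ /eqP wE hsz _]; rewrite -wE in hsz.
    rewrite ler_pdivrMr ?exprn_gt0 // ler_pdivlMl ?exprn_gt0 //.
    by rewrite -!natrX -natrM ler_nat mulnC.
  by rewrite mul0r; case: ifP => // _; rewrite ltW // pow2V_gt0.
have wmod : sum_modulus (weight r).
  apply: (modulus_of_esum (weight_ge0 _) cw _ cmu).
  by rewrite (esum_weight hr).
(* Only here does the computable domain measure enter: it bounds the tails of the weights, hence
   those of the masses. *)
have [R [RE cR]] := esum_of_modulus tau0 ctau (sum_modulus_le tau_le wmod).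
have [e he] : computable (fun m => (dim m, mkseq (fun i => mkseq (fun l =>
    Alg (proj (s m) i l)) (2 ^ dim m)) (2 ^ dim m))).
  by rewrite /dim /proj /ent; comp.
have hcode m : exists y, peval e m y /\ sqmx_dec y (S m).
  have [y p1 [h1 h2]] := he m m erefl; exists y; split=> //; split=> //.
  by apply: mx_decP h2 _ => i l; rewrite /S fmx_proj.
have test : quantum_schnorr_test S.
  split; last by exists R.
  split; last by rewrite RE ltry.
  split; last by exists e.
  move=> m; have [h1 h2] := hpS m; split=> // i l.
  have [y [_ [_ [_ hy]]]] := hcode m; have [_ /(_ l)] := hy i.
  by rewrite !mxE => /alg_dec_algebraic.
have pass := hS _ _ test (eps / 4) (divr_gt0 eps0 (ltr0n _ 4)).
apply: contrapT => hno; apply: pass => N.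
(* A description beating this d forces n above the dimensions of the first N projections, so the
   index it yields is at least N. *)
pose d : RR := (\sum_(m < N) dim m)%N%:R + 2.
have d0 : 0 < d by rewrite ltr_wpDl.
have [n hn] : exists n : nat, ~ ((n%:R - d)%:E < QK M eps (rho n))%E.
  by apply: contrapT => /forallNP h; apply: hno; exists d; split=> // n; apply: contrapT.
(* The infimum need not be attained, so one unit of d is spent to obtain an actual description. *)
have [p [y [F [ev vs on hF val]]]] : exists (p : seq bool) (y : nat)
      (F : seq 'cV[C]_(2 ^ n)),
    [/\ peval M (bcode p) y, vset_dec y F, Defs.orthonormal F,
        Complex eps 0 < \sum_(v <- F) (v ^t* *m rho n *m v) 0 0 &
        (size p)%:R + log2 (size F)%:R < n%:R - d + 1].
  apply: contrapT => hall; apply: hn.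
  apply: (@lt_le_trans _ _ (n%:R - d + 1)%:E); first by rewrite lte_fin; lra.
  apply: le_ereal_inf_tmp => _ [p [y [F [h1 h2 h3 h4 ->]]]].
  rewrite lee_fin leNgt; apply/negP => lt; apply: hall.
  by exists p, y, F.
have F0 : (0 < size F)%N.
  rewrite lt0n; apply/eqP => /size0nil e0; move: hF; rewrite e0 big_nil ltcE /=.
  by rewrite eqxx /= ltNge ltW.
have [x0 hx] := log2_le F0 (ltW val).
have [|m [g tE sz on' hent]] := good_of_frame j hr hf ev vs on F0.
  by apply: hx; rewrite /d; have : 0 <= (\sum_(m < N) dim m)%N%:R :> RR by []; lra.
exists m.
  rewrite leqNgt; apply/negP => mN.
  have : (dim m <= \sum_(m < N) dim m)%N.
    by rewrite (bigD1 (Ordinal mN)) //= leq_addr.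
  by rewrite -(ler_nat RR) /dim tE => h; move: x0; rewrite /d; lra.
set Fm := cmx F in on' hent.
have trF : \sum_(v <- F) (v ^t* *m rho n *m v) 0 0 = \tr (rho n *m (Fm *m Fm ^t*)).
  rewrite trace_frame (big_nth 0) big_mkord; apply: eq_bigr => k _.
  have -> // : col k Fm = F`_k by apply/matrixP => i z; rewrite !mxE ord1.
pose Q k : 'M[C]_(2 ^ k) := \matrix_(i, l) proj (appf r f j m) i l.
have sq (k e0 : nat) (A : 'M[C]_(2 ^ k)) :
    (forall i l, nm (A i l) <= 2 ^- (2 * k + e0)) -> mxn A <= (2 ^- e0 : RR)%:C%C.
  move=> h; apply: le_trans (_ : (2 ^ k * 2 ^ k)%:R * (2 ^- (2 * k + e0) : RR)%:C%C <= _).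
    by apply: mxn_bound => i l; rewrite nmE lecR.
  by rewrite natC -rmorphM lecR -expnD addnn -mul2n natrX pow2VM.
have hSQ : mxn (S m - Q (dim m)) <= (2 ^- j + 2 ^- (j + 3) : RR)%:C%C.
  have -> : S m - Q (dim m) = (S m - P m) + (P m - Q (dim m)) by rewrite addrA subrK.
  rewrite rmorphD; apply: le_trans (mxnD _ _) _; apply: lerD; first by have [] := hs m.
  apply: sq => i l; rewrite submxE mxE addnA.
  have tE' : tgt r f j m i l = proj (appf r f j m) i l by rewrite /tgt g.
  by rewrite -tE'; have [_ _ /(_ i l)] := hP m.
(* [dim m] equals n only propositionally, hence the generalization over k. The errors 2^-j and twice
   2^-(j+3) add up to at most 2 * 2^-j < eps/2. *)
have key k (A : 'M[C]_(2 ^ k)) : k = n -> hprojection A ->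
    mxn (A - Q k) <= (2 ^- j + 2 ^- (j + 3) : RR)%:C%C ->
    Complex (eps / 4) 0 < rhoS rho A.
  move=> kn; subst k => hA hAQ; rewrite /rhoS.
  have hQF : mxn (Q n - Fm *m Fm ^t*) <= (2 ^- (j + 3) : RR)%:C%C.
    apply: sq => i l; rewrite submxE [Q n i l]mxE.
    have e01 : 0 <= (2 : RR) ^- (10 * n + j + 8) <= 1.
      by rewrite ltW ?pow2V_gt0 // pow2V_le1.
    have := @proj_close _ _ Fm (appf r f j m) _ on' sz e01.
    move=> /(_ _ i l) h; apply: le_trans (h _) _.
      by move=> i1 k1; rewrite mxE.
    apply: le_trans (_ : 2 ^+ (n + 2) * 2 ^- ((n + 2) + (9 * n + j + 6)) <= _); last first.
      by rewrite pow2VM; apply: pow2V_le; apply: precision_le.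
    rewrite precision_split.
    rewrite mulrA ler_pM2r ?pow2V_gt0 // exprD ler_pM //.
      rewrite -natrX ler_nat.
      have : (size F * 2 ^ size p <= 2 ^ n)%N.
        by apply: hx; rewrite /d; have : 0 <= (\sum_(m < N) dim m)%N%:R :> RR by []; lra.
      by apply: leq_trans; rewrite leq_pmulr // expn_gt0.
    by rewrite -natrX ler_nat.
  have dF : density_matrix (rho n) by exact: hden.
  have := @trace_close _ (rho n) (Fm *m Fm ^t*) A eps (2 * 2 ^- j) dF.
  move=> /(_ (trace_frame_ge0 _ dF) (trace_proj_ge0 dF hA)) h.
  apply: lt_trans (_ : Complex (eps - 2 * 2 ^- j) 0 < _).
    by rewrite ltcR; lra.
  apply: h; last by rewrite -trF.
  have -> : Fm *m Fm ^t* - A = - ((A - Q n) + (Q n - Fm *m Fm ^t*)).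
    by rewrite addrA subrK opprB.
  rewrite mxnN; apply: le_trans (mxnD _ _) _; apply: le_trans (lerD hAQ hQF) _.
  rewrite -rmorphD lecR; have : (2 : RR) ^- (j + 3) <= 2 ^- (j + 1).
    by apply: pow2V_le; rewrite leq_add2l.
  have -> : (2 : RR) ^- j = 2 ^- (j + 1) + 2 ^- (j + 1).
    by rewrite addn1 exprS; field; rewrite expf_neq0.
  have := pow2V_gt0 (j + 1); lra.
exact: key tE (hpS m) hSQ.
Qed.

(** * From Schnorr tests to machines *)

(** Unlike [comp_search] this keeps divergence under control: the program halts exactly where a
    witness exists, which determines the domain of the machine built below. *)
Lemma partial_search (T : nat -> nat -> bool) :
  computable (fun q : nat * nat => T q.1 q.2) ->
  exists e, forall x n, peval e x n <-> T x n /\ forall k, (k < n)%N -> ~~ T x k.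
Proof.
move=> /comp_negb[e he].
exists (PMu (PComp e (PPair PSnd PFst))) => x n.
have ev k : peval (PComp e (PPair PSnd PFst)) (npair k x) (~~ T x k).
  have [|y p1 h] := he (npair x k) (x, k).
    by rewrite /rep /Rep_pair unpair_npair.
  rewrite -h; apply: ev_comp p1; rewrite -[npair x k]/(npair (k, x).2 (k, x).1).
  by rewrite -unpair_npair; apply: ev_pair; constructor.
split.
  move=> /peval_inv[h1 h2]; split.
    by have := peval_fun (ev n) h1; case: (T x n).
  by move=> k /h2[v v0 /(peval_fun (ev k)) e1]; move: v0; rewrite -e1; case: (T x k).
move=> [h1 h2]; apply: ev_mu; first by have := ev n; rewrite h1.
by move=> k /h2 kT; exists (nat_of_bool (~~ T x k)); rewrite ?kT //; have := ev k; rewrite kT.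
Qed.

Lemma bval_inj (p q : seq bool) : size p = size q -> bval p = bval q -> p = q.
Proof.
elim/last_ind: p q => [|p b IH] q; first by move/esym/size0nil => ->.
case/lastP: q => [|q c]; first by rewrite size_rcons.
rewrite !size_rcons => -[sz]; rewrite -!cats1 !bval_cat /bval /= -/(bval _) -/(bval _).
move=> h; have e : b = c by case: b h; case: c => //; rewrite ?expn1; lia.
by rewrite (IH q) ?e //; move: h; rewrite e expn1; lia.
Qed.

(* Kraft-Chaitin construction: the weights w m tile [0, 1) by consecutive
   intervals [a m, a m + w m), and each of these contains a dyadic interval of
   length at least w m / 4, whose address is the program for m. *)
Section Kraft.
Variable w : nat -> RR.
Hypotheses (w0 : forall m, 0 <= w m) (cw : computable w)
  (w1 : forall n, \sum_(m < n) w m <= 1).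

Definition kstart (m : nat) : RR := bsum m w.

Lemma kstartS (m : nat) : kstart m.+1 = kstart m + w m.
Proof. by rewrite /kstart /bsum big_ord_recr. Qed.

Lemma kstart_le (m n : nat) : (m <= n)%N -> kstart m <= kstart n.
Proof.
elim: n => [|n IH]; first by rewrite leqn0 => /eqP ->.
by rewrite leq_eqVlt => /orP[/eqP -> //|/IH h]; rewrite kstartS ler_wpDr.
Qed.

Lemma kraft_codes : exists l u : nat -> nat, [/\ computable l, computable u &
  forall m, 0 < w m -> [/\ w m < 4 * 2 ^- l m, 2 ^- l m <= w m,
    kstart m <= (u m)%:R * 2 ^- l m & ((u m).+1)%:R * 2 ^- l m <= kstart m.+1]].
Proof.
have cs : computable kstart by rewrite /kstart; comp.
(* An interval at least twice as long as the dyadic mesh contains an aligned dyadic interval, and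
   minimality of l loses at most another factor 2. Zero weights are accepted at once to keep the
   search total. *)
pose P m l := ~~ (0 < w m) || (2 ^- l + 2 ^- l <= w m).
have cP : computable (fun q : nat * nat => P q.1 q.2) by rewrite /P; comp.
have exP m : exists l, P m l.
  rewrite /P; case: (ltP 0 (w m)) => /= h; last by exists 0%N.
  have [|k hk] := @pow2V_small (w m / 2); first by rewrite divr_gt0.
  by exists k; lra.
have [l [cl Pl ml]] := comp_search cP exP.
pose Q m u := kstart m <= u%:R * 2 ^- l m.
have cQ : computable (fun q : nat * nat => Q q.1 q.2) by rewrite /Q; comp.
have s0 m : 0 <= kstart m by rewrite /kstart sumr_ge0.
have exQ m : exists u, Q m u.
  exists (2 ^ l m)%N; rewrite /Q natrX divff ?expf_neq0 //; exact: w1.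
have [u [cu Qu mu]] := comp_search cQ exQ.
exists l, u; split=> // m wm.
have hl := Pl m; rewrite /P wm /= in hl; have e0 := pow2V_gt0 (l m).
have wle : w m <= 1.
  by have := w1 m.+1; rewrite big_ord_recr /=; have := s0 m; rewrite /kstart /bsum; lra.
split.
- case E: (l m) hl => [|k] hl; first by rewrite expr0 invr1 in hl *; lra.
  have := ml m k; rewrite E ltnSn => /(_ isT); rewrite /P wm /= -ltNge.
  by rewrite [2 ^+ k.+1]exprS invfM; lra.
- by lra.
- exact: Qu.
- rewrite kstartS -natr1 mulrDl mul1r.
  suff : (u m)%:R * 2 ^- l m <= kstart m + 2 ^- l m by lra.
  case E: (u m) => [|k]; first by rewrite mul0r; have := s0 m; lra.
  have := mu m k; rewrite E ltnSn => /(_ isT); rewrite /Q -ltNge -[k.+1%:R]natr1 mulrDl mul1r; lra.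
Qed.

Variables (l u : nat -> nat).
Hypothesis lu : forall m, 0 < w m -> [/\ w m < 4 * 2 ^- l m, 2 ^- l m <= w m,
    kstart m <= (u m)%:R * 2 ^- l m & ((u m).+1)%:R * 2 ^- l m <= kstart m.+1].

Lemma kraft_string (m : nat) : exists p : seq bool, 0 < w m ->
  size p = l m /\ bval p = u m.
Proof.
case: (ltP 0 (w m)) => h; last by exists [::].
have [_ _ _ h4] := lu h; have [|p hp] := @bval_surj (l m) (u m); last by exists p.
have : ((u m).+1)%:R * 2 ^- l m <= 1 :> RR by apply: le_trans h4 _; exact: w1.
by rewrite ler_pdivrMr ?exprn_gt0 // mul1r -natrX ler_nat.
Qed.

(** A prefix means nested dyadic intervals, but those of different indices lie in different tiles of
    the unit interval. *)
Lemma kraft_disjoint (m n : nat) (p q : seq bool) : 0 < w m -> 0 < w n ->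
  size p = l m -> bval p = u m -> size q = l n -> bval q = u n ->
  prefix p q -> m = n.
Proof.
move=> wm wn sp vp sq vq /prefixP[t qE].
have [_ _ a1 a2] := lu wm; have [_ _ b1 b2] := lu wn.
have e0 := pow2V_gt0 (l m); have f0 := pow2V_gt0 (l n).
have lE : l n = (l m + size t)%N by rewrite -sq qE size_cat sp.
have uE : u n = (u m * 2 ^ size t + bval t)%N by rewrite -vq qE bval_cat vp.
have tl : (bval t)%:R + 1 <= (2 : RR) ^+ size t.
  by rewrite natr1 -natrX ler_nat bval_lt.
have eE : 2 ^- l m = 2 ^+ size t * 2 ^- l n :> RR by rewrite lE addnC pow2VM.
have unE : (u n)%:R = (u m)%:R * 2 ^+ size t + (bval t)%:R :> RR.
  by rewrite uE natrD natrM natrX.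
have lo : (u m)%:R * 2 ^- l m <= (u n)%:R * 2 ^- l n :> RR.
  by rewrite eE unE mulrA ler_pM2r // lerDl.
have hi : (u n)%:R * 2 ^- l n < ((u m).+1)%:R * 2 ^- l m :> RR.
  by rewrite eE unE mulrA ltr_pM2r // -[(u m).+1%:R]natr1 mulrDl mul1r; lra.
have lt1 : (u n)%:R * 2 ^- l n < (u n).+1%:R * 2 ^- l n :> RR by rewrite ltr_pM2r // ltr_nat.
by case: (ltngtP m n) => // lt; exfalso; have := kstart_le lt; lra.
Qed.
End Kraft.

Lemma log2_lt (a l K n : nat) : (0 < a)%N -> (2 ^ (l + K) * a < 2 ^ (n + 2))%N ->
  l%:R + log2 a%:R < n%:R + 2 - K%:R.
Proof.
move=> a0; have ln20 : 0 < ln (2 : RR) by rewrite ln_gt0 // ltr1n.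
rewrite -(ltr_nat RR) natrM !natrX -ltr_ln ?posrE ?mulr_gt0 ?exprn_gt0 ?ltr0n //.
rewrite lnM ?posrE ?exprn_gt0 ?ltr0n // !lnXn // -[_ *+ (l + K)]mulr_natl.
rewrite -[_ *+ (n + 2)]mulr_natl !natrD => h.
rewrite /log2; set x := ln a%:R in h *.
have -> : x / ln 2 = (x + (l%:R + K%:R) * ln 2) / ln 2 - (l%:R + K%:R).
  by field; rewrite gt_eqF.
have : (x + (l%:R + K%:R) * ln 2) / ln 2 < n%:R + 2 by rewrite ltr_pdivrMr //; lra.
by lra.
Qed.

Lemma pow2_cross (a : RR) (l K n : nat) :
  2 ^+ K * (a * 2 ^- n) < 4 * 2 ^- l -> 2 ^+ (l + K) * a < 2 ^+ (n + 2).
Proof.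
rewrite !exprD; have : 0 < (2 : RR) ^+ l by rewrite exprn_gt0.
have : 0 < (2 : RR) ^+ n by rewrite exprn_gt0.
move: (2 ^+ K) (2 ^+ l) (2 ^+ n) => Y X Z Z0 X0; rewrite ltr_pdivlMr //.
have -> : Y * (a / Z) * X = X * Y * a / Z by field; rewrite gt_eqF.
by rewrite ltr_pdivrMr // => h; rewrite expr2; lra.
Qed.

Lemma machine_schnorr (rho : forall n : nat, 'M[C]_(2 ^ n)) : is_state rho ->
  (forall M : prf, computable_measure_machine M ->
   forall eps : RR, 0 < eps ->
   exists d : RR, 0 < d /\
     forall n : nat, ((n%:R - d)%:E < QK M eps (rho n))%E) ->
  quantum_schnorr_random rho.
Proof.
move=> [hden _] hM dim S [[[spec [e he]] _] [R [RE cR]]] eps eps0 fails.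
have [y hy] := choice he.
have cy : computable y by exists e => x m ->; exists (y m) => //; have [] := hy m.
have dimE m : dim m = (unpair (y m)).1 by have [_ []] := hy m.
have cdim : computable dim.
  by apply: (@comp_ext _ _ _ _ (fun m => (unpair (y m)).1)); [move=> m|comp].
have [f cf hf] := alg_approx.
have [j hj] : exists j : nat, 2 ^- j < eps / 2 by apply: pow2V_small; rewrite divr_gt0.
pose B m i k := f (nth 0%N (seq_dec (nth 0%N (seq_dec (unpair (y m)).2) i)) k)
  (2 * dim m + j + 3)%N.
have hpS m : hprojection (S m) by have [h1 h2 _] := spec m.
have [||s cs hs] := @frame_search dim B j S cdim _ hpS.
- by rewrite /B; comp.
- move=> m i k; apply: hf; have [_ [_ [_ h]]] := hy m; have [_ /(_ k)] := h i.
  by rewrite !mxE.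
have tauE m : tauS (S m) = (size (s m))%:R * 2 ^- dim m.
  by rewrite /tauS; have [_ _ <-] := hs m; rewrite natC /= mulrC.
have tau0 m : 0 <= tauS (S m) by rewrite tauE mulr_ge0 // ltW // pow2V_gt0.
have ctau : computable (fun m => tauS (S m)).
  by apply: (@comp_ext _ _ _ _ (fun m => (size (s m))%:R * 2 ^- dim m)); [move=> m|comp].
have tmod : sum_modulus (fun m => tauS (S m)) by apply: modulus_of_esum RE cR.
have [G [cG Ginf G1 Gmod]] := divergent_weights tau0 tmod.
pose w m : RR := (G m)%:R * tauS (S m).
have w0 m : 0 <= w m by rewrite mulr_ge0.
have cw : computable w by rewrite /w; apply: comp_mulR; comp.
have [l [u [cl cu lu]]] := kraft_codes w0 cw G1.
pose T x m := (0 < w m) && (((str_info x).1 == u m) && ((str_info x).2 == l m)).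
have cT : computable (fun q : nat * nat => T q.1 q.2) by rewrite /T; comp.
have [et het] := partial_search cT.
have [eo heo] : computable (fun m => mkseq (fun k => mkseq (fun i =>
    Alg (ent (s m) k i)) (2 ^ dim m)) (size (s m))) by rewrite /ent; comp.
(* [et] finds the index m whose address is the given string, diverging if there is none; [eo] then
   prints the frame of index m. *)
pose M := PComp eo et.
have TP p m : T (bcode p) m <-> [/\ 0 < w m, size p = l m & bval p = u m].
  rewrite /T str_infoE /=; split=> [/and3P[h1 /eqP h2 /eqP h3] //|[-> -> ->]].
  by rewrite !eqxx.
have TM p m : T (bcode p) m -> exists2 c, peval M (bcode p) c &
    rep c (mkseq (fun k => mkseq (fun i => Alg (ent (s m) k i)) (2 ^ dim m)) (size (s m))).
  move=> h; have [c p1 h1] := heo m m erefl; exists c => //.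
  apply: ev_comp p1; apply/het; split=> // k km; apply/negP => /TP[k1 k2 k3].
  move/TP: h => [h2 h3 h4].
  have := kraft_disjoint w0 lu k1 h2 k2 k3 h3 h4 (prefix_refl p).
  by move=> e1; rewrite e1 ltnn in km.
have haltP p : halts_on M p <-> exists m, T (bcode p) m.
  split=> [[c /peval_inv[m /het[h _] _]]|[m /TM[c h _]]]; first by exists m.
  by exists c.
have pf : prefix_free_machine M.
  move=> p q /haltP[m /TP[h1 h2 h3]] /haltP[n /TP[h4 h5 h6]] pq.
  have e1 := kraft_disjoint w0 lu h1 h4 h2 h3 h5 h6 pq; subst n.
  by apply: bval_inj; rewrite ?h2 ?h3.
have [pi hpi] := choice (kraft_string G1 lu).
have Tpi m : 0 < w m -> T (bcode (pi m)) m by move=> h; apply/TP; have [] := hpi m h.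
(* The masses of the programs; being dominated by w, they have a computable sum, which is the domain
   measure. *)
pose v m : RR := if 0 < w m then 2 ^- l m else 0.
have v0 m : 0 <= v m by rewrite /v; case: ifP => // _; rewrite ltW // pow2V_gt0.
have cv : computable v by rewrite /v; comp.
have vw m : v m <= w m by rewrite /v; case: ifP => [/lu[]|].
have [r [rE cr]] := esum_of_modulus v0 cv (sum_modulus_le vw Gmod).
have cmm : computable_measure_machine M.
  split=> //; exists r; split=> //; rewrite -rE.
  have bij : set_bij [set m | 0 < w m]%classic [set p | halts_on M p] pi.
    split.
    - by move=> m h; apply/haltP; exists m; apply: Tpi.
    - move=> m n /set_mem h /set_mem h' e1.
      have [h1 h2] := hpi m h; have [h3 h4] := hpi n h'.
      by apply: (kraft_disjoint w0 lu h h' h1 h2 h3 h4); rewrite e1 prefix_refl.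
    - move=> p /haltP[m /TP[h1 h2 h3]]; exists m => //.
      by have [h4 h5] := hpi m h1; apply: bval_inj; rewrite ?h4 ?h5.
  rewrite /domain_measure (@reindex_esum _ _ _ _ _ pi _ bij) [LHS]esum_mkcond.
  apply: eq_esum => m _; rewrite /v.
  have -> : (m \in [set m | 0 < w m]%classic) = (0 < w m) by apply/idP/idP; rewrite inE.
  by case: ifP => // h; have [-> _] := hpi m h.
have [d [d0 hd]] := hM M cmm (eps / 2) (divr_gt0 eps0 (ltr0n _ 2)).
(* A weight G m >= 2^K brings the complexity below n + 2 - K, where the 2 comes from the factor 4 in
   [kraft_codes]; K > d + 2 then contradicts the bound n - d. *)
pose K := (Num.truncn d).+3.
have Kd : d + 2 < K%:R.
  by have /andP[_ h] := truncn_itv (ltW d0); rewrite /K -addn2 natrD; lra.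
have [m0 hm0] := Ginf K; have [m mm hfail] := fails m0.
have GK := hm0 m mm; pose W := fmx (2 ^ dim m) (s m).
have [hW hWS _] := hs m; rewrite -/W in hW hWS.
have dF : density_matrix (rho (dim m)) by exact: hden.
have hWr : Complex (eps / 2) 0 < \tr (rho (dim m) *m (W *m W ^t*)).
  apply: lt_trans (_ : Complex (eps - 2 ^- j) 0 < _); first by rewrite ltcR; lra.
  apply: trace_close dF (trace_proj_ge0 dF (hpS m)) (trace_frame_ge0 _ dF) _ hfail.
  by rewrite -mxnN opprB.
have s0 : (0 < size (s m))%N.
  rewrite lt0n; apply/eqP => e1; move: hWr; rewrite trace_frame big1.
    by rewrite ltcE /= eqxx /= ltNge divr_ge0 // ltW.
  by move=> k; have := leq_trans (ltn_ord k) (eq_leq e1).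
have wm : 0 < w m.
  rewrite mulr_gt0 ?ltr0n //; first by apply: leq_trans GK; rewrite expn_gt0.
  by rewrite tauE mulr_gt0 ?ltr0n // pow2V_gt0.
have [c evc repc] := TM _ _ (Tpi m wm).
have [spi _] := hpi m wm.
have := hd (dim m); apply/negP; rewrite -leNgt.
apply: le_trans (_ : ((l m)%:R + log2 (size (s m))%:R)%:E <= _)%E.
  apply: ereal_inf_lbound; exists (pi m), c,
    [seq col k W | k <- enum 'I_(size (s m))]; split=> //.
  - exact: vset_decP.
  - move=> i k; rewrite size_map size_enum_ord => hi hk.
    have cE (a : 'I_(size (s m))) : [seq col k W | k <- enum 'I_(size (s m))]`_a = col a W.
      by rewrite (nth_map a) ?size_enum_ord // nth_ord_enum.
    rewrite (cE (Ordinal hi)) (cE (Ordinal hk)).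
    have /matrixP/(_ (Ordinal hi) (Ordinal hk)) := hW; rewrite [X in _ = X]mxE => <-.
    by rewrite !mxE; apply: eq_bigr => a _; rewrite !mxE.
  - by rewrite big_map big_enum /= -trace_frame.
  - by rewrite spi size_map size_enum_ord.
rewrite lee_fin; have [w4 _ _ _] := lu m wm.
suff : (l m)%:R + log2 (size (s m))%:R < (dim m)%:R + 2 - K%:R by lra.
apply: log2_lt => //; rewrite -(ltr_nat RR) natrM !natrX.
have : (2 : RR) ^+ K * ((size (s m))%:R * 2 ^- dim m) < 4 * 2 ^- l m.
  apply: le_lt_trans w4; rewrite /w tauE ler_pM2r -?natrX ?ler_nat //.
  by rewrite mulr_gt0 ?ltr0n // natrX pow2V_gt0.
exact: pow2_cross.
Qed.

Theorem mainTheorem15 (rho : forall n : nat, 'M[C]_(2 ^ n)) (Hrho : is_state rho) :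
  quantum_schnorr_random rho <->
  (forall M : prf, computable_measure_machine M ->
   forall eps : RR, 0 < eps ->
   exists d : RR, 0 < d /\
     forall n : nat, ((n%:R - d)%:E < QK M eps (rho n))%E).
Proof.
by split; [apply: schnorr_machine | apply: machine_schnorr].
Qed.
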